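(* Let $s=1$, $n\ge2$, and let $\Omega\subseteq\mathbb{R}^n$ be an MSS applicable domain with center $P$ such that $\mathbb{R}^n\setminus\overline{\Omega}$ is a g-radially convex domain with radially convex center $P$. Suppose $P\in\mathbb{R}^n\setminus\overline\Omega$ and $\partial\Omega$ is locally Lipschitz. Let $f(x,u)$ be a real-valued function on $\Omega\times[0,+\infty)$ such that: (a) $f$ is subcritical; (b) there exist $d_\Omega<r<+\infty$, a cross-section $\Sigma\subseteq\Sigma^r_\Omega$, and constants $C>0$, $-2<a<+\infty$, $1\le p<p_c(a)$ such that $f(x,u)\ge C|x-P|^a u^p$ for all $(x,u)\in\mathcal{C}^{r,e}_{P,\Sigma}\times[0,+\infty)$; (c) there exists $u_0\in[0,+\infty)$ such that $f(\cdot,u_0)\in L^1(\Omega\cap B_R(P))$ for all $R>0$; (d) $f$ is locally $L^q$-Lipschitz on $u$ in $\Omega\times[0,+\infty)$, with $q=\frac n2$ if $n\ge3$ and $q=1+\delta$ ($\delta>0$ arbitrarily small) if $n=2$. Then there is no classical solution of the Dirichlet problem $-\Delta u=f(x,u)$ in $\Omega$, $u=0$ in $\mathbb{R}^n\setminus\Omega$, that is positive in $\Omega$. Moreover, if $f(x,u)\ge0$ in $\Omega\times[0,+\infty)$ and $u$ is a nonnegative classical solution of this Dirichlet problem, then $u\equiv0$ in $\Omega$.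
   Context: A domain $D\subseteq\mathbb{R}^n$ (bounded or unbounded) is g-radially convex with radially convex center $x_0\in\overline D$ if for every $x\in D$ the segment $\{(1-t)x_0+tx:t\in[0,1]\}$ is contained in $\overline D$. A simply connected domain $\Omega$ is MSS applicable with center $P$ if $\Omega$, or $\mathbb{R}^n\setminus\overline\Omega$, is g-radially convex with radially convex center $P$. A cross-section is a sub-domain $\Sigma$ of the unit sphere $S^{n-1}$. $\mathcal{C}_{P,\Sigma}:=\bigcup_{0<r<+\infty}(r\Sigma+P)$, $\mathcal{C}^r_{P,\Sigma}:=\mathcal{C}_{P,\Sigma}\cap B_r(P)$, $\mathcal{C}^{r,e}_{P,\Sigma}:=\mathcal{C}_{P,\Sigma}\setminus\overline{\mathcal{C}^r_{P,\Sigma}}$. $d_\Omega:=\inf_{x\in\Omega}|x-P|$ and $\Sigma^r_\Omega:=r^{-1}\big((\partial B_r(P)\cap\Omega)-P\big)\subseteq S^{n-1}$. $p_c(a):=\frac{n+2+2a}{n-2}$ if $n>2$, and $p_c(a):=+\infty$ if $n=2$. Subcritical: if $n>2$, $\mu^{\frac{n+2}{n-2}}f(\mu^{\frac{2}{n-2}}(x-P)+P,\mu^{-1}u)$ is strictly increasing with respect to $\mu\ge1$ or $\mu\le1$ for all $(x,u)\in(\Omega\setminus\{P\})\times(0,+\infty)$; if $n=2$, $\mu^{2}f(\mu(x-P)+P,u)$ is strictly increasing with respect to $\mu\ge1$ or $\mu\le1$ for all $(x,u)\in(\Omega\setminus\{P\})\times(0,+\infty)$. Here $\mu$ ranges over values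 for which the first argument of $f$ lies in $\Omega$. Locally $L^q$-Lipschitz on $u$ in $\Omega\times[0,+\infty)$: for every $u_0\in[0,+\infty)$ and every bounded $\omega\subseteq\Omega$ there exist a relatively open neighborhood $U(u_0)\subset[0,+\infty)$ of $u_0$ and a nonnegative $h_{u_0}\in L^q(\omega)$ with $\sup_{u\neq v\in U(u_0)}\frac{|f(x,u)-f(x,v)|}{|u-v|}\le h_{u_0}(x)$ for all $x\in\omega$. Classical solution of the Dirichlet problem: $u\in C^2(\Omega)\cap C(\overline\Omega)$, $u=0$ in $\mathbb{R}^n\setminus\Omega$, and the equation holds pointwise in $\Omega$. *)

(* Defs.v *)
From HB Require Import structures.
From mathcomp Require Import all_boot all_order all_algebra.
From mathcomp Require Import all_classical all_reals all_analysis.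

Set Implicit Arguments.
Unset Strict Implicit.
Unset Printing Implicit Defensive.

Import Order.TTheory GRing.Theory Num.Theory.
Import numFieldNormedType.Exports.

Local Open Scope classical_set_scope.
Local Open Scope ring_scope.

(* The library norm on 'rV[R]_n is the sup norm.  It induces the usual
   topology and the usual bounded sets, but balls, spheres and distances have
   to be Euclidean. *)
Section euclidean.
Context {R : realType} {n : nat}.
Implicit Types (x y P : 'rV[R]_n) (r : R) (D : set 'rV[R]_n).

Definition enorm x : R := Num.sqrt (\sum_(i < n) x 0 i ^+ 2).

Definition eball P r : set 'rV[R]_n := [set x | enorm (x - P) < r].

Definition esphere P r : set 'rV[R]_n := [set x | enorm (x - P) = r].

Definition domain D := [/\ open D, connected D & D !=set0].

Definition path_connected D := forall x y, D x -> D y ->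
  exists g : R -> 'rV[R]_n, [/\ {within `[0, 1], continuous g},
    g 0 = x, g 1 = y & forall t : R, 0 <= t <= 1 -> D (g t)].

Definition null_homotopic D (g : R -> 'rV[R]_n) :=
  exists H : R * R -> 'rV[R]_n,
  [/\ {within `[0, 1] `*` `[0, 1], continuous H},
      forall s t : R, 0 <= s <= 1 -> 0 <= t <= 1 -> D (H (s, t)),
      forall t : R, 0 <= t <= 1 -> H (0, t) = g t /\ H (1, t) = g 0 &
      forall s : R, 0 <= s <= 1 -> H (s, 0) = g 0 /\ H (s, 1) = g 0].

Definition simply_connected D := path_connected D /\
  forall g : R -> 'rV[R]_n, {within `[0, 1], continuous g} ->
    g 0 = g 1 -> (forall t : R, 0 <= t <= 1 -> D (g t)) -> null_homotopic D g.

Definition g_radially_convex D x0 := [/\ domain D, closure D x0 &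
  forall x, D x -> forall t : R, 0 <= t <= 1 ->
    closure D ((1 - t) *: x0 + t *: x)].

Definition MSS_applicable (Omega : set 'rV[R]_n) P :=
  [/\ domain Omega, simply_connected Omega &
      g_radially_convex Omega P \/ g_radially_convex (~` closure Omega) P].

(* Near each boundary point, in suitable orthonormal coordinates z, the set
   is the strict epigraph z_i > gamma (z without its i-th coordinate) of a
   Lipschitz function gamma of n - 1 variables. *)
Definition lipschitz_boundary (Omega : set 'rV[R]_n) :=
  forall x, (closure Omega `\` interior Omega) x ->
  exists (Q : 'M[R]_n) (i : 'I_n) (gamma : 'rV[R]_n.-1 -> R) (rho : R),
    [/\ Q *m Q^T = 1%:M, 0 < rho, lipschitz gamma &
        forall y, eball x rho y ->
          let z := (y - x) *m Q in Omega y <-> gamma (col' i z) < z 0 i].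

Definition cross_section (Sigma : set 'rV[R]_n) :=
  [/\ exists2 O : set 'rV[R]_n, open O & Sigma = O `&` esphere 0 1,
      connected Sigma & Sigma !=set0].

Definition cone P (Sigma : set 'rV[R]_n) : set 'rV[R]_n :=
  \bigcup_(r in [set r : R | 0 < r]) [set r *: s + P | s in Sigma].

Definition cone_in P (Sigma : set 'rV[R]_n) r := cone P Sigma `&` eball P r.

Definition cone_out P (Sigma : set 'rV[R]_n) r :=
  cone P Sigma `\` closure (cone_in P Sigma r).

Definition dist_inf (Omega : set 'rV[R]_n) P : R :=
  inf [set enorm (x - P) | x in Omega].

Definition section_at (Omega : set 'rV[R]_n) P r : set 'rV[R]_n :=
  [set r^-1 *: (y - P) | y in esphere P r `&` Omega].

End euclidean.

(* The n-dimensional Lebesgue measure on Lebesgue-measurable sets: the n-fold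
   product of the one-dimensional measure, the outer measure it generates, and
   the measure on the Caratheodory sets of the latter. *)
Section lebesgue_rV.
Context {R : realType}.
Local Open Scope ereal_scope.

Fixpoint lebesgue_tuple n : set (n.-tuple R) -> \bar R :=
  match n with
  | 0%N => fun A => \d_([tuple]) A
  | m.+1 => fun A => \int[lebesgue_measure]_x
      lebesgue_tuple [set t : m.-tuple R | A [tuple of x :: t]]
  end.

Lemma lebesgue_tuple_ge0 n (A : set (n.-tuple R)) : 0 <= lebesgue_tuple A.
Proof. by elim: n A => [|n IHn] A //=; apply: integral_ge0. Qed.

Lemma lebesgue_tuple0 n : lebesgue_tuple (set0 : set (n.-tuple R)) = 0.
Proof.
elim: n => [|n IHn] /=; first by rewrite diracE in_set0.
by apply: integral0_eq => x _; rewrite -[RHS]IHn; congr lebesgue_tuple.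
Qed.

Definition lebesgue_outer n (A : set 'rV[R]_n) : \bar R :=
  mu_ext (@lebesgue_tuple n) [set t | A (\row_i tnth t i)].

Section outer_measure.
Variable n : nat.
Local Notation mu := (@lebesgue_outer n).

Let mu0 : mu set0 = 0.
Proof. exact: mu_ext0 (lebesgue_tuple0 n) (@lebesgue_tuple_ge0 n). Qed.

Let mu_ge0 A : 0 <= mu A.
Proof. exact: mu_ext_ge0 (@lebesgue_tuple_ge0 n) _. Qed.

Let le_mu : {homo mu : A B / A `<=` B >-> A <= B}.
Proof. by move=> A B AB; apply: le_mu_ext => t; exact: AB. Qed.

Let mu_sigma_subadditive : sigma_subadditive mu.
Proof.
move=> A; apply: le_trans; last first.
  exact: (mu_ext_sigma_subadditive (@lebesgue_tuple_ge0 n)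
    (fun k => [set t | A k (\row_i tnth t i)])).
by apply: le_mu_ext => t [k _ Akt]; exists k.
Qed.

HB.instance Definition _ := isOuterMeasure.Build R 'rV[R]_n mu
  mu0 mu_ge0 le_mu mu_sigma_subadditive.

End outer_measure.

Definition lebesgue_rV n :
  set (caratheodory_type (@lebesgue_outer n)) -> \bar R := @lebesgue_outer n.

HB.instance Definition _ n := isMeasure.Build _ _ _ (@lebesgue_rV n)
  (@caratheodory_measure0 R _ (@lebesgue_outer n))
  (@caratheodory_measure_ge0 R _ (@lebesgue_outer n))
  (@caratheodory_measure_sigma_additive R _ (@lebesgue_outer n)).

End lebesgue_rV.

Section integrability.
Context {R : realType} {n : nat}.
Implicit Types (D Omega : set 'rV[R]_n) (f : 'rV[R]_n -> R -> R).
Local Notation T := (caratheodory_type (@lebesgue_outer R n)).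
Local Notation mu := (@lebesgue_rV R n).

Definition Lq_on (D : set 'rV[R]_n) (q : R) (h : 'rV[R]_n -> R) :=
  measurable_fun (D : set T) (h : T -> R) /\
  (\int[mu]_(x in D) (`|h x| `^ q)%:E < +oo)%E.

(* Membership in L^q only makes sense on measurable sets: omega ranges over
   the Lebesgue-measurable bounded subsets of Omega. *)
Definition locally_Lq_lipschitz Omega (q : R) f :=
  forall u0 : R, 0 <= u0 -> forall omega : set 'rV[R]_n,
    measurable (omega : set T) -> bounded_set omega -> omega `<=` Omega ->
  exists (O : set R) (h : 'rV[R]_n -> R),
    [/\ open O, O u0, Lq_on omega q h &
        forall x, omega x -> 0 <= h x /\
          forall u v : R, 0 <= u -> 0 <= v -> O u -> O v -> u != v ->
            `|f x u - f x v| / `|u - v| <= h x].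

End integrability.

Section pde.
Context {R : realType} {n : nat}.
Implicit Types (Omega : set 'rV[R]_n) (P x : 'rV[R]_n) (u : 'rV[R]_n -> R).

Definition partial (i : 'I_n) u : 'rV[R]_n -> R := 'D_(delta_mx 0 i) u.

Definition C2_on Omega u := forall x, Omega x ->
  [/\ {for x, continuous u},
      forall i, derivable u x (delta_mx 0 i) /\
                {for x, continuous (partial i u)} &
      forall i j, derivable (partial i u) x (delta_mx 0 j) /\
                  {for x, continuous (partial j (partial i u))}].

Definition laplacian u x : R := \sum_(i < n) partial i (partial i u) x.

(* f is total on the type level, but only its values on Omega x [0, +oo[ are
   meaningful: u has to be nonnegative on Omega. *)
Definition classical_solution Omega (f : 'rV[R]_n -> R -> R) u :=
  [/\ C2_on Omega u, {within closure Omega, continuous u},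
      forall x, ~ Omega x -> u x = 0 &
      forall x, Omega x -> - laplacian u x = f x (u x)].

Definition p_c (a : R) : \bar R :=
  if (2 < n)%N then ((n%:R + 2 + 2 * a) / (n%:R - 2))%:E else +oo%E.

Definition scaled_point P x (mu : R) : 'rV[R]_n :=
  if (2 < n)%N then mu `^ (2 / (n%:R - 2)) *: (x - P) + P
  else mu *: (x - P) + P.

Definition scaled_nonlinearity P (f : 'rV[R]_n -> R -> R) x (u mu : R) : R :=
  if (2 < n)%N
  then mu `^ ((n%:R + 2) / (n%:R - 2)) * f (scaled_point P x mu) (mu^-1 * u)
  else mu ^+ 2 * f (scaled_point P x mu) u.

(* The range of mu is either [1, +oo[ for all (x, u) or ]0, 1] for all (x, u),
   intersected with the set of mu whose scaled point stays in Omega. *)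
Definition subcritical Omega P (f : 'rV[R]_n -> R -> R) :=
  let increasing_on (I : set R) :=
    forall x (u : R), Omega x -> x != P -> 0 < u ->
    forall mu nu : R, I mu -> I nu ->
      Omega (scaled_point P x mu) -> Omega (scaled_point P x nu) ->
      mu < nu -> scaled_nonlinearity P f x u mu < scaled_nonlinearity P f x u nu
  in increasing_on [set mu | 1 <= mu] \/ increasing_on [set mu | 0 < mu <= 1].

End pde.

Arguments p_c {R} n a.

(* Main.v *)
(** The method of moving spheres.  Since the exterior of Omega is radially convex
    and the boundary is Lipschitz, Omega is invariant under the dilations of centre
    P and ratio t >= 1.  Let u_l be the Kelvin transform of a positive solution u
    with respect to the sphere of centre P and radius l.  Subcriticality says that
    - Delta u_l > f(x, u_l) in the part of Omega inside the sphere, so u - u_l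
    satisfies - Delta phi <= H phi, with H in L^q, on the set E_l where it is
    positive; by Sobolev's inequality E_l is empty as soon as the integral of H^q
    over E_l is small.  This holds for small l.  If it failed for larger l, then
    near the first bad radius the sets E_l would shrink to a subset of a sphere,
    because the strict inequality excludes interior contact points; the integral
    would then tend to 0, a contradiction.  Hence u <= u_l inside every sphere, that
    is, |x - P|^((n-2)/2) u is nondecreasing along the rays from P.  In a ball of
    centre P + T s0 and radius proportional to T inside the cone this gives
    - Delta u >= K u with K T^2 unbounded, because p < p_c(a); for large T this is
    incompatible with the first Dirichlet eigenvalue of the ball.  The second
    assertion follows by the strong maximum principle.

    Sobolev's inequality is obtained on Riemann sums over a lattice, from the
    Loomis-Whitney inequality. *)
From HB Require Import structures.
Require Import Defs.
From mathcomp Require Import all_boot all_order all_algebra.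
From mathcomp Require Import all_classical all_reals all_analysis.
From mathcomp Require Import measurable_realfun.
From mathcomp Require Import ring lra zify.

Set Implicit Arguments.
Unset Strict Implicit.
Unset Printing Implicit Defensive.

Import Order.TTheory GRing.Theory Num.Theory.
Import numFieldNormedType.Exports.

Local Open Scope classical_set_scope.
Local Open Scope ring_scope.

(** * Lebesgue measure and Riemann sums *)

Section rV_norm.
Context {R : realType} {n : nat}.
Implicit Types v : 'rV[R]_n.

(** The boundary of a bad set E_l has no regularity. Cutting [u - u_l] off at a level e > 0 leaves
    functions that vanish on E_l outside a subset closed in the whole space, so that they extend by
    0; the price is an error of order e. The test function is the square of the cut-off difference
    z, because z itself is not of class C^1. All integrands are then continuous with compact
    support, hence limits of Riemann sums: integration by parts becomes telescoping, and Fubini's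
    theorem the exchange of finite sums. The square also yields the factor 2 by which the energy is
    absorbed. The weight H is merely measurable and enters through a comparison of integrals with a
    continuous function below it. The Sobolev constant may depend on the cube containing E_l (it
    does for n = 2), so one cube is fixed for all radii near the first bad one before passing to the
    limit. *)

Lemma coord_le_norm v i : `|v 0 i| <= `|v|.
Proof.
have -> : `|v| = mx_norm v by [].
by rewrite mx_normrE; exact: (le_bigmax _ (fun ij : 'I_1 * 'I_n => `|v ij.1 ij.2|) (0, i)).
Qed.

Lemma norm_rV_lt v e : 0 < e -> (forall i, `|v 0 i| < e) -> `|v| < e.
Proof.
move=> e0 h; have -> : `|v| = mx_norm v by [].
by rewrite mx_normrE bigmax_lt // => -[i j] _ /=; rewrite (ord1 i).
Qed.

Lemma norm_rV_le v e : 0 <= e -> (forall i, `|v 0 i| <= e) -> `|v| <= e.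
Proof.
move=> e0 h; have -> : `|v| = mx_norm v by [].
by rewrite mx_normrE bigmax_le // => -[i j] _ /=; rewrite (ord1 i).
Qed.

End rV_norm.

Lemma cvg_sum_seq {R : realType} {T I : Type} {F : set_system T} {FF : Filter F}
    (s : seq I) (f : I -> T -> R) (l : I -> R) :
  (forall i, f i x @[x --> F] --> l i) ->
  (\sum_(i <- s) f i x) @[x --> F] --> \sum_(i <- s) l i.
Proof.
move=> fl; elim: s => [|i s IH].
  rewrite big_nil; under eq_fun do rewrite big_nil; exact: cvg_cst.
rewrite big_cons; under eq_fun do rewrite big_cons; exact: cvgD.
Qed.

Definition nsq {R : realType} {n} (x : 'rV[R]_n) : R := \sum_(i < n) x 0 i ^+ 2.

Lemma nsq_continuous {R : realType} {n} : continuous (@nsq R n).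
Proof.
move=> x; apply: (@cvg_sum_seq R _ _ (nbhs x)) => i; under eq_fun do rewrite expr2.
by rewrite expr2; apply: cvgM; exact: coord_continuous.
Qed.

(** * Lebesgue measure on tuples and on row vectors *)

Section tuple_measure.
Context {R : realType}.
Local Open Scope ereal_scope.

Definition tuple_box n (a b : 'I_n -> R) : set (n.-tuple R) :=
  [set t | forall i, tnth t i \in `[a i, b i[].

Lemma measurable_tuple_box n (a b : 'I_n -> R) : measurable (tuple_box a b).
Proof.
have -> : tuple_box a b =
      \bigcap_(i in [set: 'I_n]) ((@tnth n R ^~ i) @^-1` `[a i, b i[).
  apply/seteqP; split=> t h i; first by move=> _; apply: h.
  exact: (h i I).
apply: fin_bigcap_measurable; first exact: finite_finset.
move=> i _; rewrite -[X in measurable X]setTI.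
exact: (measurable_tnth (n:=n) i).
Qed.

Lemma lebesgue_tuple_box n (a b : 'I_n -> R) : (forall i, (a i <= b i)%R) ->
  lebesgue_tuple (tuple_box a b) = (\prod_(i < n) (b i - a i))%R%:E.
Proof.
elim: n a b => [|n IH] a b ab /=.
  rewrite big_ord0 diracE; congr (_%:E).
  by rewrite mem_set //= => -[].
transitivity (\int[lebesgue_measure]_(x in `[a ord0, b ord0[)
  (\prod_(i < n) (b (lift ord0 i) - a (lift ord0 i)))%R%:E).
  rewrite [RHS]integral_mkcond; apply: eq_integral => x _.
  rewrite patchE; case: ifPn => hx.
    rewrite -IH; last by [].
    congr lebesgue_tuple; apply/seteqP; split=> t /= ht i.
      by have := ht (lift ord0 i); rewrite tnthS.
    case: (unliftP ord0 i) => [j ->|->]; first by rewrite tnthS.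
    by move: hx; rewrite inE.
  rewrite -[RHS](lebesgue_tuple0 n); congr lebesgue_tuple.
  apply/seteqP; split=> t //= ht.
  by move: hx; rewrite notin_setE /=; apply; exact: (ht ord0).
rewrite integral_cst //= lebesgue_measure_itv /= lte_fin.
rewrite big_ord_recl mulrC EFinM; congr (_ * _).
case: ltP => // h; have -> : b ord0 = a ord0 by apply/eqP; rewrite eq_le h ab.
by rewrite subrr.
Qed.

(** Integrating the measures of slices is the product of the one-dimensional measure with the
    measure in one dimension less, pushed forward by prepending a coordinate. Sigma-finiteness is
    part of the induction because the product needs it. *)
Lemma lebesgue_tuple_measure n : exists mu : {sigma_finite_measure set (n.-tuple R) -> \bar R},
  forall A, mu A = lebesgue_tuple A.
Proof.
elim: n => [|n [mu IH]].
  by exists (\d_([tuple] : 0.-tuple R)).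
pose cons (z : R * n.-tuple R) : n.+1.-tuple R := [tuple of z.1 :: z.2].
have mcons : measurable_fun setT cons by apply: measurable_cons.
pose nu0 := pushforward (lebesgue_measure \x mu) cons.
have nu0E A : nu0 A = lebesgue_tuple A.
  rewrite /nu0 /pushforward /product_measure1 /=.
  apply: eq_integral => x _; rewrite -IH /=; congr (mu _).
  by apply/seteqP; split=> t; rewrite /xsection /= inE.
have nu00 : nu0 set0 = 0 by rewrite nu0E lebesgue_tuple0.
have nu0ge A : 0 <= nu0 A by rewrite nu0E lebesgue_tuple_ge0.
have nu0s : semi_sigma_additive nu0.
  move=> F mF tF mUF; rewrite /nu0 /pushforward preimage_bigcup.
  apply: measure_semi_sigma_additive.
  - by move=> i; rewrite -[X in measurable X]setTI; apply: mcons.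
  - apply/trivIsetP => i j _ _ ij; rewrite -preimage_setI.
    by move/trivIsetP : tF => ->//; rewrite preimage_set0.
  - by rewrite -preimage_bigcup -[X in measurable X]setTI; apply: mcons.
have nu0f : sigma_finite setT nu0.
  exists (fun k => tuple_box (fun _ => - k%:R)%R (fun _ => k%:R)%R).
    apply/seteqP; split=> // t _.
    exists (Num.trunc (\sum_i `|tnth t i|)%R).+1 => //= i.
    have : (`|tnth t i| < ((Num.trunc (\sum_i `|tnth t i|)%R).+1)%:R)%R.
      apply: le_lt_trans (truncnS_gt _).
      rewrite (bigD1 i) //= lerDl; exact: sumr_ge0.
    by rewrite ltr_norml => /andP[? ?]; rewrite in_itv /= ltW.
  move=> k; split; first exact: measurable_tuple_box.
  rewrite nu0E lebesgue_tuple_box ?ltry // => i.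
  by rewrite (@le_trans _ _ 0%R) // oppr_le0.
clearbody nu0.
pose M := isMeasure.Build _ _ _ nu0 nu00 nu0ge nu0s.
pose m : {measure set (n.+1.-tuple R) -> \bar R} := HB.pack nu0 M.
pose S := Measure_isSigmaFinite.Build _ _ _ m nu0f.
pose m' : {sigma_finite_measure set (n.+1.-tuple R) -> \bar R} := HB.pack nu0 M S.
by exists m'.
Qed.

(** A slice at a fixed first coordinate is again a sphere, possibly with negative squared radius, so
    [c] stays arbitrary; in dimension 1 at most two points remain. In dimension 0 the case [c = 0]
    would be a unit mass. *)
Lemma lebesgue_tuple_sphere n (P : 'I_n -> R) (c : R) : (0 < n)%N ->
  lebesgue_tuple [set t : n.-tuple R | (\sum_(i < n) (tnth t i - P i) ^+ 2 = c)%R] = 0.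
Proof.
case: n P => // n P _; elim: n P c => [|n IH] P c.
  rewrite /= .
  have fin : finite_set [set x : R | ((x - P ord0) ^+ 2 = c)%R].
    apply: (@sub_finite_set _ _ [set P ord0 + Num.sqrt c; P ord0 - Num.sqrt c]%R); last first.
      by rewrite finite_setU; split; exact: finite_set1.
    move=> x /= <-; rewrite sqrtr_sqr.
    by case: (ger0P (x - P ord0)%R) => h; [left|right]; lra.
  transitivity (\int[lebesgue_measure]_x (\1_[set x : R | ((x - P ord0) ^+ 2 = c)%R] x)%:E).
    apply: eq_integral => x _; rewrite diracE indicE; congr (_%:R%:E); congr nat_of_bool.
    by apply/idP/idP; rewrite !inE /= big_ord_recl big_ord0 addr0 (tnth_nth 0%R).
  have cnt := finite_set_countable fin.
  rewrite integral_indic //; last exact: countable_measurable.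
  by rewrite setIT; exact: countable_lebesgue_measure0.
transitivity (\int[lebesgue_measure]_(x in [set: R]) (0 : \bar R)); last exact: integral0.
apply: eq_integral => x _.
rewrite -[RHS](IH (fun i => P (lift ord0 i)) (c - (x - P ord0) ^+ 2)%R).
rewrite -[LHS]/(lebesgue_tuple (n:=n.+1) _); congr lebesgue_tuple.
apply/seteqP; split=> t /=.
  rewrite big_ord_recl {1}(tnth_nth 0%R) /= => <-.
  by rewrite addrAC subrr add0r; apply: eq_bigr => i _; rewrite tnthS.
move=> h; rewrite big_ord_recl {1}(tnth_nth 0%R) /=; rewrite -[RHS](subrKC ((x - P ord0) ^+ 2)%R).
by congr (_ + _)%R; rewrite -h; apply: eq_bigr => i _; rewrite tnthS.
Qed.

Definition on_tuples n (A : set 'rV[R]_n) : set (n.-tuple R) := [set t | A (\row_i tnth t i)].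

(** The topology lives on row vectors, the product sigma-algebra on tuples. They are related by the
    countably many cubes with rational centre and half-side [k.+1%:R^-1] contained in the open
    set. *)
Lemma measurable_on_tuples_open n (A : set 'rV[R]_n) : open A -> measurable (on_tuples A).
Proof.
move=> oA.
pose box (z : n.-tuple rat * nat) : set (n.-tuple R) :=
  tuple_box (fun i => ratr (tnth z.1 i) - z.2.+1%:R^-1)%R (fun i => ratr (tnth z.1 i) +
    z.2.+1%:R^-1)%R.
have -> : on_tuples A = \bigcup_(z in [set z | box z `<=` on_tuples A]) box z.
  apply/seteqP; split=> [t At|t [z /= zA /zA]//].
  have [e e0 eA] : exists2 e : R, (0 < e)%R & forall y, (`|\row_i tnth t i - y| < e)%R -> A y.
    have /nbhs_ballP[e /= e0 eA] := open_nbhs_nbhs (conj oA At).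
    by exists e => // y ye; apply: eA; rewrite mx_norm_ball.
  have [k ke] : exists k : nat, (k.+1%:R^-1 < e / 2)%R.
    have [k _ hk] := @near_infty_natSinv_lt R (PosNum (divr_gt0 e0 (ltr0Sn _ 1))).
    by exists k; apply: (hk k) => /=.
  have k0 : (0 < (k.+1%:R : R)^-1)%R by rewrite invr_gt0.
  have box_k q : box (q, k) = tuple_box (fun i => ratr (tnth q i) - k.+1%:R^-1)%R
    (fun i => ratr (tnth q i) + k.+1%:R^-1)%R by [].
  move: (k.+1%:R^-1)%R => d in ke k0 box_k.
  have /choice[q hq] : forall i : 'I_n, exists r : rat, (`|ratr r - tnth t i| < d)%R.
    move=> i; have [|r] := @rat_in_itvoo R (tnth t i) (tnth t i + d)%R; first by rewrite ltrDl.
    rewrite in_itv /= => /andP[h1 h2]; exists r; rewrite ltr_norml; apply/andP; split; lra.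
  exists ([tuple q i | i < n], k) => /=; rewrite box_k.
    move=> s hs; apply: eA; apply: norm_rV_lt => // i; rewrite !mxE.
    have := hs i; rewrite tnth_mktuple in_itv /= => /andP[? ?].
    by have := hq i; rewrite !ltr_norml => /andP[? ?]; apply/andP; split; lra.
  move=> i; rewrite tnth_mktuple in_itv /=; have := hq i; rewrite ltr_norml => /andP[? ?].
  by apply/andP; split; lra.
have -> : \bigcup_(z in [set z | box z `<=` on_tuples A]) box z =
    \bigcup_z (if `[< box z `<=` on_tuples A >] then box z else set0).
  apply/seteqP; split=> [t [z /= zA zt]|t [z _]].
    by exists z => //; case: asboolP.
  by case: asboolP => // zA zt; exists z.
apply: countable_bigcupT_measurable => // z.
by case: asboolP => // _; exact: measurable_tuple_box.
Qed.

Section measure_rV.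
Variable n : nat.
Local Notation T := (caratheodory_type (@lebesgue_outer R n)).
Local Notation mu := (@lebesgue_rV R n).

(** [lebesgue_outer] is the outer measure generated by the measure on tuples, so sets of the product
    sigma-algebra are Caratheodory measurable for it. *)
Lemma measurable_rV_tuples (A : set 'rV[R]_n) : measurable (on_tuples A) -> measurable (A : set T).
Proof.
move=> mA; have [nu nuE] := lebesgue_tuple_measure n.
have eqnu : lebesgue_tuple (n:=n) = nu by apply/funext => X; rewrite nuE.
have := caratheodory_measurable_mu_ext nu mA => h.
move=> X; have := h (on_tuples X); rewrite /= -eqnu; exact.
Qed.

Lemma lebesgue_rV_tuples (A : set 'rV[R]_n) : measurable (on_tuples A) ->
  mu A = lebesgue_tuple (on_tuples A).
Proof.
move=> mA; have [nu nuE] := lebesgue_tuple_measure n.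
have eqnu : lebesgue_tuple (n:=n) = nu by apply/funext => X; rewrite nuE.
by rewrite /lebesgue_rV /lebesgue_outer eqnu measurable_mu_extE.
Qed.

Lemma open_measurable_rV (A : set 'rV[R]_n) : open A -> measurable (A : set T).
Proof. by move=> oA; apply: measurable_rV_tuples; exact: measurable_on_tuples_open. Qed.

Lemma closed_measurable_rV (A : set 'rV[R]_n) : closed A -> measurable (A : set T).
Proof.
move=> cA; rewrite -(setCK A); apply: measurableC; apply: open_measurable_rV.
exact: closed_openC.
Qed.

Definition rV_box (a b : 'I_n -> R) : set 'rV[R]_n := [set x | forall i, x 0%R i \in `[a i, b i[].

Lemma on_tuples_box a b : on_tuples (rV_box a b) = tuple_box a b.
Proof. by apply/seteqP; split=> t h i; have := h i; rewrite mxE. Qed.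

Lemma measurable_rV_box a b : measurable (rV_box a b : set T).
Proof. by apply: measurable_rV_tuples; rewrite on_tuples_box; exact: measurable_tuple_box. Qed.

Lemma lebesgue_rV_box a b : (forall i, (a i <= b i)%R) ->
  mu (rV_box a b) = (\prod_(i < n) (b i - a i))%R%:E.
Proof.
by move=> ab; rewrite lebesgue_rV_tuples on_tuples_box; [exact: lebesgue_tuple_box|exact:
  measurable_tuple_box].
Qed.

Lemma lebesgue_rV_sphere (P : 'rV[R]_n) (c : R) : (0 < n)%N ->
  mu [set x | (\sum_(i < n) ((x - P) 0 i) ^+ 2 = c)%R] = 0.
Proof.
move=> n0; rewrite lebesgue_rV_tuples.
  rewrite -[RHS](lebesgue_tuple_sphere (P 0%R) c n0); congr lebesgue_tuple.
  by apply/seteqP; split=> t /= <-; apply: eq_bigr => i _; rewrite !mxE.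
rewrite -[X in measurable X]setCK; apply: measurableC.
rewrite -[X in measurable X]/(on_tuples (~` _)).
apply: measurable_on_tuples_open; apply: closed_openC.
apply: (@closed_comp _ _ (fun x : 'rV[R]_n => nsq (x - P))%R [set c]); last exact: closed_eq.
move=> x _; apply: continuous_comp; last exact: nsq_continuous.
by apply: (@cvgB _ _ _ (nbhs x)); [exact: cvg_id|exact: cvg_cst].
Qed.

End measure_rV.

End tuple_measure.

(** * Riemann sums of continuous functions supported in a cube *)

Section riemann_sum.
Context {R : realType} {n : nat}.
Variable L : R.
Hypothesis L0 : 0 < L.
Implicit Types F : 'rV[R]_n -> R.
Local Notation T := (caratheodory_type (@lebesgue_outer R n)).
Local Notation mu := (@lebesgue_rV R n).

Definition mesh (N : nat) : R := 2 * L / N.+1%:R.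

Definition node (N : nat) (k : 'I_n -> nat) : 'rV[R]_n :=
  \row_i (- L + mesh N * (k i)%:R).

Definition riemann_sum (N : nat) F : R :=
  mesh N ^+ n * \sum_(k : {ffun 'I_n -> 'I_N.+1}) F (node N (fun i => k i)).

(** The faces [|x| = L] are included, so that both ends of a lattice line drop out when differences
    telescope. *)
Definition supported F := forall x, L <= `|x| -> F x = 0.

Lemma mesh_gt0 N : 0 < mesh N.
Proof. by rewrite /mesh divr_gt0 ?mulr_gt0. Qed.

Lemma meshN N : mesh N * N.+1%:R = 2 * L.
Proof. by rewrite /mesh divfK // pnatr_eq0. Qed.

Lemma mesh_cvg0 e : 0 < e -> \forall N \near \oo, mesh N < e.
Proof.
move=> e0; have d0 : 0 < e / (2 * L) by rewrite divr_gt0 ?mulr_gt0.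
have [k _ hk] := @near_infty_natSinv_lt R (PosNum d0).
exists k => // N /= kN; have := hk N kN; rewrite /= ltr_pdivlMr ?mulr_gt0 //.
by rewrite /mesh mulrC.
Qed.

Lemma compact_rV_ball r : compact [set x : 'rV[R]_n | `|x| <= r].
Proof.
apply: bounded_closed_compact.
  by exists r; split; [exact: num_real|move=> M rM x /= xr; rewrite (le_trans xr) // ltW].
apply: (@closed_comp _ _ (fun x : 'rV[R]_n => `|x|) [set x | x <= r]); last exact: closed_le.
by move=> x _; exact: norm_continuous.
Qed.

(** Heine's theorem on the compact ball of radius [L + 1]; if [x] lies outside it and [y] within
    distance 1 of [x], both values vanish. *)
Lemma supported_uniform F : continuous F -> supported F ->
  forall e : R, 0 < e -> exists2 d : R, 0 < d & forall x y : 'rV[R]_n, `|x - y| < d -> `|F x - F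
    y| < e.
Proof.
move=> cF sF e e0.
have cB := compact_rV_ball (r := L + 1).
have /compact_near_coveringP/near_covering_withinP := cB.
move=> /(_ R (0 : R)^'+ (fun d x => forall y, `|x - y| < d -> `|F x - F y| < e)) [].
  move=> x xB.
  have /cvgrPdist_lt/(_ (e / 2)) := cF x; rewrite divr_gt0 // => /(_ isT).
  move=> /nbhs_ballP[d /= d0 hd].
  exists (ball x (d / 2), [set t | t < d / 2]) => /=.
    split; first by apply: nbhsx_ballx; rewrite divr_gt0.
    by apply: nbhs_right_lt; rewrite divr_gt0.
  move=> [x' t] /= [xx' td] _ y x'y.
  have h1 : `|F x - F x'| < e / 2.
    by apply: hd; apply: le_ball xx'; lra.
  have h2 : `|F x - F y| < e / 2.
    apply: hd; rewrite mx_norm_ball /ball_ /=.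
    rewrite -(subrKA x') (le_lt_trans (ler_normD _ _)) //.
    have : `|x - x'| < d / 2 by move: xx'; rewrite mx_norm_ball.
    by move=> ?; lra.
  rewrite -(subrKA (F x)) (le_lt_trans (ler_normD _ _)) // distrC; lra.
move=> d0 /= d00 hd.
exists (Num.min (d0 / 2) 1) => [|x y].
  by rewrite lt_min divr_gt0 //=.
rewrite lt_min => /andP[xy xy1].
have h := hd (d0 / 2); rewrite /ball_ /= sub0r normrN gtr0_norm ?divr_gt0 // in h.
have {}h : forall x, [set x | `|x| <= L + 1] x -> forall y : 'rV_n, `|x - y| < d0 / 2 -> `|F x -
  F y| < e.
  by apply: h; rewrite ?divr_gt0 //; lra.
case: (lerP `|x| (L + 1)) => xL; first exact: h.
have yL : L <= `|y|.
  have : `|x| <= `|x - y| + `|y| by rewrite -{1}(subrK y x) ler_normD.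
  lra.
by rewrite !sF ?subrr ?normr0 //; lra.
Qed.

Lemma measurable_continuous_rV (D : set T) F : measurable D -> continuous F -> measurable_fun D
  (F : T -> R).
Proof.
move=> mD cF; apply: (measurability _ (RGenOInfty.measurableE R)) => //.
move=> _ [_ [a ->] <-]; apply: measurableI => //; apply: open_measurable_rV.
apply: open_comp; first by move=> x _; exact: cF.
exact: interval_open.
Qed.

Definition cell (N : nat) (k : 'I_n -> nat) : set 'rV[R]_n :=
  rV_box (fun i => node N k 0 i) (fun i => node N k 0 i + mesh N).

Lemma cell_near N k x : cell N k x -> `|node N k - x| <= mesh N.
Proof.
move=> xk; apply: norm_rV_le; first exact/ltW/mesh_gt0.
move=> i; have := xk i; rewrite in_itv /= => /andP[h1 h2].
have m0 := mesh_gt0 N.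
by rewrite !mxE in h1 h2 *; rewrite ler_norml; apply/andP; split; lra.
Qed.

Lemma lebesgue_cell N k : mu (cell N k) = (mesh N ^+ n)%:E.
Proof.
rewrite lebesgue_rV_box; last by move=> i; rewrite lerDl; exact/ltW/mesh_gt0.
congr (_%:E); under eq_bigr do rewrite addrAC subrr add0r.
by rewrite prodr_const card_ord.
Qed.

Lemma cell_inj N k l x : cell N k x -> cell N l x -> k =1 l.
Proof.
move=> xk xl i; have m0 := mesh_gt0 N.
have := xk i; have := xl i; rewrite !in_itv /= !mxE => /andP[h1 h2] /andP[h3 h4].
have lt (a b : nat) : mesh N * a%:R < mesh N * b%:R + mesh N -> (a <= b)%N.
  by rewrite -{3}[mesh N]mulr1 -mulrDr natr1 ltr_pM2l // ltr_nat.
apply/eqP; rewrite eqn_leq; apply/andP; split; apply: lt; lra.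
Qed.

Lemma cell_trivIset N : trivIset [set` index_enum {ffun 'I_n -> 'I_N.+1}]
  (fun k : {ffun 'I_n -> 'I_N.+1} => cell N (fun i => k i)).
Proof.
move=> k l _ _ [x [xk xl]]; apply/ffunP => i; apply/val_inj.
exact: (cell_inj xk xl).
Qed.

Lemma cell_cover N : rV_box (fun=> - L) (fun=> L) =
  \big[setU/set0]_(k : {ffun 'I_n -> 'I_N.+1}) cell N (fun i => k i).
Proof.
have m0 := mesh_gt0 N; have mN := meshN N.
rewrite -bigcup_seq; apply/seteqP; split=> [x xB|x [k /= _ xk] i].
  have kN (i : 'I_n) : (Num.trunc ((x 0%R i + L) / mesh N)%R < N.+1)%N.
    have := xB i; rewrite in_itv /= => /andP[h1 h2].
    rewrite truncn_lt_nat; last by rewrite divr_ge0 ?(ltW m0) //; lra.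
    by rewrite ltr_pdivrMr // mulrC mN; lra.
  exists [ffun i => Ordinal (kN i)]; first by rewrite /= mem_index_enum.
  move=> i; rewrite in_itv /= !mxE ffunE /=.
  have := xB i; rewrite in_itv /= => /andP[h1 h2].
  have h0 : 0 <= (x 0 i + L) / mesh N by rewrite divr_ge0 ?(ltW m0) //; lra.
  have := truncn_itv h0; rewrite ler_pdivlMr // ltr_pdivrMr // -natr1 mulrC => /andP[h3].
  rewrite mulrC mulrDr mulr1 => h4; by apply/andP; split; lra.
have := xk i; rewrite !in_itv /= !mxE => /andP[h1 h2].
have h3 : 0 <= mesh N * (k i)%:R by rewrite mulr_ge0 // ltW.
have h4 : mesh N * (k i)%:R + mesh N <= 2 * L.
  by rewrite -mN -{2}[mesh N]mulr1 -mulrDr ler_pM2l // natr1 ler_nat.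
by apply/andP; split; lra.
Qed.

(** Uniform continuity replaces [F] on each cell by its value at the lower corner, at a total cost
    of [e * (2 * L) ^+ n]. Later estimates are made on the sums; the integral serves to have a
    limit, to see that it is positive and to compare it with the measurable weight. *)
Lemma riemann_cvg F : continuous F -> supported F -> (forall x, 0 <= F x) ->
  exists2 l : R, riemann_sum N F @[N --> \oo] --> l & l%:E = (\int[mu]_x (F x)%:E)%E.
Proof.
move=> cF sF F0.
pose B := rV_box (fun=> - L) (fun=> L : R) : set 'rV[R]_n.
have mB : measurable (B : set T) by exact: measurable_rV_box.
have L2 : 0 < (2 * L) ^+ n by rewrite exprn_gt0 ?mulr_gt0.
have muB : mu B = ((2 * L) ^+ n)%:E.
  rewrite lebesgue_rV_box; last by move=> _ /=; rewrite (@le_trans _ _ 0%R) // ?oppr_le0 ltW.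
  by congr (_%:E); rewrite prodr_const card_ord; congr (_ ^+ _); lra.
have mF (D : set T) : measurable D -> measurable_fun D (fun x : T => (F x)%:E).
  by move=> mD; apply/measurable_EFinP; exact: measurable_continuous_rV.
have intB : (\int[mu]_x (F x)%:E = \int[mu]_(x in B) (F x)%:E)%E.
  rewrite [RHS]integral_mkcond; apply: eq_integral => x _; rewrite patchE.
  case: ifPn => //; rewrite notin_setE => xB; rewrite sF //.
  rewrite leNgt; apply/negP => xL; apply: xB => i; rewrite in_itv /=.
  have := le_lt_trans (coord_le_norm x i) xL; rewrite ltr_norml => /andP[? ->].
  by rewrite ltW.
have mC N k : measurable (cell N k : set T) by exact: measurable_rV_box.
have split_int (G : 'rV[R]_n -> R) N : continuous G -> (forall x, 0 <= G x) ->
    (\int[mu]_(x in B) (G x)%:E =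
     \sum_(k : {ffun 'I_n -> 'I_N.+1}) \int[mu]_(x in cell N (fun i => k i)) (G x)%:E)%E.
  move=> cG G0; rewrite /B (cell_cover N) ge0_integral_bigsetU //.
  - exact: index_enum_uniq.
  - exact: cell_trivIset.
  - apply/measurable_EFinP; apply: measurable_continuous_rV => //.
    by rewrite -cell_cover.
  - by move=> x _; rewrite lee_fin.
have approx e : 0 < e -> \forall N \near \oo,
    (\int[mu]_(x in B) (F x)%:E <= (riemann_sum N F + e * (2 * L) ^+ n)%:E)%E /\
    ((riemann_sum N F)%:E <= \int[mu]_(x in B) (F x)%:E + (e * (2 * L) ^+ n)%:E)%E.
  move=> e0; have [d d0 hd] := supported_uniform cF sF e0.
  near=> N; have md : mesh N < d by near: N; exact: mesh_cvg0.
  have Fk k x : cell N k x -> `|F (node N k) - F x| < e.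
    by move=> /cell_near xk; apply: hd; exact: le_lt_trans md.
  have cells (c : R) : (c * (2 * L) ^+ n = \sum_(k : {ffun 'I_n -> 'I_N.+1}) (c * mesh N ^+ n))%R.
    rewrite sumr_const card_ffun !card_ord -mulrnAr -[(mesh N ^+ n) *+ _]mulr_natr natrX.
    by rewrite -exprMn meshN.
  split.
    rewrite (split_int F N) // cells /riemann_sum mulr_sumr -big_split /= -sumEFin.
    apply: lee_sum => k _.
    apply: (@le_trans _ _ (\int[mu]_(x in cell N (fun i => k i)) (cst (F (node N (fun i => k i))
      + e)%:E x))%E).
      apply: ge0_le_integral => //; [by move=> x _; rewrite lee_fin|exact: mF|].
      move=> x /Fk; rewrite ltr_norml lee_fin => /andP[? ?]; lra.
    rewrite integral_cst // [X in (_ * X)%E]lebesgue_cell -EFinM lee_fin.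
    by rewrite mulrDl mulrC.
  have -> : (\int[mu]_(x in B) (F x)%:E + (e * (2 * L) ^+ n)%:E =
     \int[mu]_(x in B) ((F x)%:E + (e)%:E))%E.
    rewrite ge0_integralD //; last 3 first.
    - by move=> x _; rewrite lee_fin.
    - exact: mF.
    - by move=> x _; rewrite lee_fin ltW.
    congr (_ + _)%E; rewrite -[RHS]/(\int[mu]_(x in B) (cst e%:E x))%E integral_cst //.
    by rewrite [X in (_ * X)%E]muB.
  under eq_integral do rewrite -EFinD.
  rewrite (split_int (fun x => F x + e) N); last 2 first.
    by move=> x; apply: (@cvgD _ _ _ (nbhs x)); [exact: cF|exact: cvg_cst].
    by move=> x; rewrite addr_ge0 // ltW.
  rewrite /riemann_sum mulr_sumr -sumEFin; apply: lee_sum => k _.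
  apply: (@le_trans _ _ (\int[mu]_(x in cell N (fun i => k i)) (cst (F (node N (fun i => k
    i)))%:E x))%E).
    by rewrite integral_cst // [X in (_ * X)%E]lebesgue_cell -EFinM lee_fin mulrC.
  apply: ge0_le_integral => //; [by move=> x _; rewrite lee_fin| |].
    apply/measurable_EFinP; apply: measurable_continuous_rV => // x.
    by apply: (@cvgD _ _ _ (nbhs x)); [exact: cF|exact: cvg_cst].
  by move=> x /Fk; rewrite ltr_norml lee_fin => /andP[? ?]; lra.
have fin : (\int[mu]_(x in B) (F x)%:E \is a fin_num)%E.
  have [N _ /(_ N (leqnn _)) [h _]] := approx 1 ltr01.
  rewrite ge0_fin_numE; first by apply: le_lt_trans h _; rewrite ltry.
  by apply: integral_ge0 => x _; rewrite lee_fin.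
exists (fine (\int[mu]_(x in B) (F x)%:E)%E); last by rewrite intB fineK.
apply/cvgrPdist_le => e e0.
have d0 : 0 < e / (2 * L) ^+ n by rewrite divr_gt0.
have := approx _ d0; apply: filterS => N; rewrite divfK ?gt_eqF // -(fineK fin) -EFinD !lee_fin.
by move=> [h1 h2]; rewrite ler_norml; apply/andP; split; lra.
Unshelve. all: by end_near. Qed.

End riemann_sum.

(** * The Gagliardo-Nirenberg inequality *)

Section hoelder_prod.
Context {R : realType}.

Lemma powR_prod (I : Type) (s : seq I) (P : pred I) (a : I -> R) r :
  (forall i, P i -> 0 <= a i) ->
  (\prod_(i <- s | P i) a i) `^ r = \prod_(i <- s | P i) (a i `^ r).
Proof.
move=> a0; elim: s => [|i s IH]; first by rewrite !big_nil powR1.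
rewrite !big_cons; case: ifP => // Pi; rewrite powRM ?IH //; first exact: a0.
exact: prodr_ge0.
Qed.

Lemma prod_root_le_mean (I : finType) (P : pred I) (a : I -> R) :
  (0 < #|P|)%N -> (forall i, 0 <= a i) ->
  \prod_(i | P i) (a i `^ (#|P|%:R^-1)) <= (\sum_(i | P i) a i) / #|P|%:R.
Proof.
move=> P0 a0; rewrite -powR_prod; last by move=> i _; exact: a0.
have [h _] := @leif_AGM R I P a (in1W a0).
have m0 : 0 <= (\sum_(i | P i) a i) / #|P|%:R by rewrite divr_ge0 // sumr_ge0.
apply: (@le_trans _ _ ((((\sum_(i | P i) a i) / #|P|%:R) ^+ #|P|) `^ (#|P|%:R^-1))).
  by apply: ge0_ler_powR => //; rewrite ?nnegrE ?prodr_ge0 ?exprn_ge0.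
by rewrite -powR_mulrn // -powRrM divff ?pnatr_eq0 -?lt0n // powRr1.
Qed.

(** Once every factor is normalised to total 1, the pointwise inequality of geometric and arithmetic
    means sums up to 1. A factor of total 0 cannot be normalised, but it makes the left side
    vanish. *)
Lemma hoelder_prod (I T : finType) (P : pred I) (G : I -> T -> R) :
  (0 < #|P|)%N -> (forall i t, 0 <= G i t) ->
  \sum_t \prod_(i | P i) (G i t `^ (#|P|%:R^-1)) <=
  \prod_(i | P i) ((\sum_t G i t) `^ (#|P|%:R^-1)).
Proof.
move=> P0 G0; have m0 : (#|P|%:R : R)^-1 != 0 by rewrite invr_eq0 pnatr_eq0 -lt0n.
have B0 i : 0 <= \sum_t G i t by apply: sumr_ge0.
have [/existsP[i /andP[Pi /eqP Bi]]|] := boolP [exists i, P i && (\sum_t G i t == 0)].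
  rewrite big1; first by apply: prodr_ge0 => j _; exact: powR_ge0.
  move=> t _; rewrite (bigD1 i) //=; suff -> : G i t = 0 by rewrite powR0 ?mul0r.
  by have /psumr_eq0P -> := Bi.
rewrite negb_exists => /forallP Bn.
have Bp i : P i -> 0 < \sum_t G i t.
  by move=> Pi; have := Bn i; rewrite Pi /= lt_def B0 andbT.
have -> : \sum_t \prod_(i | P i) (G i t `^ (#|P|%:R^-1)) =
  \prod_(i | P i) ((\sum_t G i t) `^ (#|P|%:R^-1)) *
  \sum_t \prod_(i | P i) ((G i t / \sum_t G i t) `^ (#|P|%:R^-1)).
  rewrite mulr_sumr; apply: eq_bigr => t _; rewrite -big_split /=.
  apply: eq_bigr => i Pi; rewrite -powRM ?divr_ge0 // mulrC divfK //.
  by rewrite gt_eqF // Bp.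
rewrite ler_piMr //; first by apply: prodr_ge0 => j _; exact: powR_ge0.
apply: (@le_trans _ _ (\sum_t (\sum_(i | P i) (G i t / \sum_t G i t)) / #|P|%:R)).
  apply: ler_sum => t _; apply: prod_root_le_mean => // i; exact: divr_ge0.
rewrite -mulr_suml exchange_big /=.
rewrite (eq_bigr (fun=> 1)); last first.
  by move=> i Pi; rewrite -mulr_suml divff // gt_eqF // Bp.
by rewrite sumr_const divff // pnatr_eq0 -lt0n.
Qed.

End hoelder_prod.

(** * The Loomis-Whitney inequality on a finite grid *)

Section loomis_whitney.
Context {R : realType} {n M : nat}.
Implicit Types (x y : {ffun 'I_n -> 'I_M.+1}) (F G : {ffun 'I_n -> 'I_M.+1} -> R) (k i : 'I_n) (s
  : seq 'I_n).

Definition upd x k (t : 'I_M.+1) : {ffun 'I_n -> 'I_M.+1} :=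
  [ffun i => if i == k then t else x i].

Definition sumk k F x : R := \sum_t F (upd x k t).

Definition sums s F : {ffun 'I_n -> 'I_M.+1} -> R := foldr sumk F s.

Lemma sumk_ge0 k F : (forall x, 0 <= F x) -> forall x, 0 <= sumk k F x.
Proof. by move=> F0 x; apply: sumr_ge0. Qed.

Lemma sums_ge0 s F : (forall x, 0 <= F x) -> forall x, 0 <= sums s F x.
Proof. by move=> F0; elim: s => // k s IH; exact: sumk_ge0. Qed.

Lemma sums_const s F k : (forall x t, F (upd x k t) = F x) ->
  forall x t, sums s F (upd x k t) = sums s F x.
Proof.
move=> FE; elim: s => //= j s IH x t; rewrite /sumk.
apply: eq_bigr => t' _; case: (eqVneq j k) => [->|jk].
  congr (sums s F _); by apply/ffunP => i; rewrite !ffunE; case: (i == k).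
rewrite -[RHS](IH _ t); congr (sums s F _); apply/ffunP => i; rewrite !ffunE.
by case: (eqVneq i j) => // ->; rewrite (negbTE jk).
Qed.

Lemma sumsE s F x : uniq s ->
  sums s F x = \sum_(y : {ffun 'I_n -> 'I_M.+1} | [forall i, (i \in s) || (y i == x i)]) F y.
Proof.
elim: s x => [|k s IH] x /= => [_|/andP[ks us]].
  rewrite (big_pred1 x) // => y; apply/forallP/eqP => [h|-> i]; last by rewrite eqxx.
  by apply/ffunP => i; have := h i => /eqP.
rewrite (partition_big (fun y => y k) xpredT) //=; apply: eq_bigr => t _.
rewrite IH //; apply: eq_bigl => y; apply/forallP/andP => [h|[/forallP h /eqP <-] i].
  split; last by have := h k; rewrite (negbTE ks) ffunE eqxx.
  apply/forallP => i; have := h i; rewrite ffunE inE.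
  by case: (i == k).
have := h i; rewrite ffunE in_cons; case: eqP => //= -> _.
by rewrite eqxx orbT.
Qed.

Lemma sums_all s F x : uniq s -> (forall i, i \in s) -> sums s F x = \sum_y F y.
Proof.
by move=> us sA; rewrite sumsE //; apply: eq_bigl => y; apply/forallP => i; rewrite sA.
Qed.

Lemma sums_rcons s k F : sums (rcons s k) F = sums s (sumk k F).
Proof. by rewrite /sums foldr_rcons. Qed.

Lemma sumk_const k F x t : sumk k F (upd x k t) = sumk k F x.
Proof.
apply: eq_bigr => t' _; congr F; by apply/ffunP => i; rewrite !ffunE; case: (i == k).
Qed.

(* Finner's form of the Loomis-Whitney inequality: integrating out one coordinate k
   at a time, the k-th factor is constant and Hoelder's inequality applies to the
   n - 1 remaining ones. *)
Lemma loomis_whitney_seq (G : 'I_n -> {ffun 'I_n -> 'I_M.+1} -> R) s x :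
  (1 < n)%N -> (forall i x, 0 <= G i x) -> (forall i x t, G i (upd x i t) = G i x) ->
  sums s (fun x => \prod_i (G i x `^ (n.-1%:R^-1))) x <=
  \prod_i (sums [seq j <- s | j != i] (G i) x `^ (n.-1%:R^-1)).
Proof.
move=> n1 G0 Gc; elim: s x => //= k s IH x.
have n0 : 0 <= (n.-1%:R : R)^-1 by rewrite invr_ge0.
pose H i := sums [seq j <- s | j != i] (G i).
have H0 i y : 0 <= H i y by exact: sums_ge0.
have cardk : #|[pred i : 'I_n | i != k]| = n.-1 by rewrite cardC1 card_ord.
apply: (@le_trans _ _ (\sum_t \prod_i (H i (upd x k t) `^ (n.-1%:R^-1)))).
  by apply: ler_sum => t _; exact: IH.
rewrite (bigD1 k) //= eqxx /=.
have -> : \sum_t \prod_i (H i (upd x k t) `^ (n.-1%:R^-1)) =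
  H k x `^ (n.-1%:R^-1) * \sum_t \prod_(i | i != k) (H i (upd x k t) `^ (n.-1%:R^-1)).
  rewrite mulr_sumr; apply: eq_bigr => t _; rewrite (bigD1 k) //=; congr (_ `^ _ * _).
  by apply: sums_const => y t'; exact: Gc.
apply: ler_wpM2l; first exact: powR_ge0.
have := @hoelder_prod R _ _ [pred i : 'I_n | i != k] (fun i t => H i (upd x k t)).
rewrite cardk => /(_ _ _)/le_trans; apply => //; first by rewrite -ltnS prednK // ltnW.
by apply: ler_prod => i /negbTE ik; rewrite powR_ge0 /= eq_sym ik /=.
Qed.

(** Multiplying the bounds of [V x] along the n coordinate lines gives a bound of [V x ^+ n]. The
    i-th factor does not depend on the i-th coordinate, as Loomis-Whitney requires, and summing it
    over the other coordinates restores the full sum of [D i]. *)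
Lemma gagliardo_nirenberg_sum (V : {ffun 'I_n -> 'I_M.+1} -> R) (D : 'I_n -> {ffun 'I_n ->
  'I_M.+1} -> R) :
  (1 < n)%N -> (forall x, 0 <= V x) -> (forall i x, 0 <= D i x) ->
  (forall i x, V x <= sumk i (D i) x) ->
  \sum_x (V x `^ (n%:R / n.-1%:R)) <= \prod_i ((\sum_x D i x) `^ (n.-1%:R^-1)).
Proof.
move=> n1 V0 D0 VD.
have n0 : 0 <= (n.-1%:R : R)^-1 by rewrite invr_ge0.
apply: (@le_trans _ _ (\sum_x \prod_i (sumk i (D i) x `^ (n.-1%:R^-1)))).
  apply: ler_sum => x _; rewrite powRrM powR_mulrn // -powR_prod; last first.
    by move=> i _; exact: sumk_ge0.
  apply: ge0_ler_powR => //; rewrite ?nnegrE ?exprn_ge0 //.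
    by apply: prodr_ge0 => i _; exact: sumk_ge0.
  rewrite -[X in V x ^+ X]card_ord -prodr_const; apply: ler_prod => i _.
  by rewrite V0 VD.
pose x0 : {ffun 'I_n -> 'I_M.+1} := [ffun => ord0].
rewrite -(@sums_all (enum 'I_n) _ x0) ?enum_uniq //; last by move=> i; rewrite mem_enum.
apply: le_trans (loomis_whitney_seq _ _ n1 _ _) _.
- by move=> i x; exact: sumk_ge0.
- by move=> i x t; exact: sumk_const.
apply: ler_prod => i _; rewrite powR_ge0 /= -sums_rcons sums_all //.
  by rewrite rcons_uniq filter_uniq ?enum_uniq // mem_filter eqxx.
by move=> j; rewrite mem_rcons in_cons mem_filter mem_enum; case: eqVneq.
Qed.

(** The involution exchanging the k-th entry of [x] with [t] carries one double sum to the other. *)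
Lemma sum_sumk k F : \sum_x sumk k F x = M.+1%:R * \sum_x F x.
Proof.
pose h (z : {ffun 'I_n -> 'I_M.+1} * 'I_M.+1) := (upd z.1 k z.2, z.1 k).
have hK : involutive h.
  move=> [x t]; rewrite /h /=; congr (_, _); last by rewrite ffunE eqxx.
  by apply/ffunP => i; rewrite !ffunE; case: eqVneq => [->|].
rewrite /sumk pair_big /= (reindex_inj (inv_inj hK)) /=.
transitivity (\sum_(z : {ffun 'I_n -> 'I_M.+1} * 'I_M.+1) F z.1).
  by apply: eq_bigr => -[x t] _; rewrite -[in RHS](hK (x, t)).
rewrite -(pair_big xpredT xpredT (fun x (t : 'I_M.+1) => F x)) /=.
rewrite mulr_sumr; apply: eq_bigr => x _.
by rewrite sumr_const card_ord mulr_natl.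
Qed.

End loomis_whitney.

Section line_derivative.
Context {R : realType} {V : normedModType R}.

Lemma is_derive_line (F : V -> R) (x v : V) (t d : R) :
  is_derive (x + t *: v) v F d -> is_derive t 1 (fun s : R => F (x + s *: v)) d.
Proof.
move=> [dF <-].
have eqf : (fun h : R => h^-1 *: ((F \o shift (x + t *: v)) (h *: v) - F (x + t *: v))) =
  (fun h : R => h^-1 *: (((fun s : R => F (x + s *: v)) \o shift t) (h *: 1) - F (x + t *: v))).
  apply/funext => h /=; congr (_ *: (F _ - _)).
  by rewrite [h *: 1]mulr1 scalerDl addrCA.
by apply: DeriveDef; rewrite /derivable /derive -eqf.
Qed.

End line_derivative.

Lemma cvg_le {R : realFieldType} (u v : nat -> R) (a b : R) :
  u @ \oo --> a -> v @ \oo --> b -> (\forall N \near \oo, u N <= v N) -> a <= b.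
Proof.
move=> ua vb uv; rewrite -(cvg_lim _ ua) // -(cvg_lim _ vb) //.
by apply: ler_lim uv; apply/cvg_ex; [exists a|exists b].
Qed.

(** * Integration by parts and the Gagliardo-Nirenberg inequality in the limit *)

Section riemann_derivative.
Context {R : realType} {n : nat}.
Variable L : R.
Hypothesis L0 : 0 < L.
Implicit Types (F G : 'rV[R]_n -> R) (k : 'I_n).
Local Notation riemann := (riemann_sum L).
Local Notation mesh := (mesh L).
Local Notation node := (node L).
Local Notation supported := (supported L).
Local Notation e_ k := (delta_mx 0 k : 'rV[R]_n).

(** The mean value theorem on a lattice edge, whose length is below the modulus of continuity of
    [G]; hence uniformly in [x]. *)
Lemma difference_quotient F G k : continuous G -> supported G ->
  (forall x, is_derive x (e_ k) F (G x)) ->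
  forall e, 0 < e -> \forall N \near \oo, forall x,
    `|F (x + mesh N *: e_ k) - F x - mesh N * G x| <= mesh N * e.
Proof.
move=> cG sG dF e e0; have [d d0 hd] := supported_uniform cG sG e0.
near=> N; move=> x; have m0 := mesh_gt0 L0 N.
have md : mesh N < d by near: N; exact: mesh_cvg0.
have dg (t : R) : is_derive t 1 (fun s : R => F (x + s *: e_ k)) (G (x + t *: e_ k)).
  by apply: is_derive_line; exact: dF.
have [|c] := @MVT R (fun s : R => F (x + s *: e_ k)) (fun s => G (x + s *: e_ k)) 0 (mesh N) m0
  (fun t _ => dg t).
  apply/continuous_subspaceT => t; apply: differentiable_continuous.
  by apply/derivable1_diffP; case: (dg t).
rewrite in_itv /= => /andP[c0 cN]; rewrite scale0r addr0 subr0 => ->.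
rewrite mulrC -mulrBr normrM gtr0_norm // ler_pM2l // distrC; apply/ltW/hd.
rewrite opprD addrA subrr add0r normrN normrZ (gtr0_norm c0).
apply: le_lt_trans md; apply: le_trans (ltW cN); rewrite ler_piMr ?(ltW c0) //.
by apply: norm_rV_le => // i; rewrite mxE eqxx /=; case: (i == k); rewrite ?normr1 ?normr0.
Unshelve. all: by end_near. Qed.

Definition line N (x : {ffun 'I_n -> 'I_N.+1}) k (t : nat) : 'rV[R]_n :=
  node N (fun i => if i == k then t else x i).

Lemma lineS N x k t : @line N x k t.+1 = line x k t + mesh N *: e_ k.
Proof.
apply/rowP => i; rewrite !mxE eqxx /=; case: eqVneq => _ /=; last by rewrite mulr0 addr0.
by rewrite mulr1 -addrA -{3}[mesh N]mulr1 -mulrDr natr1.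
Qed.

Lemma line_upd N x k (t : 'I_N.+1) : line x k t = node N (fun i => upd x k t i).
Proof. by apply/rowP => i; rewrite !mxE ffunE; case: eqP. Qed.

Lemma line_self N (x : {ffun 'I_n -> 'I_N.+1}) k : line x k (x k) = node N (fun i => x i).
Proof. by apply/rowP => i; rewrite !mxE; case: eqP => [->|]. Qed.

Lemma line_boundary F N x k : supported F -> F (@line N x k 0) = 0 /\ F (@line N x k N.+1) = 0.
Proof.
move=> sF; split; apply: sF; apply: le_trans (coord_le_norm _ k); rewrite mxE eqxx.
  by rewrite mulr0 addr0 normrN gtr0_norm.
by rewrite meshN // (_ : - L + 2 * L = L) ?gtr0_norm //; ring.
Qed.

Definition step F N k (x : {ffun 'I_n -> 'I_N.+1}) : R :=
  F (node N (fun i => x i) + mesh N *: e_ k) - F (node N (fun i => x i)).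

Lemma sum_step0 F N k : supported F -> \sum_(x : {ffun 'I_n -> 'I_N.+1}) step F k x = 0.
Proof.
(* Multiplication by [N.+1] turns the sum over the grid into sums over whole lines in direction k,
   each of which telescopes to 0. *)
move=> sF; apply/eqP; rewrite -(@mulrI_eq0 _ (N.+1%:R)); last first.
  by apply/lregP; rewrite pnatr_eq0.
rewrite -(sum_sumk k) big1 // => x _; rewrite /sumk.
rewrite (eq_bigr (fun t : 'I_N.+1 => F (line x k t.+1) - F (line x k t))); last first.
  by move=> t _; rewrite /step -line_upd lineS.
rewrite -(big_mkord xpredT (fun t => F (line x k t.+1) - F (line x k t))) telescope_sumr //.
by have [-> ->] := line_boundary x k sF; rewrite subrr.
Qed.

Lemma norm_le_sum_step F N k (x : {ffun 'I_n -> 'I_N.+1}) : supported F ->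
  `|F (node N (fun i => x i))| <= sumk k (fun y => `|step F k y|) x.
Proof.
move=> sF; rewrite -(line_self x k).
have -> : F (line x k (x k)) = \sum_(0 <= t < x k) (F (line x k t.+1) - F (line x k t)).
  by rewrite telescope_sumr //; have [-> _] := line_boundary x k sF; rewrite subr0.
apply: le_trans (ler_norm_sum _ _ _) _.
rewrite /sumk (eq_bigr (fun t : 'I_N.+1 => `|F (line x k t.+1) - F (line x k t)|)); last first.
  by move=> t _; rewrite /step -line_upd lineS.
rewrite -(big_mkord xpredT (fun t => `|F (line x k t.+1) - F (line x k t)|)).
rewrite [leRHS](big_cat_nat _ (n := x k)) //=; last exact: ltnW.
by rewrite lerDl; exact: sumr_ge0.
Qed.

Lemma riemannD N F G : riemann N (fun x => F x + G x) = riemann N F + riemann N G.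
Proof. by rewrite /riemann big_split mulrDr. Qed.

Lemma riemannZ N a F : riemann N (fun x => a * F x) = a * riemann N F.
Proof. by rewrite /riemann -mulr_sumr mulrCA. Qed.

Lemma riemann_cst N (a : R) : riemann N (fun _ : 'rV[R]_n => a) = (2 * L) ^+ n * a.
Proof.
rewrite /riemann sumr_const card_ffun !card_ord -[a *+ _]mulr_natl natrX mulrA.
by rewrite -exprMn meshN.
Qed.

Lemma le_riemann N F G : (forall x, F x <= G x) -> riemann N F <= riemann N G.
Proof.
move=> FG; rewrite /riemann ler_wpM2l ?exprn_ge0 ?(ltW (mesh_gt0 L0 _)) //.
by apply: ler_sum => x _.
Qed.

Lemma riemann_ge0 N F : (forall x, 0 <= F x) -> 0 <= riemann N F.
Proof.
by move=> F0; rewrite /riemann mulr_ge0 ?exprn_ge0 ?(ltW (mesh_gt0 L0 _)) // sumr_ge0.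
Qed.

(** The substitute for integration by parts: the steps of [F] sum exactly to 0, and [mesh N * G]
    differs from them by a small multiple of [mesh N], uniformly. *)
Lemma riemann_derive_cvg0 F G k : continuous G -> supported G -> supported F ->
  (forall x, is_derive x (e_ k) F (G x)) -> riemann N G @[N --> \oo] --> 0.
Proof.
move=> cG sG sF dF; have L2 : 0 < (2 * L) ^+ n by rewrite exprn_gt0 ?mulr_gt0.
apply/cvgrPdist_le => e e0.
have d0 : 0 < e / (2 * L) ^+ n by rewrite divr_gt0.
have := difference_quotient cG sG dF d0; apply: filterS => N hN; rewrite sub0r normrN.
have m0 := mesh_gt0 L0 N.
have -> : riemann N G = - (mesh N ^+ n * \sum_(x : {ffun 'I_n -> 'I_N.+1})
    ((mesh N)^-1 * (step F k x - mesh N * G (node N (fun i => x i))))).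
  rewrite -mulr_sumr big_split /= sum_step0 // add0r sumrN mulrN mulrN opprK -mulr_sumr.
  by rewrite [(mesh N)^-1 * _]mulrA mulVf ?gt_eqF // mul1r.
rewrite normrN normrM ger0_norm ?exprn_ge0 ?(ltW m0) //.
have -> : e = mesh N ^+ n * \sum_(x : {ffun 'I_n -> 'I_N.+1}) (e / (2 * L) ^+ n).
  rewrite sumr_const card_ffun !card_ord -[_ *+ _]mulr_natl natrX [RHS]mulrA.
  by rewrite -exprMn meshN // [RHS]mulrC divfK // gt_eqF.
rewrite ler_wpM2l ?exprn_ge0 ?(ltW m0) //; apply: le_trans (ler_norm_sum _ _ _) _.
apply: ler_sum => x _; rewrite normrM gtr0_norm ?invr_gt0 // ler_pdivrMl //.
exact: hN.
Qed.

Lemma gagliardo_nirenberg (F W : 'rV[R]_n -> R) (G : 'I_n -> 'rV[R]_n -> R) (a b : R) :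
  (1 < n)%N -> (forall k, continuous (G k)) -> (forall k, supported (G k)) ->
  supported F -> (forall k x, is_derive x (e_ k) F (G k x)) ->
  (forall k x, `|G k x| <= W x) ->
  riemann N (fun x => `|F x| `^ (n%:R / n.-1%:R)) @[N --> \oo] --> a ->
  riemann N W @[N --> \oo] --> b ->
  a <= b `^ (n%:R / n.-1%:R).
Proof.
move=> n1 cG sG sF dF GW Fa Wb; have L2 : 0 < (2 * L) ^+ n by rewrite exprn_gt0 ?mulr_gt0.
have n10 : (0 < n.-1)%N by rewrite -ltnS prednK // ltnW.
have n0 : 0 <= (n.-1%:R : R)^-1 by rewrite invr_ge0.
have q0 : 0 <= n%:R / n.-1%:R :> R by rewrite divr_ge0.
have W0 x : 0 <= W x by apply: le_trans (GW (Ordinal (ltnW n1)) x).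
have r0 : n%:R / n.-1%:R != 0 :> R.
  by rewrite mulf_neq0 ?invr_neq0 ?pnatr_eq0 -?lt0n // ltnW.
have a0 : 0 <= a.
  by apply: (cvg_le (cvg_cst 0) Fa); apply: nearW => N; apply: riemann_ge0 => x; exact: powR_ge0.
have b0 : 0 <= b.
  by apply: (cvg_le (cvg_cst 0) Wb); apply: nearW => N; exact: riemann_ge0.
(* The slack e absorbs the errors of the difference quotients and of the convergence to [b]; it is
   removed after taking the root of both sides, which makes it additive. *)
suff main e : 0 < e -> a <= (b + e) `^ (n%:R / n.-1%:R).
  have root_a : a = (a `^ (n%:R / n.-1%:R)^-1) `^ (n%:R / n.-1%:R).
    by rewrite -powRrM mulVf // powRr1.
  rewrite {1}root_a; apply: ge0_ler_powR; rewrite ?nnegrE ?powR_ge0 //.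
  apply/ler_addgt0Pr => e e0; have ae := main e e0.
  have -> : b + e = ((b + e) `^ (n%:R / n.-1%:R)) `^ (n%:R / n.-1%:R)^-1.
    by rewrite -powRrM divff // powRr1 // addr_ge0 // ltW.
  by apply: ge0_ler_powR; rewrite ?nnegrE ?powR_ge0 ?invr_ge0.
move=> e0; have d0 : 0 < e / 2 / (2 * L) ^+ n by rewrite !divr_gt0.
apply: (cvg_le Fa (cvg_cst _)).
have near_quotient : \forall N \near \oo, forall k x,
    `|F (x + mesh N *: e_ k) - F x - mesh N * G k x| <= mesh N * (e / 2 / (2 * L) ^+ n).
  by apply: filter_forall => k; exact: (difference_quotient (cG k) (sG k) (dF k) d0).
set d := e / 2 / (2 * L) ^+ n in d0 near_quotient.
near=> N; have m0 := mesh_gt0 L0 N.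
have hq : forall k x, `|F (x + mesh N *: e_ k) - F x - mesh N * G k x| <= mesh N * d.
  by near: N.
have hN k x : `|F (x + mesh N *: e_ k) - F x| <= mesh N * (W x + d).
  have h : `|F (x + mesh N *: e_ k) - F x - mesh N * G k x| <= mesh N * d.
    exact: hq.
  rewrite -(subrK (mesh N * G k x) (_ - _)) (le_trans (ler_normD _ _)) //.
  by rewrite mulrDr addrC lerD // normrM gtr0_norm // ler_pM2l.
have WN : riemann N W <= b + e / 2.
  by near: N; apply: (cvgr_le _ Wb); rewrite ltrDl divr_gt0.
(* [S] bounds the total variation in every direction. Completed by [mesh N ^+ n.-1] it is a Riemann
   sum, and the power n / (n - 1) of that factor is exactly the volume [mesh N ^+ n] of a cell. *)
pose S := mesh N * \sum_(x : {ffun 'I_n -> 'I_N.+1}) (W (node N (fun i => x i)) + d).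
have S0 : 0 <= S.
  by rewrite mulr_ge0 ?(ltW m0) // sumr_ge0 // => x _; rewrite addr_ge0 // ltW.
have SE : mesh N ^+ n.-1 * S <= b + e.
  rewrite mulrA -exprSr prednK ?(ltnW n1) //.
  have -> : mesh N ^+ n * \sum_(x : {ffun 'I_n -> 'I_N.+1}) (W (node N (fun i => x i)) + d) =
      riemann N W + riemann N (fun _ : 'rV[R]_n => d).
    exact: (riemannD N W (fun=> d)).
  by rewrite riemann_cst /d [_ * (_ / _)]mulrC divfK ?gt_eqF //; move: WN; lra.
apply: (@le_trans _ _ ((mesh N ^+ n.-1 * S) `^ (n%:R / n.-1%:R))); last first.
  have mS0 : 0 <= mesh N ^+ n.-1 * S by rewrite mulr_ge0 ?exprn_ge0 ?(ltW m0).
  by apply: ge0_ler_powR => //; rewrite ?nnegrE //; lra.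
rewrite powRM ?exprn_ge0 ?(ltW m0) //.
have -> : (mesh N ^+ n.-1) `^ (n%:R / n.-1%:R) = mesh N ^+ n.
  rewrite -(powR_mulrn n.-1) ?(ltW m0) // -powRrM [_ * (_ / _)]mulrC divfK ?pnatr_eq0 -?lt0n //.
  by rewrite powR_mulrn ?(ltW m0).
rewrite /riemann_sum ler_wpM2l ?exprn_ge0 ?(ltW m0) //.
apply: le_trans (gagliardo_nirenberg_sum n1 _ _ (fun k x => norm_le_sum_step k x sF)) _ => //.
rewrite [X in _ `^ X]mulrC powRrM powR_mulrn ?powR_ge0 //.
rewrite -[X in _ ^+ X]card_ord -prodr_const; apply: ler_prod => k _; rewrite powR_ge0 /=.
apply: ge0_ler_powR => //; rewrite ?nnegrE ?sumr_ge0 //.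
by rewrite /S mulr_sumr; apply: ler_sum => x _; exact: hN.
Unshelve. all: by end_near. Qed.
End riemann_derivative.

(** * The maximum principle in narrow domains *)

Section continuity_at.
Context {R : realType} {T : topologicalType}.
Implicit Types (f g : T -> R) (x : T).

Lemma continuous_at_cst (a : R) x : {for x, continuous (fun _ : T => a)}.
Proof. exact: cvg_cst. Qed.

Lemma continuous_at_add f g x : {for x, continuous f} -> {for x, continuous g} ->
  {for x, continuous (fun y => f y + g y)}.
Proof. exact: cvgD. Qed.

Lemma continuous_at_sub f g x : {for x, continuous f} -> {for x, continuous g} ->
  {for x, continuous (fun y => f y - g y)}.
Proof. exact: cvgB. Qed.

Lemma continuous_at_mul f g x : {for x, continuous f} -> {for x, continuous g} ->
  {for x, continuous (fun y => f y * g y)}.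
Proof. exact: cvgM. Qed.

Lemma continuous_at_inv f x : f x != 0 -> {for x, continuous f} ->
  {for x, continuous (fun y => (f y)^-1)}.
Proof. exact: cvgV. Qed.

Lemma continuous_at_opp f x : {for x, continuous f} -> {for x, continuous (fun y => - f y)}.
Proof. exact: cvgN. Qed.

Lemma continuous_at_sum (I : Type) (r : seq I) (f : I -> T -> R) x :
  (forall i, {for x, continuous (f i)}) -> {for x, continuous (fun y => \sum_(i <- r) f i y)}.
Proof. exact: (@cvg_sum_seq R T I (nbhs x)). Qed.

Lemma continuous_at_comp (g : R -> R) f x : {for x, continuous f} -> {for f x, continuous g} ->
  {for x, continuous (fun y => g (f y))}.
Proof. by move=> cf cg; exact: (continuous_comp cf cg). Qed.

Lemma continuous_at_max f g x : {for x, continuous f} -> {for x, continuous g} ->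
  {for x, continuous (fun y => Num.max (f y) (g y))}.
Proof. by move=> cf cg; exact: (continuous_max cf cg). Qed.

Lemma continuous_at_min f g x : {for x, continuous f} -> {for x, continuous g} ->
  {for x, continuous (fun y => Num.min (f y) (g y))}.
Proof. by move=> cf cg; exact: (continuous_min cf cg). Qed.

End continuity_at.

(** * Powers of the positive part *)

Section positive_power.
Context {R : realType}.
Implicit Types (t p : R).

(** Of class C^1 for p > 1, which restricts the exponents of the test functions. *)
Definition pospow p t : R := Num.max t 0 `^ p.

Lemma pospow_ge0 p t : 0 <= pospow p t. Proof. exact: powR_ge0. Qed.

Lemma pospow_le0 p t : p != 0 -> t <= 0 -> pospow p t = 0.
Proof. by move=> p0 t0; rewrite /pospow max_r // powR0. Qed.

Lemma pospow_gt0 p t : 0 < t -> pospow p t = t `^ p.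
Proof. by move=> t0; rewrite /pospow max_l // ltW. Qed.

Lemma pospow_cvg0 p : 0 < p -> pospow p t @[t --> 0] --> 0.
Proof.
move=> p0; apply/cvgrPdist_lt => e e0; near=> t; rewrite sub0r normrN ger0_norm ?pospow_ge0 //.
case: (lerP t 0) => t0; first by rewrite pospow_le0 // gt_eqF.
have te : t < e `^ p^-1.
  near: t; apply: (@cvgr_lt R R (nbhs 0) _ id 0) => //; first exact: powR_gt0.
rewrite pospow_gt0 //; have -> : e = (e `^ p^-1) `^ p.
  by rewrite -powRrM mulVf ?gt_eqF // powRr1 // ltW.
by apply: gt0_ltr_powR => //; rewrite nnegrE ?powR_ge0 // ltW.
Unshelve. all: by end_near. Qed.

Lemma is_derive_pospow_gt0 p t : 0 < t -> is_derive t 1 (pospow p) (p * pospow (p - 1) t).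
Proof.
move=> t0; rewrite pospow_gt0 //.
apply: (@near_eq_is_derive _ _ _ (fun t => t `^ p)).
  by near=> u; rewrite pospow_gt0 //; near: u; exact: lt_nbhsr.
exact: is_derive1_powR.
Unshelve. all: by end_near. Qed.

Lemma is_derive_pospow_lt0 p t : p != 0 -> t < 0 -> is_derive t 1 (pospow p) 0.
Proof.
move=> p0 t0; apply: (@near_eq_is_derive _ _ _ (cst 0)).
  by near=> u; rewrite pospow_le0 //; apply/ltW; near: u; exact: lt_nbhsl.
Unshelve. all: by end_near. Qed.

Lemma pospow_continuous p : 0 < p -> continuous (pospow p).
Proof.
move=> p0 t; case: (ltgtP t 0) => t0.
- apply: differentiable_continuous; apply/derivable1_diffP.
  by case: (is_derive_pospow_lt0 (lt0r_neq0 p0) t0).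
- apply: differentiable_continuous; apply/derivable1_diffP.
  by case: (is_derive_pospow_gt0 p t0).
- by rewrite t0 /continuous_at pospow_le0 ?gt_eqF //; exact: pospow_cvg0.
Qed.

Lemma is_derive_pospow p t : 1 < p -> is_derive t 1 (pospow p) (p * pospow (p - 1) t).
Proof.
move=> p1; have p0 : 0 < p by lra.
have q0 : 0 < p - 1 by lra.
case: (ltgtP t 0) => [t0|t0|->]; last 1 first.
- rewrite [pospow (p - 1) 0]pospow_le0 ?gt_eqF // mulr0.
  have lim0 : h^-1 *: ((pospow p \o shift 0) (h *: 1) - pospow p 0) @[h --> 0^'] --> (0 : R).
    have : pospow (p - 1) h @[h --> 0^'] --> (0 : R).
      by apply: cvg_trans (pospow_cvg0 q0); apply: cvg_app; exact: nbhs_dnbhs.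
    apply: cvg_trans; apply: near_eq_cvg; near=> h => /=.
    have h0 : h != 0 by near: h; exact: nbhs_dnbhs_neq.
    rewrite addr0 [h *: 1]mulr1 [pospow p 0]pospow_le0 ?gt_eqF // subr0.
    move: h0; rewrite neq_lt => /orP[h0|h0].
      by rewrite !pospow_le0 ?gt_eqF ?(ltW h0) // scaler0.
    by rewrite !pospow_gt0 // -(mulr_powRB1 (ltW h0) p0) /GRing.scale /= mulKf // gt_eqF.
  by apply: DeriveDef; [apply/cvg_ex; exists 0|exact: cvg_lim].
- rewrite [pospow (p - 1) t]pospow_le0 ?gt_eqF ?ltW // mulr0.
  by apply: is_derive_pospow_lt0 => //; rewrite gt_eqF.
- exact: is_derive_pospow_gt0.
Unshelve. all: by end_near. Qed.

Lemma pospowD p q t : 0 < p -> 0 < q -> pospow p t * pospow q t = pospow (p + q) t.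
Proof.
by move=> p0 q0; rewrite /pospow powRD // gt_eqF ?addr_gt0.
Qed.

Lemma pospowM p q t : pospow p t `^ q = pospow (p * q) t.
Proof. by rewrite /pospow powRrM. Qed.

Lemma cvg_powR (u : nat -> R) (a p : R) : 0 < p -> (forall N, 0 <= u N) ->
  u @ \oo --> a -> (fun N => u N `^ p) @ \oo --> a `^ p.
Proof.
move=> p0 u0 ua; have a0 : 0 <= a.
  by apply: (cvg_le (cvg_cst 0) ua); exact: nearW.
have uE v : 0 <= v -> v `^ p = pospow p v by move=> v0; rewrite /pospow max_l.
have h : pospow p (u N) @[N --> \oo] --> pospow p a.
  exact: (continuous_cvg _ (pospow_continuous p0 (x:=a)) ua).
rewrite uE // (_ : (fun N => u N `^ p) = fun N => pospow p (u N)) //.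
by apply/funext => N; rewrite uE.
Qed.

End positive_power.

Section chain.
Context {R : realType} {V : normedModType R}.

Lemma is_derive_line0 (F : V -> R) (x v : V) (d : R) :
  is_derive (0 : R) 1 (fun s : R => F (x + s *: v)) d -> is_derive x v F d.
Proof.
move=> [dF <-].
have eqf : (fun h : R => h^-1 *: ((F \o shift x) (h *: v) - F x)) =
  (fun h : R => h^-1 *: (((fun s : R => F (x + s *: v)) \o shift 0) (h *: 1) - F (x + 0 *: v))).
  by apply/funext => h /=; rewrite [h *: 1]mulr1 scale0r !addr0 [x + _]addrC.
by apply: DeriveDef; rewrite /derivable /derive eqf.
Qed.

Lemma is_derive_comp_line (g : R -> R) (F : V -> R) (x v : V) (dg dF : R) :
  is_derive x v F dF -> is_derive (F x) 1 g dg -> is_derive x v (fun y => g (F y)) (dg * dF).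
Proof.
move=> hF hg; apply: is_derive_line0.
have h1 : is_derive (0 : R) 1 (fun s : R => F (x + s *: v)) dF.
  by apply: is_derive_line; rewrite scale0r addr0.
have h2 : is_derive (F (x + 0 *: v)) 1 g dg by rewrite scale0r addr0.
exact: (@is_derive1_comp _ g (fun s : R => F (x + s *: v)) 0 dg dF h2 h1).
Qed.

End chain.

(** * Extension by zero *)

Section extension_by_zero.
Context {R : realType} {V : normedModType R}.
Variables (E K : set V).
Hypotheses (oE : open E) (cK : closed K) (KE : K `<=` E).
Implicit Types (g : V -> R).

Definition ext0 g x : R := if x \in E then g x else 0.

Lemma ext0_in g x : E x -> ext0 g x = g x.
Proof. by move=> xE; rewrite /ext0 mem_set. Qed.

Lemma ext0_out g x : ~ E x -> ext0 g x = 0.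
Proof. by move=> xE; rewrite /ext0 memNset. Qed.

Lemma near_in x : E x -> \forall y \near x, E y.
Proof. by move=> xE; apply: open_nbhs_nbhs; split. Qed.

Lemma near_out x : ~ K x -> \forall y \near x, ~ K y.
Proof. by move=> xK; apply: open_nbhs_nbhs; split => //; exact: closed_openC. Qed.

(** Every point outside [E] has the complement of the closed set [K] as an open neighbourhood, on
    which the extension is 0. *)
Lemma ext0_continuous g : (forall x, E x -> {for x, continuous g}) ->
  (forall x, E x -> ~ K x -> g x = 0) -> continuous (ext0 g).
Proof.
move=> cg g0 x; have [xE|xE] := pselect (E x).
  rewrite /continuous_at ext0_in //; have := cg x xE; apply: cvg_trans.
  apply: near_eq_cvg; have := near_in xE; apply: filterS => y yE.
  by rewrite ext0_in.
have xK : ~ K x by move=> /KE.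
rewrite /continuous_at ext0_out //; have : cst (0 : R) y @[y --> x] --> (0 : R) by exact: cvg_cst.
apply: cvg_trans.
apply: near_eq_cvg; have := near_out xK; apply: filterS => y yK.
by rewrite /ext0; case: ifPn => //; rewrite inE => /g0 ->.
Qed.

Lemma is_derive_ext0 g g' v : (forall x, E x -> is_derive x v g (g' x)) ->
  (forall x, E x -> ~ K x -> g x = 0) -> forall x, is_derive x v (ext0 g) (ext0 g' x).
Proof.
move=> dg g0 x; have [xE|xE] := pselect (E x).
  rewrite ext0_in //; apply: near_eq_is_derive (dg x xE).
  by have := near_in xE; apply: filterS => y yE; rewrite ext0_in.
have xK : ~ K x by move=> /KE.
rewrite ext0_out //; apply: near_eq_is_derive (is_derive_cst 0 x v).
have := near_out xK; apply: filterS => y yK.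
by rewrite /ext0; case: ifPn => //; rewrite inE => /g0 ->.
Qed.

End extension_by_zero.

(** * Hoelder's and Jensen's inequalities for Riemann sums *)

Section riemann_hoelder.
Context {R : realType} {n : nat}.
Variable L : R.
Hypothesis L0 : 0 < L.
Implicit Types (F G : 'rV[R]_n -> R).
Local Notation riemann := (riemann_sum L).

Lemma riemann_eq0 N F : (forall x, 0 <= F x) -> riemann N F = 0 ->
  forall k : {ffun 'I_n -> 'I_N.+1}, F (node L N (fun i => k i)) = 0.
Proof.
move=> F0 /eqP; rewrite /riemann_sum mulf_eq0 expf_eq0 (gt_eqF (mesh_gt0 L0 N)) andbF /=.
by move=> /eqP /psumr_eq0P h k; apply: h.
Qed.

(** Young's inequality at each node, after scaling by [a] and [b], the inverses of the two norms. If
    one of the sums is 0, that factor vanishes at every node. *)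
Lemma riemann_hoelder N p q F G : 0 < p -> 0 < q -> p^-1 + q^-1 = 1 ->
  (forall x, 0 <= F x) -> (forall x, 0 <= G x) ->
  riemann N (fun x => F x * G x) <=
  riemann N (fun x => F x `^ p) `^ p^-1 * riemann N (fun x => G x `^ q) `^ q^-1.
Proof.
move=> p0 q0 pq F0 G0.
set A := riemann N (fun x => F x `^ p); set B := riemann N (fun x => G x `^ q).
have A0 : 0 <= A by apply: riemann_ge0 => // x; exact: powR_ge0.
have B0 : 0 <= B by apply: riemann_ge0 => // x; exact: powR_ge0.
have triv : (forall k : {ffun 'I_n -> 'I_N.+1},
    F (node L N (fun i => k i)) * G (node L N (fun i => k i)) = 0) ->
    riemann N (fun x => F x * G x) <= A `^ p^-1 * B `^ q^-1.
  by move=> h; rewrite /riemann_sum big1 ?mulr0 ?mulr_ge0 ?powR_ge0.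
have [A00|A1] := eqVneq A 0.
  apply: triv => k; have /eqP := riemann_eq0 (fun x => powR_ge0 (F x) p) A00 k.
  by rewrite powR_eq0 => /andP[/eqP -> _]; rewrite mul0r.
have [B00|B1] := eqVneq B 0.
  apply: triv => k; have /eqP := riemann_eq0 (fun x => powR_ge0 (G x) q) B00 k.
  by rewrite powR_eq0 => /andP[/eqP -> _]; rewrite mulr0.
have Ap : 0 < A by rewrite lt_def A1.
have Bp : 0 < B by rewrite lt_def B1.
have hA : A = riemann N (fun x => F x `^ p) by [].
have hB : B = riemann N (fun x => G x `^ q) by [].
clearbody A B; set a := A `^ (- p^-1); set b := B `^ (- q^-1).
have aA : A `^ p^-1 * a = 1 by rewrite /a powRN divff // gt_eqF // powR_gt0.
have bB : B `^ q^-1 * b = 1 by rewrite /b powRN divff // gt_eqF // powR_gt0.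
have ap : a `^ p = A^-1 by rewrite /a -powRrM mulNr mulVf ?gt_eqF // powR_inv1.
have bq : b `^ q = B^-1 by rewrite /b -powRrM mulNr mulVf ?gt_eqF // powR_inv1.
have a0 : 0 <= a by exact: powR_ge0.
have b0 : 0 <= b by exact: powR_ge0.
clearbody a b.
have young x : F x * G x <=
    (A `^ p^-1 * B `^ q^-1) * ((A^-1 / p) * F x `^ p + (B^-1 / q) * G x `^ q).
  have := @conjugate_powR R (F x * a) (G x * b) p q.
  rewrite !mulr_ge0 ?powR_ge0 // => /(_ isT isT p0 q0 pq).
  rewrite !powRM ?powR_ge0 // ap bq => h.
  have -> : F x * G x = (A `^ p^-1 * B `^ q^-1) * (F x * a * (G x * b)).
    transitivity ((A `^ p^-1 * a) * (B `^ q^-1 * b) * (F x * G x)); last by ring.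
    by rewrite aA bB !mul1r.
  apply: ler_wpM2l; first by rewrite mulr_ge0 // powR_ge0.
  by apply: le_trans h _; rewrite le_eqVlt; apply/orP; left; apply/eqP; ring.
apply: (@le_trans _ _ ((A `^ p^-1 * B `^ q^-1) * ((A^-1 / p) * A + (B^-1 / q) * B))).
  by rewrite [X in _ / p * X]hA [X in _ / q * X]hB -!riemannZ -riemannD -riemannZ; apply:
    le_riemann.
by rewrite !(mulrAC _ _^-1) !mulVf ?gt_eqF // !mul1r pq mulr1.
Qed.

(** Hoelder's inequality against the constant 1, with exponents [(1 - t)^-1] and [t^-1]. The second
    does not exist for t = 0, which is the case q = n / 2 of the application. *)
Lemma riemann_jensen N t F : 0 <= t < 1 -> (forall x, 0 <= F x) ->
  riemann N (fun x => F x `^ (1 - t)) <= riemann N F `^ (1 - t) * ((2 * L) ^+ n) `^ t.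
Proof.
move=> /andP[t0 t1] F0; have B0 : 0 <= (2 * L) ^+ n by rewrite exprn_ge0 // mulr_ge0 // ltW.
move: t0; rewrite le_eqVlt => /orP[/eqP <-|t0].
  rewrite subr0 powRr0 mulr1 powRr1 ?riemann_ge0 //.
  by apply: le_riemann => // x; rewrite powRr1.
have q1 : (1 - t)^-1^-1 + t^-1^-1 = 1 by rewrite !invrK subrK.
have t2 : 0 < 1 - t by lra.
have := @riemann_hoelder N (1 - t)^-1 t^-1 (fun x => F x `^ (1 - t)) (fun=> 1).
rewrite !invr_gt0 => /(_ t2 t0 q1 (fun x => powR_ge0 _ _) (fun=> ler01)).
rewrite !invrK powR1 riemann_cst mulr1.
rewrite (_ : (fun x => (F x `^ (1 - t)) `^ (1 - t)^-1) = F); last first.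
  by apply/funext => x; rewrite -powRrM divff ?gt_eqF // powRr1.
by rewrite (_ : (fun x => F x `^ (1 - t) * 1) = (fun x => F x `^ (1 - t))) //; apply/funext => x;
  rewrite mulr1.
Qed.

End riemann_hoelder.

(** * The energy argument on a set where the weight is small *)

Section narrow_domain.
Context {R : realType} {n : nat}.
Variables (L q : R).
Hypotheses (n1 : (1 < n)%N) (L0 : 0 < L) (q1 : 1 < q) (nq : n%:R / 2 <= q).
Local Notation T := (caratheodory_type (@lebesgue_outer R n)).
Local Notation mu := (@lebesgue_rV R n).
Local Notation riemann := (riemann_sum L).
Local Notation supported := (supported L).
Local Notation e_ k := (delta_mx 0 k : 'rV[R]_n).

(** Testing with the square of z = (phi - e)^+ produces H z^3, and Hoelder's inequality with the
    conjugate exponent [q'] leads to the power [s] of z. The Gagliardo-Nirenberg inequality with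
    exponent [r] is applied to the power [gam] of z, so [gam * r = s]. Cauchy-Schwarz leaves the
    power [2 * gam - 3 = s * (1 - theta)], and Jensen's inequality makes up for [theta], which is 0
    in the critical case q = n / 2. *)
Let q' : R := q / (q - 1).
Let s : R := 3 * q'.
Let gam : R := s * n.-1%:R / n%:R.
Let theta : R := 2 / n%:R - q^-1.
Let r : R := n%:R / n.-1%:R.
Let B : R := (2 * L) ^+ n.

Let n0 : 0 < n%:R :> R. Proof. by rewrite ltr0n ltnW. Qed.
Let n10 : 0 < n.-1%:R :> R. Proof. by rewrite ltr0n -ltnS prednK // ltnW. Qed.
Let nE : n%:R = n.-1%:R + 1 :> R. Proof. by rewrite natr1 prednK // ltnW. Qed.
Let q0 : 0 < q. Proof. exact: lt_trans q1. Qed.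
Let q_neq0 : q != 0. Proof. by rewrite gt_eqF. Qed.
Let q1_neq0 : q - 1 != 0. Proof. by rewrite subr_eq0 gt_eqF. Qed.
Let n_neq0 : n%:R != 0 :> R. Proof. by rewrite gt_eqF. Qed.
Let q'1 : 1 < q'.
Proof. by rewrite /q' ltr_pdivlMr ?subr_gt0 // mul1r ltrBlDr ltrDl. Qed.
Let qq' : q^-1 + q'^-1 = 1. Proof. by rewrite /q'; field; rewrite ?q_neq0 ?q1_neq0. Qed.
Let B0 : 0 < B. Proof. by rewrite exprn_gt0 // mulr_gt0. Qed.
Let n2 : 2 <= n%:R :> R. Proof. by rewrite ler_nat. Qed.
Let theta0 : 0 <= theta < 1.
Proof.
apply/andP; split; rewrite /theta.
  rewrite subr_ge0 -[2 / _]invrK lef_pV2 ?posrE ?invr_gt0 ?divr_gt0 //.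
  by rewrite invfM invrK mulrC.
rewrite ltrBlDr; have : 2 / n%:R <= 1 :> R by rewrite ler_pdivrMr // mul1r.
have : 0 < q^-1 by rewrite invr_gt0.
by move=> ? ?; lra.
Qed.
Let gam32 : 3 / 2 < gam.
Proof.
have : 1 / 2 <= n.-1%:R / n%:R :> R by rewrite ler_pdivlMr //; have := n2; have := nE; lra.
by rewrite /gam -mulrA /s; have := q'1; move: (n.-1%:R / n%:R) => c c2; nra.
Qed.
Let gamr : gam * r = s. Proof. by rewrite /gam /r; field; rewrite !gt_eqF. Qed.
Let gam_theta : 2 * gam - 3 = s * (1 - theta).
Proof.
rewrite /gam /s /theta /q' (_ : n.-1%:R = n%:R - 1); last by rewrite nE addrK.
by field; rewrite n_neq0 q_neq0.
Qed.
Let s0 : 0 < s. Proof. by rewrite /s mulr_gt0 // (lt_trans ltr01). Qed.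
Let gam0 : 0 < gam. Proof. by have := gam32; lra. Qed.

(* [gam ^+ 2 * B `^ theta] is the constant of Sobolev's inequality for the power
   3/2 of [(phi - e)^+], and [narrow_const] the size of the integral of [H `^ q]
   below which testing [- Delta phi <= H phi] with [((phi - e)^+) ^+ 2] bounds the
   integral of [((phi - e)^+) `^ s] by a quantity that vanishes with e. *)
Definition narrow_const : R := ((gam ^+ 2 * B `^ theta)^-1) `^ q.

Lemma narrow_const_gt0 : 0 < narrow_const.
Proof.
by rewrite powR_gt0 // invr_gt0 mulr_gt0 ?powR_gt0 // exprn_gt0.
Qed.

Section domain.
Variables (E : set 'rV[R]_n) (phi H : 'rV[R]_n -> R) (d dd : 'I_n -> 'rV[R]_n -> R) (M : R).
(** [cphi], closedness of the superlevel sets in the whole space, is the form in which [phi]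
    vanishes at the boundary of [E]. *)
Hypotheses (oE : open E) (EL : forall x, E x -> `|x| < L)
  (phi_gt0 : forall x, E x -> 0 < phi x) (phiM : forall x, E x -> phi x <= M)
  (cphi : forall e, 0 < e -> closed [set x | E x /\ e <= phi x])
  (phi_cont : forall x, E x -> {for x, continuous phi})
  (d_cont : forall k x, E x -> {for x, continuous (d k)})
  (d_derive : forall k x, E x -> is_derive x (e_ k) phi (d k x))
  (dd_derive : forall k x, E x -> is_derive x (e_ k) (d k) (dd k x))
  (dd_cont : forall k x, E x -> {for x, continuous (dd k)})
  (mH : measurable_fun (E : set T) (H : T -> R)) (H0 : forall x, E x -> 0 <= H x)
  (lapH : forall x, E x -> - (\sum_k dd k x) <= H x * phi x)
  (intH : (\int[mu]_(x in E) (`|H x| `^ q)%:E <= narrow_const%:E)%E).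

Let lap x : R := \sum_k dd k x.
Let nrm2 x : R := \sum_k d k x ^+ 2.
Let nrm x : R := Num.sqrt (nrm2 x).
Let nrm2_ge0 x : 0 <= nrm2 x. Proof. by apply: sumr_ge0 => k _; exact: sqr_ge0. Qed.

Let lap_cont x : E x -> {for x, continuous lap}.
Proof. by move=> xE; apply: continuous_at_sum => k; exact: dd_cont. Qed.
Let nrm2_cont x : E x -> {for x, continuous nrm2}.
Proof.
move=> xE; apply: continuous_at_sum => k.
have -> : (fun y => d k y ^+ 2) = (fun y => d k y * d k y) by apply/funext => y; rewrite expr2.
by apply: continuous_at_mul; exact: d_cont.
Qed.
Let nrm_cont x : E x -> {for x, continuous nrm}.
Proof. by move=> xE; apply: continuous_at_comp; [exact: nrm2_cont|exact: sqrt_continuous]. Qed.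

Section level.
Variable e : R.
Hypothesis e0 : 0 < e.

(** Products and powers of such functions are again of this form, so the Sobolev estimate reduces to
    a computation with exponents. *)
Definition zed (p : R) (h : 'rV[R]_n -> R) := ext0 E (fun x => pospow p (phi x - e) * h x).

Let K e' : set 'rV[R]_n := [set x | E x /\ e' <= phi x].
Let KE e' : K e' `<=` E. Proof. by move=> x []. Qed.
Let notK e' x : E x -> ~ K e' x -> phi x <= e'.
Proof. by move=> xE xK; rewrite leNgt; apply/negP => h; apply: xK; split => //; exact: ltW. Qed.

Lemma zed_cont p h : 0 < p -> (forall x, E x -> {for x, continuous h}) -> continuous (zed p h).
Proof.
move=> p0 ch; apply: (ext0_continuous oE (cphi e0) (@KE e)).
  move=> x xE; apply: continuous_at_mul; last exact: ch.
  apply: continuous_at_comp; last exact: pospow_continuous.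
  by apply: continuous_at_sub; [exact: phi_cont|exact: continuous_at_cst].
by move=> x xE /(notK xE) xe; rewrite pospow_le0 ?mul0r ?gt_eqF //; lra.
Qed.

Let zed_supp p h : supported (zed p h).
Proof. by move=> x xL; rewrite /zed ext0_out // => /EL; lra. Qed.

Lemma zed_ge0 p h : (forall x, E x -> 0 <= h x) -> forall x, 0 <= zed p h x.
Proof.
move=> h0 x; have [xE|xE] := pselect (E x); last by rewrite /zed ext0_out.
by rewrite /zed ext0_in // mulr_ge0 ?pospow_ge0 // h0.
Qed.

Let zedM p p' h h' x : 0 < p -> 0 < p' ->
  zed p h x * zed p' h' x = zed (p + p') (fun x => h x * h' x) x.
Proof.
move=> p0 p'0; have [xE|xE] := pselect (E x); last by rewrite /zed !ext0_out ?mul0r.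
by rewrite /zed !ext0_in // mulrACA pospowD.
Qed.

Let zed_powR p p' x : p' != 0 -> zed p (fun=> 1) x `^ p' = zed (p * p') (fun=> 1) x.
Proof.
move=> p'0; have [xE|xE] := pselect (E x); last by rewrite /zed !ext0_out ?powR0.
by rewrite /zed !ext0_in // !mulr1 pospowM.
Qed.

Let zedZ p a h x : zed p (fun x => a * h x) x = a * zed p h x.
Proof.
have [xE|xE] := pselect (E x); last by rewrite /zed !ext0_out ?mulr0.
by rewrite /zed !ext0_in // mulrCA.
Qed.

Let one_cont (x : 'rV[R]_n) : E x -> {for x, continuous (fun _ : 'rV[R]_n => 1 : R)}.
Proof. by move=> _; exact: continuous_at_cst. Qed.

Let phi_e_derive p k x : 1 < p -> E x ->
  is_derive x (e_ k) (fun x => pospow p (phi x - e)) (p * pospow (p - 1) (phi x - e) * d k x).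
Proof.
move=> p1 xE.
have h : is_derive x (e_ k) (fun x => phi x - e) (d k x).
  by rewrite -[d k x]subr0; apply: is_deriveB; exact: d_derive.
exact: (is_derive_comp_line h (is_derive_pospow _ p1)).
Qed.

Lemma zed_cvg : exists2 l : R, riemann N (zed s (fun=> 1)) @[N --> \oo] --> l &
   l%:E = (\int[mu]_x (zed s (fun=> 1) x)%:E)%E.
Proof.
by apply: (riemann_cvg L0); [exact: zed_cont|exact: zed_supp|exact: zed_ge0].
Qed.

(** With [W] the limit for the gradient of z^gam and [Z] that for z^(2 gam - 3): Gagliardo-Nirenberg
    bounds [Y] by the power [r] of [W], Cauchy-Schwarz bounds W^2 by gam^2 X Z, and Jensen bounds
    [Z] by the power [1 - theta] of [Y]. Since 2 / r = 1 / q' + (1 - theta), dividing by that power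
    of [Y > 0] gives the claim. *)
Lemma sobolev_level (Y X : R) : riemann N (zed s (fun=> 1)) @[N --> \oo] --> Y ->
  riemann N (zed 1 nrm2) @[N --> \oo] --> X -> 0 < Y ->
  Y `^ q'^-1 <= gam ^+ 2 * B `^ theta * X.
Proof.
move=> hY hX Y0.
have n00 x : 0 <= nrm x by exact: sqrtr_ge0.
have gn_cont : forall x, E x -> {for x, continuous (fun x => gam * nrm x)}.
  by move=> x xE; apply: continuous_at_mul; [exact: continuous_at_cst|exact: nrm_cont].
have g32 := gam32; have g0 : 0 <= gam by lra.
have g1 : 0 < gam - 1 by lra.
have g3 : 0 < 2 * gam - 3 by lra.
have p1 : 0 < 2^-1 :> R by rewrite invr_gt0.
have p2 : 0 < gam - 3 / 2 by lra.
have half : 2^-1 + 2^-1 = 1 :> R by lra.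
have e1 : 2^-1 + (gam - 3 / 2) = gam - 1 by lra.
have e2 : gam - 3 / 2 + (gam - 3 / 2) = 2 * gam - 3 by lra.
have ep := e0.
have t1 : 0 < 1 - theta by rewrite subr_gt0; have /andP[] := theta0.
have [W hW _] : exists2 l : R, riemann N (zed (gam - 1) (fun x => gam * nrm x)) @[N --> \oo] --> l &
   l%:E = (\int[mu]_x (zed (gam - 1) (fun x => gam * nrm x) x)%:E)%E.
  apply: (riemann_cvg L0); [exact: zed_cont|exact: zed_supp|apply: zed_ge0 => x _].
  exact: mulr_ge0.
have [Z hZ _] : exists2 l : R, riemann N (zed (2 * gam - 3) (fun=> 1)) @[N --> \oo] --> l &
   l%:E = (\int[mu]_x (zed (2 * gam - 3) (fun=> 1) x)%:E)%E.
  by apply: (riemann_cvg L0); [exact: zed_cont|exact: zed_supp|exact: zed_ge0].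
have r0 : r != 0 by rewrite mulf_neq0 ?invr_neq0 // gt_eqF.
have X0 : 0 <= X.
  by apply: (cvg_le (cvg_cst 0) hX); apply: nearW => N; apply: riemann_ge0 => //; exact: zed_ge0.
have W0 : 0 <= W.
  apply: (cvg_le (cvg_cst 0) hW); apply: nearW => N; apply: riemann_ge0 => //; apply: zed_ge0 =>
    x _.
  exact: mulr_ge0.
have Z0 : 0 <= Z.
  by apply: (cvg_le (cvg_cst 0) hZ); apply: nearW => N; apply: riemann_ge0 => //; exact: zed_ge0.
have YW : Y <= W `^ r.
  apply: (@gagliardo_nirenberg R n L L0 (zed gam (fun=> 1)) (zed (gam - 1) (fun x => gam * nrm x))
    (fun k => zed (gam - 1) (fun x => gam * d k x)) Y W n1) => //.
  - by move=> k; apply: zed_cont => // x xE; apply: continuous_at_mul; [exact: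
    continuous_at_cst|exact: d_cont].
  - move=> k x.
    have -> : zed (gam - 1) (fun x => gam * d k x) =
        ext0 E (fun x => gam * pospow (gam - 1) (phi x - e) * d k x).
      by apply/funext => y; rewrite /zed /ext0; case: ifP => // _; rewrite mulrCA mulrA.
    have -> : zed gam (fun=> 1) = ext0 E (fun x => pospow gam (phi x - e)).
      by apply/funext => y; rewrite /zed /ext0; case: ifP => // _; rewrite mulr1.
    apply: (is_derive_ext0 oE (cphi e0) (@KE e)) => [y yE|y yE /(notK yE) ye].
      by apply: phi_e_derive => //; lra.
    by rewrite pospow_le0 ?gt_eqF //; lra.
  - move=> k x; have [xE|xE] := pselect (E x); last by rewrite /zed !ext0_out ?normr0.
    rewrite /zed !ext0_in // normrM ger0_norm ?pospow_ge0 // ler_wpM2l ?pospow_ge0 //.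
    rewrite normrM ger0_norm // ler_wpM2l // -sqrtr_sqr ler_wsqrtr //.
    by rewrite /nrm2 (bigD1 k) //= lerDl sumr_ge0 // => j _; exact: sqr_ge0.
  - rewrite (_ : (fun N => _) = (fun N => riemann N (zed s (fun=> 1)))) //.
    apply/funext => N; congr (riemann N); apply/funext => x.
    by rewrite ger0_norm ?zed_ge0 // zed_powR // gamr.
have WXZ : W <= X `^ 2^-1 * (gam ^+ 2 * Z) `^ 2^-1.
  apply: (cvg_le hW (cvgM (cvg_powR _ _ hX) (cvg_powR _ _ (cvgM (cvg_cst (gam ^+ 2)) hZ)))).
  - by rewrite invr_gt0.
  - by move=> N; apply: riemann_ge0 => //; exact: zed_ge0.
  - by rewrite invr_gt0.
  - by move=> N; rewrite mulr_ge0 ?exprn_ge0 // riemann_ge0 //; exact: zed_ge0.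
  apply: nearW => N.
  have := @riemann_hoelder R n L L0 N 2 2 (zed 2^-1 nrm) (zed (gam - 3 / 2) (fun=> gam)).
  move=> /(_ (ltr0Sn _ _) (ltr0Sn _ _) half (zed_ge0 _ (fun x _ => n00 x)) (zed_ge0 _ (fun x _ =>
    g0))) h.
  have E1 : (fun x => zed 2^-1 nrm x * zed (gam - 3 / 2) (fun=> gam) x) = zed (gam - 1) (fun x =>
    gam * nrm x).
    apply/funext => x; rewrite (zedM _ _ _ p1 p2).
    rewrite e1.
    by congr zed; apply/funext => y; rewrite mulrC.
  have E2 : (fun x => zed 2^-1 nrm x `^ 2) = zed 1 nrm2.
    apply/funext => x; rewrite powR_mulrn ?zed_ge0 // expr2 (zedM _ _ _ p1 p1).
    rewrite half.
    by congr (zed 1 _ x); apply/funext => y; rewrite -expr2 sqr_sqrtr.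
  have E3 : (fun x => zed (gam - 3 / 2) (fun=> gam) x `^ 2) = (fun x => gam ^+ 2 * zed (2 * gam -
    3) (fun=> 1) x).
    apply/funext => x; rewrite powR_mulrn; last exact: zed_ge0.
    rewrite expr2 (zedM _ _ _ p2 p2).
    rewrite e2.
    by rewrite -zedZ; congr (zed _ _ x); apply/funext => y; rewrite mulr1 expr2.
  by move: h; rewrite E1 E2 E3 riemannZ.
have ZY : Z <= Y `^ (1 - theta) * B `^ theta.
  apply: (cvg_le hZ (cvgM (cvg_powR t1 _ hY) (cvg_cst (B `^ theta)))).
    by move=> N; apply: riemann_ge0 => //; exact: zed_ge0.
  apply: nearW => N.
  have := @riemann_jensen R n L L0 N theta (zed s (fun=> 1)) theta0 (zed_ge0 _ (fun _ _ => ler01)).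
  by under [X in riemann N X <= _]eq_fun do rewrite zed_powR ?gt_eqF // -gam_theta.
have r_inv : r^-1 = n.-1%:R / n%:R by rewrite /r invf_div.
have Yr : Y `^ (2 / r) <= gam ^+ 2 * X * Z.
  have h : Y `^ r^-1 <= X `^ 2^-1 * (gam ^+ 2 * Z) `^ 2^-1.
    apply: le_trans WXZ.
    rewrite -[leRHS](_ : (W `^ r) `^ r^-1 = W); last by rewrite -powRrM divff // powRr1.
    by apply: ge0_ler_powR; rewrite ?nnegrE ?powR_ge0 ?(ltW Y0) // r_inv divr_ge0 // ltW.
  rewrite mulrC powRrM powR_mulrn ?powR_ge0 //.
  apply: (@le_trans _ _ ((X `^ 2^-1 * (gam ^+ 2 * Z) `^ 2^-1) ^+ 2)).
    have c1 : 0 <= X `^ 2^-1 * (gam ^+ 2 * Z) `^ 2^-1 by exact: mulr_ge0 (powR_ge0 _ _) (powR_ge0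
      _ _).
    by apply: lerXn2r => //; rewrite nnegrE // powR_ge0.
  have c0 : 0 <= gam ^+ 2 * Z by exact: mulr_ge0 (exprn_ge0 _ g0) Z0.
  have sq (a : R) : 0 <= a -> (a `^ 2^-1) ^+ 2 = a.
    by move=> a0; rewrite -powR_mulrn ?powR_ge0 // -powRrM mulVf ?pnatr_eq0 // powRr1.
  rewrite exprMn (sq _ X0) (sq _ c0).
  by rewrite mulrA [X * _]mulrC.
have expo : 2 / r = q'^-1 + (1 - theta).
  rewrite r_inv (_ : n.-1%:R = n%:R - 1); last by rewrite nE addrK.
  by rewrite /theta /q'; field; rewrite ?n_neq0 ?q_neq0 ?q1_neq0.
move: Yr; rewrite expo powRD; last by rewrite (gt_eqF Y0) implybT.
move=> Yr; rewrite -(ler_pM2r (_ : 0 < Y `^ (1 - theta))) ?powR_gt0 //.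
apply: le_trans Yr _; have -> : gam ^+ 2 * B `^ theta * X * Y `^ (1 - theta) =
  gam ^+ 2 * X * (Y `^ (1 - theta) * B `^ theta) by ring.
by rewrite ler_wpM2l // mulr_ge0 // exprn_ge0.
Qed.

Let kappa : R := (gam ^+ 2 * B `^ theta)^-1.

(* [H] is only measurable: in the Riemann sums it is replaced by the continuous
   quotient of [(- Delta phi)^+] by [phi], cut off below [phi = e]. *)
Let lapp x : R := Num.max (- lap x) 0.
Let cutoff t : R := Num.min 1 (Num.max (2 / e * t - 1) 0).
Let c x : R := cutoff (phi x) * (lapp x / phi x).
Let C := ext0 E c.

Let e2 : 0 < e / 2. Proof. by rewrite divr_gt0. Qed.

Let cutoff01 t : 0 <= cutoff t <= 1.
Proof. by rewrite /cutoff le_min ler01 le_max lexx orbT ge_min lexx. Qed.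

Let cutoff0 t : t <= e / 2 -> cutoff t = 0.
Proof.
move=> te; rewrite /cutoff max_r ?min_r // subr_le0 mulrAC ler_pdivrMr // mul1r.
by rewrite mulrC -ler_pdivlMr.
Qed.

Let cutoff1 t : e <= t -> cutoff t = 1.
Proof.
move=> te; rewrite /cutoff min_l // le_max; apply/orP; left.
by rewrite lerBrDr mulrAC ler_pdivlMr // -[1 + 1]/2 ler_pM2l.
Qed.

Let c_ge0 x : E x -> 0 <= c x.
Proof.
move=> xE; rewrite /c mulr_ge0 //; first by have /andP[] := cutoff01 (phi x).
by rewrite divr_ge0 ?(ltW (phi_gt0 xE)) // /lapp le_max lexx orbT.
Qed.

Let C_ge0 x : 0 <= C x.
Proof. by have [xE|xE] := pselect (E x); [rewrite /C ext0_in // c_ge0|rewrite /C ext0_out]. Qed.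

Let C_cont : continuous C.
Proof.
apply: (ext0_continuous oE (cphi e2) (@KE (e / 2))) => [x xE|x xE /(notK xE) xe]; last first.
  by rewrite /c cutoff0 // mul0r.
apply: continuous_at_mul.
  apply: continuous_at_min; first exact: continuous_at_cst.
  apply: continuous_at_max; last exact: continuous_at_cst.
  by apply: continuous_at_sub; [apply: continuous_at_mul; [exact: continuous_at_cst|exact:
    phi_cont]|exact: continuous_at_cst].
apply: continuous_at_mul.
  by apply: continuous_at_max; [apply: continuous_at_opp; exact: lap_cont|exact: continuous_at_cst].
by apply: continuous_at_inv; [rewrite gt_eqF // phi_gt0|exact: phi_cont].
Qed.

Let C_le x : E x -> C x <= H x.
Proof.
move=> xE; rewrite /C ext0_in // /c; have p0 := phi_gt0 xE.
have l0 : 0 <= lapp x / phi x by rewrite divr_ge0 ?(ltW p0) // /lapp le_max lexx orbT.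
apply: (@le_trans _ _ (lapp x / phi x)).
  by rewrite ler_piMl //; have /andP[] := cutoff01 (phi x).
rewrite ler_pdivrMr // /lapp ge_max lapH // mulr_ge0 ?(ltW p0) //; exact: H0.
Qed.

Let C_supp : supported C.
Proof. by move=> x xL; rewrite /C ext0_out // => /EL; rewrite ltNge xL. Qed.

(** The measurable weight is met here: the continuous [C] lies below [H] on [E], so the limit of its
    sums inherits the bound [narrow_const], whose q-th root is [kappa]. *)
Let Cq : exists2 l : R, riemann N (fun x => C x `^ q) @[N --> \oo] --> l & l `^ q^-1 <= kappa.
Proof.
have CqE : (fun x => C x `^ q) = (fun x => pospow q (C x)).
  by apply/funext => x; rewrite /pospow max_l.
have Cqc : continuous (fun x => C x `^ q).
  by rewrite CqE => x; apply: continuous_at_comp; [exact: C_cont|exact: pospow_continuous].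
have Cqs : supported (fun x => C x `^ q) by move=> x xL; rewrite C_supp // powR0.
have [l hl lE] := riemann_cvg L0 Cqc Cqs (fun x => powR_ge0 _ _).
exists l => //.
have l0 : 0 <= l.
  by apply: (cvg_le (cvg_cst 0) hl); apply: nearW => N; apply: riemann_ge0 => // x; exact: powR_ge0.
have kap0 : 0 <= kappa by rewrite invr_ge0 mulr_ge0 ?powR_ge0 // exprn_ge0 // ltW.
rewrite -[leRHS](_ : (kappa `^ q) `^ q^-1 = kappa); last by rewrite -powRrM divff // powRr1.
apply: ge0_ler_powR; rewrite ?nnegrE ?powR_ge0 ?invr_ge0 ?(ltW q0) //.
rewrite -lee_fin lE; apply: le_trans intH.
have mE : measurable (E : set T) by exact: open_measurable_rV.
have -> : (\int[mu]_x (C x `^ q)%:E = \int[mu]_(x in E) (C x `^ q)%:E)%E.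
  rewrite [RHS]integral_mkcond; apply: eq_integral => x _; rewrite patchE.
  case: ifPn => //; rewrite notin_setE => xE; by rewrite /C ext0_out // powR0.
apply: (ge0_le_integral mu mE).
- by move=> x _; rewrite lee_fin powR_ge0.
- by apply/measurable_EFinP; exact: measurable_continuous_rV.
- apply/measurable_EFinP.
  apply: (@measurableT_comp _ _ _ _ _ _ (fun y : R => y `^ q)); first exact: measurable_powR.
  exact: measurableT_comp.
- move=> x xE; rewrite lee_fin; apply: ge0_ler_powR; rewrite ?nnegrE ?(ltW q0) //.
  by rewrite ger0_norm ?H0 // C_le.
Qed.

(** The k-th term of the divergence of z^2 grad phi, where z = (phi - e)^+. *)
Let dens k x : R := 2 * pospow (2 - 1) (phi x - e) * d k x * d k x + pospow 2 (phi x - e) * dd k x.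

Let dens_cvg k : riemann N (ext0 E (dens k)) @[N --> \oo] --> 0.
Proof.
have two1 : 1 < 2 :> R by rewrite ltr1n.
have two_1 : 0 < 2 - 1 :> R by rewrite subr_gt0.
apply: (@riemann_derive_cvg0 R n L L0 (ext0 E (fun x => pospow 2 (phi x - e) * d k x)) _ k).
- apply: (ext0_continuous oE (cphi e0) (@KE e)) => [x xE|x xE /(notK xE) xe].
    have phie : {for x, continuous (fun x => phi x - e)}.
      by apply: continuous_at_sub; [exact: phi_cont|exact: continuous_at_cst].
    apply: continuous_at_add; apply: continuous_at_mul.
    + apply: continuous_at_mul; last exact: d_cont.
      apply: continuous_at_mul; first exact: continuous_at_cst.
      by apply: continuous_at_comp => //; exact: pospow_continuous.
    + exact: d_cont.
    + by apply: continuous_at_comp => //; exact: pospow_continuous.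
    + exact: dd_cont.
  by rewrite /dens !pospow_le0 ?gt_eqF // ?subr_le0 // mulr0 !mul0r addr0.
- by move=> x xL; rewrite ext0_out // => /EL; rewrite ltNge xL.
- by move=> x xL; rewrite ext0_out // => /EL; rewrite ltNge xL.
- apply: (is_derive_ext0 oE (cphi e0) (@KE e)) => [x xE|x xE /(notK xE) xe]; last first.
    by rewrite pospow_le0 ?mul0r ?gt_eqF // subr_le0.
  have h1 := phi_e_derive k two1 xE; have h2 := dd_derive k xE.
  rewrite (_ : dens k x = pospow 2 (phi x - e) *: dd k x +
    d k x *: (2 * pospow (2 - 1) (phi x - e) * d k x)); first exact: (is_deriveM h1 h2).
  by rewrite /dens /GRing.scale /=; ring.
Qed.

(** With z = (phi - e)^+, the density 2 z |grad phi|^2 is the divergence of z^2 grad phi minus z^2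
    Delta phi, and - z^2 Delta phi <= C z^2 phi = C z^3 + e C z^2. The divergence sums to 0 in the
    limit, Hoelder's inequality bounds the cubic term, and z <= M the last one, which keeps the
    factor e. *)
Lemma energy_level (Y X : R) : riemann N (zed s (fun=> 1)) @[N --> \oo] --> Y ->
  riemann N (zed 1 nrm2) @[N --> \oo] --> X ->
  2 * X <= kappa * Y `^ q'^-1 + e * (M ^+ 2 * (kappa * B `^ q'^-1)).
Proof.
move=> hY hX; have [A hA Ak] := Cq.
have q'0 : 0 < q' by exact: lt_trans q'1.
have pw x : 2 * zed 1 nrm2 x <= C x * zed 3 (fun=> 1) x + e * (C x * zed 2 (fun=> 1) x) +
    \sum_k ext0 E (dens k) x.
  have [xE|xE] := pselect (E x); last first.
    by rewrite big1 => [|k _]; rewrite /zed /C !ext0_out // !mulr0 !addr0.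
  rewrite (eq_bigr (fun k => dens k x)); last by move=> k _; rewrite ext0_in.
  rewrite /zed /C !ext0_in // !mulr1 /dens big_split /= -mulr_sumr -/(lap x).
  have -> : \sum_k 2 * pospow (2 - 1) (phi x - e) * d k x * d k x = 2 * (pospow 1 (phi x - e) *
    nrm2 x).
    rewrite (_ : 2 - 1 = 1 :> R); last by rewrite -[2]/(1 + 1) addrK.
    rewrite mulrA /nrm2 mulr_sumr; apply: eq_bigr => k _; by rewrite expr2 mulrA.
  rewrite [leRHS]addrC -addrA lerDl.
  have [xe|xe] := leP (phi x) e.
    by rewrite !pospow_le0 ?gt_eqF ?subr_le0 // !mul0r !mulr0 !addr0.
  have p0 := phi_gt0 xE.
  have cE : c x * phi x = lapp x.
    by rewrite /c cutoff1 ?(ltW xe) // mul1r divfK // gt_eqF.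
  have -> : pospow 3 (phi x - e) = (phi x - e) * pospow 2 (phi x - e).
    by rewrite !pospow_gt0 ?subr_gt0 // !powR_mulrn ?subr_ge0 ?(ltW xe) // -exprS.
  have -> : pospow 2 (phi x - e) * lap x +
     (c x * ((phi x - e) * pospow 2 (phi x - e)) + e * (c x * pospow 2 (phi x - e))) =
     pospow 2 (phi x - e) * (lap x + c x * phi x) by ring.
  rewrite cE mulr_ge0 ?pospow_ge0 //.
  by rewrite -lerBlDl sub0r /lapp le_max lexx.
have Z2 x : zed 2 (fun=> 1) x <= M ^+ 2.
  have [xE|xE] := pselect (E x); last by rewrite /zed ext0_out // sqr_ge0.
  rewrite /zed ext0_in // mulr1; have [xe|xe] := leP (phi x) e.
    by rewrite pospow_le0 ?gt_eqF ?subr_le0 // sqr_ge0.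
  rewrite pospow_gt0 ?subr_gt0 // powR_mulrn ?subr_ge0 ?(ltW xe) //.
  have h1 : phi x - e <= M by apply: le_trans (phiM xE); rewrite gerBl ltW.
  have h2 : 0 <= phi x - e by rewrite subr_ge0 ltW.
  by rewrite ler_sqr // nnegrE //; apply: le_trans h1.
have sumR N : riemann N (fun x => \sum_k ext0 E (dens k) x) = \sum_k riemann N (ext0 E (dens k)).
  by rewrite /riemann_sum exchange_big /= mulr_sumr.
have hS : \sum_k riemann N (ext0 E (dens k)) @[N --> \oo] --> (\sum_(k < n) 0 : R).
  by apply: cvg_sum_seq => k; exact: dens_cvg.
have hA' : (riemann N (fun x => C x `^ q)) `^ q^-1 @[N --> \oo] --> A `^ q^-1.
  apply: cvg_powR hA; first by rewrite invr_gt0.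
  by move=> N; apply: riemann_ge0 => // x; exact: powR_ge0.
have hY' : (riemann N (zed s (fun=> 1))) `^ q'^-1 @[N --> \oo] --> Y `^ q'^-1.
  apply: cvg_powR hY; first by rewrite invr_gt0.
  by move=> N; apply: riemann_ge0 => //; exact: zed_ge0.
have hc (a : R) : (fun _ : nat => a) @ \oo --> a by exact: cvg_cst.
have hl : (fun N => 2 * riemann N (zed 1 nrm2)) @ \oo --> 2 * X.
  exact: (cvgM (hc 2) hX).
have hr : (fun N => riemann N (fun x => C x `^ q) `^ q^-1 * riemann N (zed s (fun=> 1)) `^ q'^-1 +
    e * (M ^+ 2 * (riemann N (fun x => C x `^ q) `^ q^-1 * B `^ q'^-1)) +
    \sum_k riemann N (ext0 E (dens k))) @ \oo -->
    A `^ q^-1 * Y `^ q'^-1 + e * (M ^+ 2 * (A `^ q^-1 * B `^ q'^-1)) + \sum_(k < n) 0.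
  exact: (cvgD (cvgD (cvgM hA' hY')
   (cvgM (hc e) (cvgM (hc (M ^+ 2)) (cvgM hA' (hc (B `^ q'^-1)))))) hS).
apply: (@le_trans _ _ (A `^ q^-1 * Y `^ q'^-1 + e * (M ^+ 2 * (A `^ q^-1 * B `^ q'^-1)))); last
  first.
  apply: lerD; first by rewrite ler_wpM2r ?powR_ge0.
  by rewrite ler_wpM2l ?(ltW e0) // ler_wpM2l ?sqr_ge0 // ler_wpM2r ?powR_ge0.
move: hr; rewrite big1 // addr0 => hr.
apply: (cvg_le hl hr).
apply: nearW => N; rewrite -riemannZ -sumR.
apply: (le_trans (le_riemann L0 N pw)); rewrite !riemannD lerD2r riemannZ lerD //.
  have := @riemann_hoelder R n L L0 N q q' C (zed 3 (fun=> 1)) q0 q'0 qq' C_ge0 (zed_ge0 _ (fun _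
    _ => ler01)).
  rewrite (_ : (fun x => zed 3 (fun=> 1) x `^ q') = zed s (fun=> 1)) //.
  by apply/funext => x; rewrite zed_powR // gt_eqF.
rewrite ler_wpM2l ?(ltW e0) //.
apply: (@le_trans _ _ (riemann N (fun x => M ^+ 2 * (C x * 1)))).
  by apply: le_riemann => // x; rewrite mulr1 mulrC ler_wpM2r.
rewrite riemannZ ler_wpM2l ?sqr_ge0 //.
have := @riemann_hoelder R n L L0 N q q' C (fun=> 1) q0 q'0 qq' C_ge0 (fun=> ler01).
by rewrite powR1 riemann_cst mulr1.
Qed.

(** [kappa] is the inverse of the Sobolev constant, so the first term of the energy estimate is at
    most [X]. The factor 2 in front of the energy, from differentiating a square, allows it to be
    absorbed and leaves the term of order e. *)
Lemma level_bound (Y : R) : riemann N (zed s (fun=> 1)) @[N --> \oo] --> Y -> 0 < Y ->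
  Y `^ q'^-1 <= e * (M ^+ 2 * B `^ q'^-1).
Proof.
move=> hY Y0.
have [X hX _] : exists2 l : R, riemann N (zed 1 nrm2) @[N --> \oo] --> l &
   l%:E = (\int[mu]_x (zed 1 nrm2 x)%:E)%E.
  by apply: (riemann_cvg L0); [exact: zed_cont|exact: zed_supp|exact: zed_ge0].
have h1 := sobolev_level hY hX Y0; have h2 := energy_level hY hX.
have k0 : 0 < gam ^+ 2 * B `^ theta by rewrite mulr_gt0 ?powR_gt0 // exprn_gt0.
move: h1 h2; rewrite /kappa; move: (gam ^+ 2 * B `^ theta) k0 => k k0.
move: (Y `^ q'^-1) (B `^ q'^-1) (M ^+ 2) => y b m h1 h2.
have h3 : y * k^-1 <= X by rewrite ler_pdivrMr // mulrC.
have h4 : X <= k^-1 * (e * (m * b)).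
  have : 2 * X <= X + k^-1 * (e * (m * b)).
    apply: le_trans h2 _; rewrite [k^-1 * y]mulrC; apply: lerD => //.
    by rewrite le_eqVlt; apply/orP; left; apply/eqP; ring.
  by rewrite mulr2n mulrDl mul1r lerD2l.
by rewrite -(ler_pM2l (_ : 0 < k^-1)) ?invr_gt0 //; apply: le_trans h4; rewrite mulrC.
Qed.

End level.

(** A point [x0] of [E] makes the integral [Y1] at level [phi x0 / 2] positive. The integrals
    increase as the level decreases, so [Y1] is also subject to the bounds of order e at all smaller
    levels. *)
Lemma narrow_domain : E = set0.
Proof.
apply/seteqP; split=> // x0 x0E /=.
pose e1 := phi x0 / 2.
have p0 := phi_gt0 x0E.
have e10 : 0 < e1 by rewrite divr_gt0.
have [Y1 hY1 Y1E] := zed_cvg e10.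
have Y1_gt0 : 0 < Y1.
  have pc : {for x0, continuous phi} by exact: phi_cont.
  have /nbhs_ballP[t /= t0 ht] : \forall y \near x0, E y /\ e1 + e1 / 2 <= phi y.
    apply: filterS2 (near_in oE x0E) (cvgr_ge _ pc (e1 + e1 / 2) _) => [y yE|]; first by split.
    by rewrite /e1; lra.
  pose m := (e1 / 2) `^ s.
  have m0 : 0 < m by rewrite powR_gt0 // divr_gt0.
  pose b := rV_box (fun i => x0 0 i) (fun i => x0 0 i + t / 2).
  have mb : measurable (b : set T) by exact: measurable_rV_box.
  have bt y : b y -> ball x0 t y.
    move=> yb; rewrite mx_norm_ball /ball_ /=; apply: (@le_lt_trans _ _ (t / 2)); last by lra.
    apply: norm_rV_le; first by lra.
    move=> i; have := yb i; rewrite in_itv /= !mxE => /andP[h1 h2].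
    by rewrite distrC ger0_norm ?subr_ge0 // lerBlDl ltW.
  have mZ (D : set T) : measurable D -> measurable_fun D (fun x : T => (zed e1 s (fun=> 1) x)%:E).
    by move=> mD; apply/measurable_EFinP; apply: measurable_continuous_rV => //; apply: (zed_cont
      e10) => // ? _; exact: continuous_at_cst.
  have Z0 x : (0 <= (zed e1 s (fun=> 1) x)%:E)%E.
    by rewrite lee_fin; exact: zed_ge0.
  rewrite -lte_fin Y1E.
  apply: (@lt_le_trans _ _ (\int[mu]_(x in b) (zed e1 s (fun=> 1) x)%:E)%E); last first.
    apply: (ge0_subset_integral mu mb (measurableT : measurable (setT : set T))) => [|x _|x _].
    - exact: mZ measurableT.
    - exact: Z0.
    - exact: I.
  apply: (@lt_le_trans _ _ (\int[mu]_(x in b) (cst m%:E x))%E).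
    rewrite integral_cst //= lebesgue_rV_box; last by move=> i; rewrite lerDl divr_ge0 // ltW.
    rewrite -EFinM lte_fin mulr_gt0 // prodr_gt0 // => i _.
    by rewrite addrAC subrr add0r divr_gt0.
  apply: (ge0_le_integral mu mb).
  - by move=> x _; rewrite lee_fin; exact: ltW m0.
  - exact: measurable_cst.
  - exact: mZ mb.
  move=> x /bt /ht [xE xe]; rewrite lee_fin /zed ext0_in // mulr1 /m.
  rewrite pospow_gt0; last by rewrite subr_gt0; lra.
  by apply: ge0_ler_powR; rewrite ?nnegrE ?(ltW s0) ?divr_ge0 ?subr_ge0 //; lra.
have bound e : 0 < e -> e <= e1 -> Y1 `^ q'^-1 <= e * (M ^+ 2 * B `^ q'^-1).
  move=> e0 ee1; have [Y hY _] := zed_cvg e0.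
  have YY : Y1 <= Y.
    apply: (cvg_le hY1 hY); apply: nearW => N; apply: le_riemann => // x.
    have [xE|xE] := pselect (E x); last by rewrite /zed !ext0_out.
    rewrite /zed !ext0_in // !mulr1 /pospow; apply: ge0_ler_powR; rewrite ?nnegrE ?le_max ?lexx
      ?orbT ?(ltW s0) //.
    by case: (lerP (phi x - e1) 0) => _; rewrite ?lexx ?orbT // lerD2l lerN2 ee1.
  have Y0 : 0 < Y by exact: lt_le_trans YY.
  apply: le_trans (level_bound e0 hY Y0).
  by apply: ge0_ler_powR; rewrite ?nnegrE ?invr_ge0 ?(ltW Y0) ?(ltW Y1_gt0) // (ltW (lt_trans _
    q'1)).
have y0 : 0 < Y1 `^ q'^-1 by exact: powR_gt0.
move: bound y0; move: (Y1 `^ _) => y bound y0.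
have m0 : 0 <= M ^+ 2 * B `^ q'^-1 by rewrite mulr_ge0 ?powR_ge0 ?sqr_ge0.
move: (M ^+ 2 * _) m0 bound => m m0 bound.
have m1 : 0 < m + 1 by rewrite ltr_wpDl.
have d0 : 0 < y / (2 * (m + 1)) by rewrite divr_gt0 // mulr_gt0.
have := bound (Num.min e1 (y / (2 * (m + 1)))); rewrite lt_min e10 d0 ge_min lexx => /(_ isT isT).
rewrite leNgt => /negP; apply.
apply: (@le_lt_trans _ _ (y / (2 * (m + 1)) * m)).
  by rewrite ler_wpM2r // ge_min lexx orbT.
rewrite mulrAC ltr_pdivrMr ?mulr_gt0 // ltr_pM2l //; lra.
Qed.

End domain.
End narrow_domain.

(** * The Kelvin transform *)

Section chain_rule.
Context {R : realType}.

Lemma mean_value_bound (G G' : R -> R) (h d e : R) :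
  (forall s : R, `|s| <= `|h| -> is_derive s 1 G (G' s) /\ `|G' s - d| <= e) ->
  `|G h - G 0 - h * d| <= e * `|h|.
Proof.
move=> hG.
have main a b : a <= b -> (forall s : R, a <= s <= b -> is_derive s 1 G (G' s) /\ `|G' s - d| <=
  e) ->
    `|G b - G a - (b - a) * d| <= e * (b - a).
  move=> ab hs; have [c|c|c cab ->] := @MVT_segment R G G' a b ab.
  - by move=> /[!in_itv]/= /andP[x1 x2]; case: (hs c) => //; rewrite (ltW x1) ltW.
  - apply: derivable_within_continuous => x; rewrite in_itv /= => xab.
    by have [[]] := hs x xab.
  move: cab; rewrite in_itv /= => /hs[_ hc].
  rewrite [_ * d]mulrC -mulrBl normrM [`|b - a|]ger0_norm ?subr_ge0 //.
  by rewrite ler_wpM2r // subr_ge0.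
have [h0|h0] := lerP 0 h.
  have := main 0 h h0; rewrite subr0 (ger0_norm h0); apply=> s /andP[s0 sh].
  by apply: hG; rewrite !ger0_norm.
have -> : G h - G 0 - h * d = - (G 0 - G h - (0 - h) * d) by ring.
rewrite normrN (_ : `|h| = 0 - h); last by rewrite sub0r ltr0_norm.
apply: main; first exact: ltW.
by move=> s /andP[s0 sh]; apply: hG; rewrite ler0_norm // ltr0_norm // lerN2.
Qed.

Context {n : nat}.
Implicit Types (g : 'rV[R]_n -> R) (d : 'I_n -> 'rV[R]_n -> R) (y : 'rV[R]_n).
Local Notation e_ k := (delta_mx 0 k : 'rV[R]_n).

(** Differentiability from continuous partial derivatives: [pt j] has moved in the first j
    coordinates only, and the mean value theorem applies to each edge of the path from [y] to
    [y + h]. *)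
Lemma first_order_expansion g d y :
  (\forall z \near y, forall k, is_derive z (e_ k) g (d k z)) ->
  (forall k, {for y, continuous (d k)}) ->
  forall e, 0 < e -> exists2 r : R, 0 < r & forall h : 'rV[R]_n, `|h| < r ->
    `|g (y + h) - g y - \sum_k h 0 k * d k y| <= e * \sum_k `|h 0 k|.
Proof.
move=> dg cd e e0.
have hd : \forall z \near y, forall k, `|d k z - d k y| <= e.
  apply: (@filter_forall _ _ (fun k z => `|d k z - d k y| <= e) (nbhs y) _) => k; have := cd k;
    move/cvgrPdist_le => /(_ _ e0).
  by apply: filterS => z; rewrite distrC.
have hdg : \forall z \near y, (forall k, is_derive z (e_ k) g (d k z)) /\
    (forall k, `|d k z - d k y| <= e) by exact: filterI dg hd.
move: hdg => /nbhs_ballP[r /= r0 hr].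
exists r => // h hh.
pose pt (j : nat) : 'rV[R]_n := y + \row_k (if (k < j)%N then h 0 k else 0).
have ptS (j : 'I_n) : pt j.+1 = pt j + h 0 j *: e_ j.
  rewrite /pt -addrA; congr (_ + _); apply/rowP => k; rewrite !mxE eqxx /= ltnS leq_eqVlt.
  have [->|kj] := eqVneq k j; first by rewrite eqxx ltnn /= mulr1 add0r.
  by rewrite mulr0 addr0 (negbTE (_ : val k != j)).
have pt0 : pt 0%N = y.
  by rewrite /pt -[RHS]addr0; congr (_ + _); apply/rowP => k; rewrite !mxE.
have ptn : pt n = y + h.
  by rewrite /pt; congr (_ + _); apply/rowP => k; rewrite !mxE ltn_ord.
have near_pt (j : 'I_n) s : `|s| <= `|h 0 j| -> ball y r (pt j + s *: e_ j).
  move=> sh; rewrite mx_norm_ball /ball_ /= distrC; apply: le_lt_trans hh.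
  apply: norm_rV_le => // k; rewrite !mxE eqxx /=.
  have [->|kj] := eqVneq k j.
    rewrite ltnn mulr1 addr0 addrAC subrr add0r; apply: le_trans sh _; exact: coord_le_norm.
  rewrite mulr0 addr0 addrAC subrr add0r; case: ifP => _; first exact: coord_le_norm.
  by rewrite normr0.
have step (j : 'I_n) : `|g (pt j.+1) - g (pt j) - h 0 j * d j y| <= e * `|h 0 j|.
  have := @mean_value_bound (fun s => g (pt j + s *: e_ j)) (fun s => d j (pt j + s *: e_ j)) (h
    0 j) (d j y) e.
  rewrite scale0r addr0 ptS; apply => s /near_pt /hr [h1 h2]; split => //.
  by apply: is_derive_line; exact: h1.
rewrite -ptn -[g y](congr1 g pt0).
have -> : g (pt n) - g (pt 0%N) - \sum_k h 0 k * d k y =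
    \sum_(k < n) (g (pt k.+1) - g (pt k) - h 0 k * d k y).
  rewrite sumrB -(big_mkord xpredT (fun k => g (pt k.+1) - g (pt k))) telescope_sumr //.
by apply: le_trans (ler_norm_sum _ _ _) _; rewrite mulr_sumr; apply: ler_sum => k _.
Qed.

Lemma is_derive_comp_curve g d (c : R -> 'rV[R]_n) (c' : 'I_n -> R) (t : R) :
  (\forall z \near c t, forall k, is_derive z (e_ k) g (d k z)) ->
  (forall k, {for c t, continuous (d k)}) ->
  (forall k, is_derive t 1 (fun s => c s 0 k) (c' k)) ->
  is_derive t 1 (fun s => g (c s)) (\sum_k c' k * d k (c t)).
Proof.
move=> dg cd dc.
pose q (k : 'I_n) (h : R) : R := h^-1 * (c (h + t) 0 k - c t 0 k).
have hq k : q k h @[h --> 0^'] --> c' k.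
  have [+ <-] := dc k; rewrite /derivable /derive => /cvgP.
  by under eq_fun do rewrite /= [_ *: 1]mulr1.
have main : h^-1 *: (((fun s => g (c s)) \o shift t) (h *: 1) - g (c t)) @[h --> 0^'] --> \sum_k
  c' k * d k (c t).
  pose rest (v : 'rV[R]_n) := g (c t + v) - g (c t) - \sum_k v 0 k * d k (c t).
  have -> : (fun h : R => h^-1 *: (((fun s => g (c s)) \o shift t) (h *: 1) - g (c t))) =
     (fun h => \sum_k q k h * d k (c t) + h^-1 * rest (c (h + t) - c t)).
    apply/funext => h; rewrite /= [_ *: 1]mulr1 /rest subrKC /GRing.scale /= mulrBr.
    have -> : \sum_k q k h * d k (c t) = h^-1 * \sum_k (c (h + t) - c t) 0 k * d k (c t).
      by rewrite mulr_sumr; apply: eq_bigr => k _; rewrite /q !mxE mulrA.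
    ring.
  rewrite -[X in _ --> X]addr0; apply: cvgD.
    by apply: cvg_sum_seq => k; apply: cvgM; [exact: hq|exact: cvg_cst].
  apply/cvgrPdist_le => e e0.
  (* Near 0 the sum of the difference quotients of the coordinates stays below [M]; the last 1 keeps
     [M] positive even for n = 0. *)
  pose M := \sum_k (`|c' k| + 1) + 1.
  have M0 : 0 < M by rewrite ltr_wpDl // sumr_ge0 // => k _; rewrite addr_ge0.
  have eM : 0 < e / M by rewrite divr_gt0.
  have [r r0 hr] := first_order_expansion dg cd eM.
  have cc : \forall h \near 0^', `|c (h + t) - c t| < r.
    have : \forall h \near 0^', forall k, `|c (h + t) 0 k - c t 0 k| < r.
      apply: filter_forall => k.
      have ck : {for t, continuous (fun s => c s 0 k)}.
        by apply: differentiable_continuous; apply/derivable1_diffP; case: (dc k).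
      have : c (h + t) 0 k @[h --> 0^'] --> c t 0 k.
        apply: (cvg_comp (fun h => h + t) (fun s => c s 0 k) _ ck).
        have : h + t @[h --> (0 : R)] --> 0 + t by apply: cvgD; [exact: cvg_id|exact: cvg_cst].
        by rewrite add0r; apply: cvg_trans; apply: cvg_app; exact: nbhs_dnbhs.
      move=> /cvgrPdist_lt/(_ _ r0); apply: filterS => h; by rewrite distrC.
    by apply: filterS => h hk; apply: norm_rV_lt => // k; rewrite !mxE.
  have qb : \forall h \near 0^', forall k, `|q k h| <= `|c' k| + 1.
    apply: filter_forall => k; have := hq k; move=> /cvgrPdist_le/(_ _ ltr01).
    apply: filterS => h hk; rewrite -(subrK (c' k) (q k h)) addrC.
    by apply: le_trans (ler_normD _ _) _; rewrite lerD2l distrC.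
  near=> h; rewrite sub0r normrN normrM.
  have h0 : h != 0 by near: h; exact: nbhs_dnbhs_neq.
  have ch : `|c (h + t) - c t| < r by near: h.
  have qh : forall k, `|q k h| <= `|c' k| + 1 by near: h.
  apply: (@le_trans _ _ (`|h^-1| * (e / M * \sum_k `|(c (h + t) - c t) 0 k|))).
    by rewrite ler_wpM2l // /rest; apply: hr.
  rewrite mulrCA mulr_sumr (eq_bigr (fun k => `|q k h|)); last first.
    by move=> k _; rewrite /q normrM !mxE.
  rewrite mulrAC ler_pdivrMr // ler_pM2l // /M.
  apply: (@le_trans _ _ (\sum_k (`|c' k| + 1))); first by apply: ler_sum => k _.
  by rewrite lerDl.
by apply: DeriveDef; [apply/cvg_ex; eexists; exact: main|exact: cvg_lim].
Unshelve. all: by end_near. Qed.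

End chain_rule.

Section derivation_rules.
Context {R : realType} {V : normedModType R}.
Implicit Types (f g : V -> R) (x v : V).

Lemma derive_mul f g x v df dg : is_derive x v f df -> is_derive x v g dg ->
  is_derive x v (fun y => f y * g y) (df * g x + f x * dg).
Proof.
move=> hf hg; have -> : df * g x + f x * dg = f x *: dg + g x *: df.
  by rewrite /GRing.scale /= addrC [df * _]mulrC.
exact: is_deriveM.
Qed.

Lemma derive_add f g x v df dg : is_derive x v f df -> is_derive x v g dg ->
  is_derive x v (fun y => f y + g y) (df + dg).
Proof. by move=> hf hg; exact: is_deriveD. Qed.

Lemma derive_sub f g x v df dg : is_derive x v f df -> is_derive x v g dg ->
  is_derive x v (fun y => f y - g y) (df - dg).
Proof. by move=> hf hg; exact: is_deriveB. Qed.

Lemma derive_scale (a : R) f x v df : is_derive x v f df ->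
  is_derive x v (fun y => a * f y) (a * df).
Proof.
move=> hf; have := derive_mul (is_derive_cst a x v) hf.
by rewrite mul0r add0r.
Qed.

Lemma derive_inv f x v df : f x != 0 -> is_derive x v f df ->
  is_derive x v (fun y => (f y)^-1) (- (f x) ^- 2 * df).
Proof. by move=> f0 [hf <-]; apply: DeriveDef; [exact: derivableV|rewrite deriveV]. Qed.

Lemma derive_sum n (f : 'I_n -> V -> R) x v (df : 'I_n -> R) :
  (forall i, is_derive x v (f i) (df i)) ->
  is_derive x v (fun y => \sum_i f i y) (\sum_i df i).
Proof.
move=> hf; have -> : (fun y => \sum_i f i y) = \sum_i f i by apply/funext => y; rewrite fct_sumE.
exact: is_derive_sum.
Qed.

End derivation_rules.

(** * Second derivatives at a maximum *)

Section second_derivative_test.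
Context {R : realType}.

(** If [g''] were positive, [g'], which vanishes at the maximum, would be positive just to the right
    of 0, and the mean value theorem would make [g] exceed [g 0] there. *)
Lemma second_derivative_test (g g' : R -> R) (g'' : R) :
  (\forall t \near (0 : R), is_derive (t : R) 1 g (g' t)) -> is_derive (0 : R) 1 g' g'' ->
  (\forall t \near (0 : R), g t <= g 0) -> g'' <= 0.
Proof.
move=> dg dg' gmax; rewrite leNgt; apply/negP => g0.
have [r /= r0 hr] : exists2 r : R, 0 < r & forall t : R, `|t| < r -> is_derive (t : R) 1 g (g' t)
  /\ g t <= g 0.
  have /nbhs_ballP[r /= r0 hr] : \forall t \near (0 : R), is_derive (t : R) 1 g (g' t) /\ g t <=
    g 0.
    exact: filterI.
  by exists r => // t tr; apply: hr; rewrite /ball /= sub0r normrN.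
have rr : - r <= r by lra.
have in_r t : t \in `]- r, r[ -> `|t| < r by rewrite in_itv /= ltr_norml.
have g'0 : g' 0 = 0.
  have h : is_derive (0 : R) 1 g 0.
    apply: (derive1_at_max rr) => [t /in_r /hr [[]]//||t /in_r /hr []//].
    by rewrite in_itv /= r0 oppr_lt0 r0.
  have z0 : `|0 : R| < r by rewrite normr0.
  have [h1 _] := hr 0 z0.
  by case: h1 => _ <-; case: h => _ hv; exact: hv.
have lim : h^-1 * g' h @[h --> 0^'] --> g''.
  have [+ <-] := dg'; rewrite /derivable /derive => /cvgP.
  by under eq_fun do rewrite /= [_ *: 1]mulr1 addr0 g'0 subr0.
have : \forall h \near 0^', 0 < h^-1 * g' h by apply: (cvgr_gt _ lim).
move=> [s /= s0 hs].
pose t := Num.min r s / 2.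
have m0 : 0 < Num.min r s by rewrite lt_min r0.
have t0 : 0 < t by rewrite divr_gt0.
have tm : t < Num.min r s by rewrite /t ltr_pdivrMr // ltr_pMr // ltr1n.
move: tm; rewrite lt_min => /andP[tr ts].
have [||c cab gc] := @MVT R g g' 0 t t0.
- move=> c; rewrite in_itv /= => /andP[c0 ct]; have [] := hr c => //.
  by rewrite gtr0_norm //; exact: lt_trans tr.
- apply: derivable_within_continuous => c; rewrite in_itv /= => /andP[c0 ct].
  have cr : `|c| < r by rewrite ger0_norm // (le_lt_trans ct).
  by case: (hr c cr) => [[]].
- move: cab; rewrite in_itv /= => /andP[c0 ct].
  have := hs c; rewrite /ball_ /= sub0r normrN gtr0_norm // => /(_ (lt_trans ct ts)).
  rewrite gt_eqF // => /(_ isT); rewrite pmulr_rgt0 ?invr_gt0 // => gc0.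
  have tr' : `|t| < r by rewrite gtr0_norm.
  by have [_] := hr t tr'; rewrite -subr_le0 gc subr0 leNgt mulr_gt0.
Qed.

Context {n : nat}.
Local Notation e_ k := (delta_mx 0 k : 'rV[R]_n).

Lemma near_line (Q : 'rV[R]_n -> Prop) (x v : 'rV[R]_n) : (\forall y \near x, Q y) ->
  \forall t \near (0 : R), Q (x + t *: v).
Proof.
move=> hQ; have : x + t *: v @[t --> (0 : R)] --> x + 0 *: v.
  apply: cvgD; first exact: cvg_cst.
  by apply: cvgZr_tmp; exact: cvg_id.
by rewrite scale0r addr0; apply.
Qed.

Lemma laplacian_at_max (phi : 'rV[R]_n -> R) (d dd : 'I_n -> 'rV[R]_n -> R) x :
  (\forall y \near x, forall k, is_derive y (e_ k) phi (d k y)) ->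
  (forall k, is_derive x (e_ k) (d k) (dd k x)) ->
  (\forall y \near x, phi y <= phi x) -> \sum_k dd k x <= 0.
Proof.
move=> dphi ddphi pmax; apply: sumr_le0 => k _.
apply: (@second_derivative_test (fun t => phi (x + t *: e_ k)) (fun t => d k (x + t *: e_ k))).
- have := near_line (e_ k) dphi; apply: filterS => t ht.
  by apply: is_derive_line; exact: ht.
- by apply: is_derive_line; rewrite scale0r addr0; exact: ddphi.
- by rewrite scale0r addr0; exact: (near_line (Q := fun y => phi y <= phi x) (e_ k) pmax).
Qed.

End second_derivative_test.

(** * The Kelvin transform and its Laplacian *)

Section kelvin.
Context {R : realType} {n : nat}.
Variables (P : 'rV[R]_n) (lam : R).
Hypothesis lam0 : 0 < lam.
Local Notation e_ k := (delta_mx 0 k : 'rV[R]_n).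
Implicit Types (x : 'rV[R]_n) (i j k : 'I_n).
Let m : R := n%:R - 2.

Let y_ j x : R := (x - P) 0 j.
Definition ksq x : R := nsq (x - P).
Definition kratio x : R := lam ^+ 2 / ksq x.
Definition kinv x : 'rV[R]_n := P + kratio x *: (x - P).
Definition kweight x : R := kratio x `^ (m / 2).
Definition kelvin (u : 'rV[R]_n -> R) x : R := kweight x * u (kinv x).
(** [- 2 * p_ i] is the i-th logarithmic derivative of [kratio] and [- m * p_ i] that of
    [kweight]. *)
Let p_ i x : R := y_ i x / ksq x.

Lemma ksq_ge0 x : 0 <= ksq x. Proof. by apply: sumr_ge0 => i _; exact: sqr_ge0. Qed.

Lemma derive_y x i j : is_derive x (e_ i) (y_ j) (j == i)%:R.
Proof.
apply: is_derive_line0.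
have -> : (fun s : R => y_ j (x + s *: e_ i)) = (fun s : R => y_ j x + s * (j == i)%:R).
  by apply/funext => s; rewrite /y_ !mxE /= addrAC.
rewrite -[X in is_derive _ _ _ X](_ : 0 + (1 * (j == i)%:R + 0 * 0) = _); last by rewrite mul0r
  addr0 add0r mul1r.
by apply: derive_add; apply: derive_mul.
Qed.

Lemma derive_ksq x i : is_derive x (e_ i) ksq (2 * y_ i x).
Proof.
have -> : 2 * y_ i x = \sum_j ((j == i)%:R * y_ j x + y_ j x * (j == i)%:R).
  rewrite (bigD1 i) //= eqxx big1 ?addr0; first by rewrite /= mul1r mulr1; ring.
  by move=> j /negbTE ->; rewrite mul0r mulr0 addr0.
have -> : ksq = (fun x => \sum_j (y_ j x * y_ j x)).
  by apply/funext => z; apply: eq_bigr => j _; rewrite expr2.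
by apply: derive_sum => j; apply: derive_mul; exact: derive_y.
Qed.

Section at_point.
Variable x : 'rV[R]_n.
Hypothesis x0 : ksq x != 0.
Let S := ksq x.
Let b := kratio x.

Lemma ksq_gt0 : 0 < ksq x. Proof. by rewrite lt_def x0 ksq_ge0. Qed.

Lemma kratio_gt0 : 0 < kratio x.
Proof. by rewrite divr_gt0 ?ksq_gt0 // exprn_gt0. Qed.

Lemma derive_ksqV i : is_derive x (e_ i) (fun x => (ksq x)^-1) (- 2 * p_ i x / S).
Proof.
have h := derive_ksq x i.
have -> : - 2 * p_ i x / S = (- S ^- 2) * (2 * y_ i x).
  by rewrite /p_ /S; field.
exact: derive_inv.
Qed.

Lemma derive_kratio i : is_derive x (e_ i) kratio (- 2 * p_ i x * b).
Proof.
have -> : - 2 * p_ i x * b = lam ^+ 2 * (- 2 * p_ i x / S).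
  by rewrite /b /kratio -/S; ring.
exact: (derive_scale (lam ^+ 2) (derive_ksqV i)).
Qed.

Lemma derive_p i : is_derive x (e_ i) (p_ i) (S^-1 - 2 * (p_ i x * p_ i x)).
Proof.
have -> : S^-1 - 2 * (p_ i x * p_ i x) = (i == i)%:R * (ksq x)^-1 + y_ i x * (- 2 * p_ i x / S).
  by rewrite eqxx /p_ /S /=; field.
by apply: derive_mul; [exact: derive_y|exact: derive_ksqV].
Qed.

Lemma derive_kweight i : is_derive x (e_ i) kweight (- m * p_ i x * kweight x).
Proof.
have h := derive_kratio i.
have b0 := kratio_gt0.
have -> : - m * p_ i x * kweight x = (m / 2) * kratio x `^ (m / 2 - 1) * (- 2 * p_ i x * b).
  have e : kratio x `^ (m / 2) = kratio x `^ (m / 2 - 1) * kratio x.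
    rewrite -{3}[kratio x](powRr1 (ltW b0)) -powRD ?subrK //.
    by rewrite (gt_eqF b0) implybT.
  by rewrite /kweight e /b; field.
exact: (is_derive_comp_line h (is_derive1_powR _ b0)).
Qed.

Lemma kinv_coord j z : kinv z 0 j = P 0 j + kratio z * y_ j z.
Proof. by rewrite /kinv /y_ !mxE. Qed.

(** The differential of the inversion is [kratio x] times the reflection in the hyperplane
    orthogonal to [x - P]. *)
Lemma derive_kinv_comp (g : 'rV[R]_n -> R) (d : 'I_n -> 'rV[R]_n -> R) i :
  (\forall z \near kinv x, forall k, is_derive z (e_ k) g (d k z)) ->
  (forall k, {for kinv x, continuous (d k)}) ->
  is_derive x (e_ i) (fun z => g (kinv z))
    (b * (d i (kinv x) - 2 * p_ i x * \sum_j y_ j x * d j (kinv x))).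
Proof.
move=> dg cd; apply: is_derive_line0.
pose c' k := b * ((k == i)%:R - 2 * p_ i x * y_ k x).
have -> : b * (d i (kinv x) - 2 * p_ i x * \sum_j y_ j x * d j (kinv x)) =
    \sum_k c' k * d k (kinv (x + 0 *: e_ i)).
  rewrite scale0r addr0 /c'.
  rewrite [RHS](eq_bigr (fun k => b * ((k == i)%:R * d k (kinv x)) - b * (2 * p_ i x) * (y_ k x *
    d k (kinv x)))); last first.
    by move=> k _; ring.
  have e : \sum_k (k == i)%:R * d k (kinv x) = d i (kinv x).
    rewrite (bigD1 i) //= eqxx mul1r big1 ?addr0 // => k /negbTE ->.
    by rewrite mul0r.
  by rewrite sumrB -!mulr_sumr e; ring.
apply: (@is_derive_comp_curve R n g d (fun s => kinv (x + s *: e_ i)) c' 0).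
- by rewrite scale0r addr0.
- by rewrite scale0r addr0.
- move=> k; apply: (is_derive_line (F := fun z => kinv z 0 k)); rewrite scale0r addr0.
  have -> : (fun z => kinv z 0 k) = (fun z => P 0 k + kratio z * y_ k z).
    by apply/funext => z; rewrite kinv_coord.
  have -> : c' k = 0 + ((- 2 * p_ i x * b) * y_ k x + kratio x * (k == i)%:R).
    by rewrite /c' -/b; ring.
  by apply: derive_add; apply: derive_mul; [exact: derive_kratio|exact: derive_y].
Qed.

Lemma continuous_at_y j : {for x, continuous (y_ j)}.
Proof.
have -> : y_ j = (fun z => z 0 j - P 0 j) by apply/funext => z; rewrite /y_ !mxE.
by apply: continuous_at_sub; [exact: coord_continuous|exact: continuous_at_cst].
Qed.

Lemma continuous_at_ksq : {for x, continuous ksq}.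
Proof.
apply: continuous_at_sum => j; apply: (continuous_at_comp (g := fun t => t ^+ 2)); first exact:
  continuous_at_y.
exact: exprn_continuous.
Qed.

Lemma continuous_at_ksqV : {for x, continuous (fun z => (ksq z)^-1)}.
Proof. by apply: continuous_at_inv => //; exact: continuous_at_ksq. Qed.

Lemma continuous_at_p j : {for x, continuous (p_ j)}.
Proof. by apply: continuous_at_mul; [exact: continuous_at_y|exact: continuous_at_ksqV]. Qed.

Lemma continuous_at_kratio : {for x, continuous kratio}.
Proof. by apply: continuous_at_mul; [exact: continuous_at_cst|exact: continuous_at_ksqV]. Qed.

Lemma continuous_at_kweight : {for x, continuous kweight}.
Proof.
apply: (continuous_at_comp (g := fun t => t `^ (m / 2))); first exact: continuous_at_kratio.
apply: differentiable_continuous; apply/derivable1_diffP.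
by have := is_derive1_powR (m / 2) kratio_gt0; case.
Qed.

Lemma continuous_at_kinv : {for x, continuous kinv}.
Proof.
apply/(@cvgrPdist_lt _ _ _ _ (nbhs_filter x)) => e e0.
have : \forall z \near x, forall j, `|kinv x 0 j - kinv z 0 j| < e.
  apply: (@filter_forall _ _ (fun j z => `|kinv x 0 j - kinv z 0 j| < e) (nbhs x) _) => j.
  have c : {for x, continuous (fun z => kinv z 0 j)}.
    have -> : (fun z => kinv z 0 j) = (fun z => P 0 j + kratio z * y_ j z).
      by apply/funext => z; rewrite kinv_coord.
    by apply: continuous_at_add; [exact: continuous_at_cst|apply: continuous_at_mul; [exact:
      continuous_at_kratio|exact: continuous_at_y]].
  by move/cvgrPdist_lt: c; exact.
by apply: filterS => z hz; apply: norm_rV_lt => // j; rewrite !mxE; have := hz j; rewrite !mxE.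
Qed.

Lemma continuous_at_kinv_comp (g : 'rV[R]_n -> R) : {for kinv x, continuous g} ->
  {for x, continuous (fun z => g (kinv z))}.
Proof. by move=> hg; apply: (@continuous_comp _ _ _ kinv g) => //; exact: continuous_at_kinv. Qed.

Lemma sum_p_sqr : \sum_i p_ i x ^+ 2 = S^-1.
Proof.
rewrite (eq_bigr (fun i => S ^- 2 * y_ i x ^+ 2)) => [|i _]; last by rewrite /p_ /S; field.
by rewrite -mulr_sumr -[\sum_i _]/S; have := x0; rewrite -/S => h; field.
Qed.

Lemma sum_p (g : 'I_n -> R) : \sum_i p_ i x * g i = S^-1 * \sum_i y_ i x * g i.
Proof. by rewrite mulr_sumr; apply: eq_bigr => i _; rewrite /p_ /S; field. Qed.

End at_point.

Section derivatives.
Variables (Omega : set 'rV[R]_n) (u : 'rV[R]_n -> R) (d : 'I_n -> 'rV[R]_n -> R)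
  (dd : 'I_n -> 'I_n -> 'rV[R]_n -> R).
Hypotheses (oO : open Omega)
  (u_cont : forall x, Omega x -> {for x, continuous u})
  (d_cont : forall k x, Omega x -> {for x, continuous (d k)})
  (d_derive : forall k x, Omega x -> is_derive x (e_ k) u (d k x))
  (dd_derive : forall i j x, Omega x -> is_derive x (e_ j) (d i) (dd i j x))
  (dd_cont : forall i j x, Omega x -> {for x, continuous (dd i j)}).

(* [T i] is the i-th partial derivative of the Kelvin transform divided by its
   weight, and [dT i] the i-th partial derivative of [T i].  The Hessian of [u] is
   not assumed to be symmetric. *)
Let E x : R := \sum_j y_ j x * d j (kinv x).
Let w_ j x : R := \sum_k y_ k x * dd j k (kinv x).
Let z_ i x : R := \sum_j y_ j x * dd j i (kinv x).
Let Q x : R := \sum_j y_ j x * w_ j x.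
Let T i x : R := - m * (p_ i x * u (kinv x)) + kratio x * (d i (kinv x) - 2 * (p_ i x * E x)).
Let dp i x : R := (ksq x)^-1 - 2 * (p_ i x * p_ i x).
Let du i x : R := kratio x * (d i (kinv x) - 2 * p_ i x * E x).
Let dE i x : R := d i (kinv x) + kratio x * (z_ i x - 2 * p_ i x * Q x).
Let ddd i x : R := kratio x * (dd i i (kinv x) - 2 * p_ i x * w_ i x).
Let dT i x : R := - m * (dp i x * u (kinv x) + p_ i x * du i x) +
  ((- 2 * p_ i x * kratio x) * (d i (kinv x) - 2 * (p_ i x * E x)) +
   kratio x * (ddd i x - 2 * (dp i x * E x + p_ i x * dE i x))).

Definition kelvin_d i x : R := kweight x * T i x.
Definition kelvin_dd i x : R := (- m * p_ i x * kweight x) * T i x + kweight x * dT i x.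

Section at_point.
Variable x : 'rV[R]_n.
Hypotheses (x0 : ksq x != 0) (Kx : Omega (kinv x)).

Let near_d : \forall z \near kinv x, forall k, is_derive z (e_ k) u (d k z).
Proof. by have := near_in oO Kx; apply: filterS => z zO k; exact: d_derive. Qed.

Let near_dd j : \forall z \near kinv x, forall k, is_derive z (e_ k) (d j) (dd j k z).
Proof. by have := near_in oO Kx; apply: filterS => z zO k; exact: dd_derive. Qed.

Let derive_u i : is_derive x (e_ i) (fun z => u (kinv z)) (du i x).
Proof. by apply: derive_kinv_comp => // k; exact: d_cont. Qed.

Let derive_d i j : is_derive x (e_ i) (fun z => d j (kinv z))
  (kratio x * (dd j i (kinv x) - 2 * p_ i x * w_ j x)).
Proof. by apply: derive_kinv_comp => // k; exact: dd_cont. Qed.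

Let derive_E i : is_derive x (e_ i) E (dE i x).
Proof.
have -> : dE i x = \sum_j ((j == i)%:R * d j (kinv x) +
    y_ j x * (kratio x * (dd j i (kinv x) - 2 * p_ i x * w_ j x))).
  rewrite /dE big_split /= (bigD1 i) //= eqxx mul1r big1 ?addr0; last first.
    by move=> k /negbTE ->; rewrite mul0r.
  congr (_ + _); rewrite [RHS](eq_bigr (fun j => kratio x * (y_ j x * dd j i (kinv x)) -
      kratio x * (2 * p_ i x) * (y_ j x * w_ j x))); last by move=> j _; ring.
  by rewrite sumrB -!mulr_sumr; rewrite -/(z_ i x) -/(Q x); ring.
by apply: derive_sum => j; apply: derive_mul; [exact: derive_y|exact: derive_d].
Qed.

Let derive_T i : is_derive x (e_ i) (T i) (dT i x).
Proof.
apply: derive_add.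
  by apply: derive_scale; apply: derive_mul; [exact: derive_p|exact: derive_u].
apply: derive_mul; first exact: derive_kratio.
apply: derive_sub; first exact: derive_d.
by apply: derive_scale; apply: derive_mul; [exact: derive_p|exact: derive_E].
Qed.

Lemma is_derive_kelvin i : is_derive x (e_ i) (kelvin u) (kelvin_d i x).
Proof.
have -> : kelvin_d i x = (- m * p_ i x * kweight x) * u (kinv x) + kweight x * du i x.
  by rewrite /kelvin_d /T /du; ring.
by apply: derive_mul; [exact: derive_kweight|exact: derive_u].
Qed.

Lemma is_derive_kelvin_d i : is_derive x (e_ i) (kelvin_d i) (kelvin_dd i x).
Proof. by apply: derive_mul; [exact: derive_kweight|exact: derive_T]. Qed.

Let cu : {for x, continuous (fun z => u (kinv z))}.
Proof. by apply: continuous_at_kinv_comp => //; exact: u_cont. Qed.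
Let cd k : {for x, continuous (fun z => d k (kinv z))}.
Proof. by apply: continuous_at_kinv_comp => //; exact: d_cont. Qed.
Let cdd i j : {for x, continuous (fun z => dd i j (kinv z))}.
Proof. by apply: continuous_at_kinv_comp => //; exact: dd_cont. Qed.
Let cE : {for x, continuous E}.
Proof. by apply: continuous_at_sum => k; apply: continuous_at_mul => //; exact: continuous_at_y.
Qed.
Let cw j : {for x, continuous (w_ j)}.
Proof. by apply: continuous_at_sum => k; apply: continuous_at_mul => //; exact: continuous_at_y.
Qed.
Let cz j : {for x, continuous (z_ j)}.
Proof. by apply: continuous_at_sum => k; apply: continuous_at_mul => //; exact: continuous_at_y.
Qed.
Let cQ : {for x, continuous Q}.
Proof. by apply: continuous_at_sum => k; apply: continuous_at_mul => //; exact: continuous_at_y.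
Qed.
Let cp i : {for x, continuous (p_ i)}. Proof. exact: continuous_at_p. Qed.
Let cb : {for x, continuous kratio}. Proof. exact: continuous_at_kratio. Qed.
Let cpE i : {for x, continuous (fun z => p_ i z * E z)}.
Proof. by apply: continuous_at_mul; [exact: cp|exact: cE]. Qed.

Let scale_cont (a : R) (g : 'rV[R]_n -> R) : {for x, continuous g} -> {for x, continuous (fun z
  => a * g z)}.
Proof. by move=> hg; apply: continuous_at_mul => //; exact: continuous_at_cst. Qed.

Let cdu i : {for x, continuous (fun z => d i (kinv z) - 2 * (p_ i z * E z))}.
Proof. by apply: continuous_at_sub; [exact: cd|exact: scale_cont]. Qed.

Let cT i : {for x, continuous (T i)}.
Proof.
apply: continuous_at_add; first by apply: scale_cont; apply: continuous_at_mul; [exact: cp|exact: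
  cu].
by apply: continuous_at_mul; [exact: cb|exact: cdu].
Qed.

Let cdp i : {for x, continuous (dp i)}.
Proof.
apply: continuous_at_sub; first exact: continuous_at_ksqV.
by apply: scale_cont; apply: continuous_at_mul; exact: cp.
Qed.

Let c2p i (g : 'rV[R]_n -> R) : {for x, continuous g} -> {for x, continuous (fun z => 2 * p_ i z
  * g z)}.
Proof. by move=> hg; apply: continuous_at_mul => //; apply: scale_cont; exact: cp. Qed.

Let cdT i : {for x, continuous (dT i)}.
Proof.
apply: continuous_at_add.
  apply: scale_cont; apply: continuous_at_add; first by apply: continuous_at_mul; [exact:
    cdp|exact: cu].
  apply: continuous_at_mul; first exact: cp.
  by apply: continuous_at_mul; [exact: cb|apply: continuous_at_sub; [exact: cd|exact: c2p]].
apply: continuous_at_add.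
  by apply: continuous_at_mul; [apply: continuous_at_mul; [apply: scale_cont; exact: cp|exact:
    cb]|exact: cdu].
apply: continuous_at_mul; first exact: cb.
apply: continuous_at_sub.
  by apply: continuous_at_mul; [exact: cb|apply: continuous_at_sub; [exact: cdd|apply: c2p;
    exact: cw]].
apply: scale_cont; apply: continuous_at_add; first by apply: continuous_at_mul; [exact:
  cdp|exact: cE].
apply: continuous_at_mul; first exact: cp.
apply: continuous_at_add; first exact: cd.
by apply: continuous_at_mul; [exact: cb|apply: continuous_at_sub; [exact: cz|apply: c2p; exact:
  cQ]].
Qed.

Lemma kelvin_cont : {for x, continuous (kelvin u)}.
Proof. by apply: continuous_at_mul => //; exact: continuous_at_kweight. Qed.

Lemma kelvin_d_cont i : {for x, continuous (kelvin_d i)}.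
Proof. by apply: continuous_at_mul => //; exact: continuous_at_kweight. Qed.

Lemma kelvin_dd_cont i : {for x, continuous (kelvin_dd i)}.
Proof.
have ck := continuous_at_kweight x0.
apply: continuous_at_add; last by apply: continuous_at_mul; [exact: continuous_at_kweight|exact:
  cdT].
apply: continuous_at_mul; last exact: cT.
by apply: continuous_at_mul; [apply: scale_cont; exact: cp|exact: continuous_at_kweight].
Qed.

(** After summation everything reduces to u, [E], [Q] and the trace of the Hessian, the row and
    column contractions [w_] and [z_] having the same sum against [p_]. With n = m + 2 all terms but
    the trace cancel; the exponent m / 2 of the weight is made for this. *)
Lemma kelvin_laplacian :
  \sum_i kelvin_dd i x = kweight x * kratio x ^+ 2 * \sum_i dd i i (kinv x).
Proof.
have sp := sum_p_sqr x0.
have spv : \sum_i p_ i x * d i (kinv x) = (ksq x)^-1 * E x by exact: sum_p.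
have spw : \sum_i p_ i x * w_ i x = (ksq x)^-1 * Q x by exact: sum_p.
have spz : \sum_i p_ i x * z_ i x = (ksq x)^-1 * Q x.
  rewrite sum_p //; congr (_ * _); rewrite /Q /z_ /w_.
  under eq_bigr do rewrite mulr_sumr.
  rewrite exchange_big /=; apply: eq_bigr => j _; rewrite mulr_sumr; apply: eq_bigr => k _.
  by ring.
set a := kweight x; set b := kratio x; set S1 := (ksq x)^-1 in spv spw spz sp *.
have sS : \sum_(i < n) S1 = (m + 2) * S1.
  by rewrite sumr_const card_ord /m subrK mulr_natl.
rewrite (eq_bigr (fun i => a * (m ^+ 2 * u (kinv x) + 4 * m * b * E x + 2 * m * u (kinv x) + 8 *
  b * E x + 4 * b ^+ 2 * Q x) * p_ i x ^+ 2 -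
  (a * b * (2 * m + 4)) * (p_ i x * d i (kinv x)) - (2 * a * b ^+ 2) * (p_ i x * w_ i x)
  - (2 * a * b ^+ 2) * (p_ i x * z_ i x) + (a * b ^+ 2) * dd i i (kinv x) - a * (m * u (kinv x) +
    2 * b * E x) * S1)); last first.
  move=> i _; rewrite /kelvin_dd /dT /T /dp /du /dE /ddd -/a -/b -/S1.
  by ring.
rewrite !(sumrB, big_split) /= -!mulr_sumr sp spv spw spz sS.
by rewrite /= ; ring.
Qed.

End at_point.
End derivatives.
End kelvin.

(** * Moving spheres *)

Section geometry.
Context {R : realType} {n : nat}.
Implicit Types (Omega : set 'rV[R]_n) (x y P : 'rV[R]_n).
Local Notation e_ k := (delta_mx 0 k : 'rV[R]_n).

Lemma nsq_ge0 x : 0 <= nsq x. Proof. by apply: sumr_ge0 => i _; exact: sqr_ge0. Qed.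

Lemma norm_sqr_le_nsq x : `|x| ^+ 2 <= nsq x.
Proof.
rewrite -(sqr_sqrtr (nsq_ge0 x)) ler_pXn2r ?nnegrE ?sqrtr_ge0 //.
apply: norm_rV_le; rewrite ?sqrtr_ge0 // => i.
rewrite -sqrtr_sqr; apply: ler_wsqrtr; rewrite /nsq (bigD1 i) //= lerDl.
by apply: sumr_ge0 => j _; exact: sqr_ge0.
Qed.

Lemma enormE x : enorm x = Num.sqrt (nsq x). Proof. by []. Qed.

Lemma enorm_ge0 x : 0 <= enorm x. Proof. exact: sqrtr_ge0. Qed.

Lemma enorm_sqr x : enorm x ^+ 2 = nsq x. Proof. by rewrite sqr_sqrtr // nsq_ge0. Qed.

Lemma nsqZ (a : R) x : nsq (a *: x) = a ^+ 2 * nsq x.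
Proof. by rewrite /nsq mulr_sumr; apply: eq_bigr => i _; rewrite mxE exprMn. Qed.

Lemma enormZ (a : R) x : enorm (a *: x) = `|a| * enorm x.
Proof. by rewrite enormE nsqZ sqrtrM ?sqr_ge0 // sqrtr_sqr. Qed.

Lemma near_affine (Q : 'rV[R]_n -> Prop) (a : 'rV[R]_n) (t : R) x :
  (\forall y \near a + t *: x, Q y) -> \forall y \near x, Q (a + t *: y).
Proof.
move=> /nbhs_ballP[r /= r0 hr].
have t0 : 0 < `|t| + 1 by rewrite ltr_wpDl.
apply/nbhs_ballP; exists (r / (`|t| + 1)); first by rewrite /= divr_gt0.
move=> y; rewrite mx_norm_ball /ball_ /= ltr_pdivlMr // => yx; apply: hr.
rewrite mx_norm_ball /ball_ /= opprD addrACA subrr add0r -scalerBr normrZ.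
by apply: le_lt_trans yx; rewrite mulrC ler_wpM2l // lerDl.
Qed.

Lemma near_eball P (r : R) : 0 < r -> \forall y \near P, eball P r y.
Proof.
move=> r0.
have c : {for P, continuous (ksq P)} by apply: continuous_at_ksq.
have := cvgr_lt _ c (r ^+ 2); rewrite /ksq subrr.
have -> : nsq (0 : 'rV[R]_n) = 0 by rewrite /nsq big1 // => i _; rewrite mxE expr0n.
move=> /(_ _ (exprn_gt0 2 r0)); apply: filterS => y h; rewrite /eball /= enormE.
by rewrite -(ger0_norm (ltW r0)) -sqrtr_sqr ltr_sqrt // exprn_gt0.
Qed.

(* A boundary point is a limit of points lying strictly below the Lipschitz graph,
   which are exterior points. *)
Lemma interior_closure_lipschitz Omega : open Omega -> lipschitz_boundary Omega ->
  interior (closure Omega) `<=` Omega.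
Proof.
move=> oO lip x ix; apply: contrapT => xO.
have [|Q [i [gamma [rho [QQ rho0 glip chart]]]]] := lip x.
  by split; [exact: interior_subset|move: (oO); rewrite openE => _; move/interior_subset].
have QQ' : Q^T *m Q = 1%:M by exact: mulmx1C.
(* The direction that is vertically downward in the chart. *)
pose v : 'rV[R]_n := - (e_ i *m Q^T).
have vQ : v *m Q = - e_ i by rewrite /v mulNmx -mulmxA QQ' mulmx1.
have hI : \forall y \near x, nbhs y (closure Omega `&` eball x rho).
  by apply: nbhs_interior; apply: filterI => //; exact: near_eball.
have := near_line v hI; rewrite -nbhs_nearE => /nbhs_ballP[s0 /= s00 hs].
pose s := s0 / 2.
have s_gt0 : 0 < s by rewrite divr_gt0.
have /hs hys : ball 0 s0 s.
  by rewrite /ball /= sub0r normrN gtr0_norm // /s ltr_pdivrMr // ltr_pMr // ltr1n.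
have [M M0 hM] : exists2 M : R, 0 < M & forall a b, `|gamma a - gamma b| <= M * `|a - b|.
  have [M0 [_ hM0]] := glip.
  exists (Num.max M0 0 + 1); first by rewrite ltr_wpDl // le_max lexx orbT.
  move=> a b; apply: (hM0 _ _ (a, b)) => //.
  by rewrite ltr_pwDr // le_max lexx.
pose B := \sum_l \sum_k `|Q l k| + 1.
have B0 : 0 < B by rewrite ltr_wpDl // sumr_ge0 // => l _; rewrite sumr_ge0.
(* For a point within t of [x + s *: v], each chart coordinate is off by at most [t * B]. The choice
   [t * B * (M + 1) = s] makes the descent by s outweigh this error and the variation of [gamma] it
   allows. *)
pose t := s / (B * (M + 1)).
have M1 : 0 < M + 1 by rewrite ltr_wpDl // ltW.
have t0 : 0 < t by rewrite divr_gt0 // mulr_gt0.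
have gam0 : 0 <= gamma 0.
  have xb : eball x rho x by apply: nbhs_singleton; exact: near_eball.
  rewrite leNgt; apply/negP => g0; apply: xO; apply/(chart x xb).
  rewrite subrr mul0mx mxE.
  have -> : col' i 0 = 0 :> 'rV[R]_n.-1 by apply/rowP => j; rewrite !mxE.
  exact: g0.
have [cl _] := nbhs_singleton hys.
have [y [yO [yt [_ yr]]]] := cl _ (filterI (nbhsx_ballx (x + s *: v) t t0) hys).
move/(chart y yr) : yO.
set z := (y - x) *m Q.
pose w := (y - (x + s *: v)) *m Q.
have zE : z = w - s *: e_ i.
  have e1 : y - x = (y - (x + s *: v)) + s *: v by rewrite opprD addrA subrK.
  rewrite /z [y - x in LHS]e1 mulmxDl -scalemxAl vQ; congr (_ + _); exact: scalerN.
have wB k : `|w 0 k| <= t * B.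
  rewrite /w mxE; apply: le_trans (ler_norm_sum _ _ _) _.
  apply: (@le_trans _ _ (\sum_l t * \sum_k `|Q l k|)).
    apply: ler_sum => l _; rewrite normrM; apply: ler_pM => //.
      move: yt; rewrite mx_norm_ball /ball_ /= distrC => yt.
      by apply: le_trans (coord_le_norm _ _) (ltW yt).
    by rewrite (bigD1 k) //= lerDl sumr_ge0.
  by rewrite -mulr_sumr ler_pM2l // /B lerDl.
clearbody z w.
have colz : `|col' i z| <= t * B.
  apply: norm_rV_le; first by rewrite mulr_ge0 // ltW.
  move=> k; rewrite zE !mxE eqxx /= eq_sym.
  by rewrite (negbTE (neq_lift i k)) mulr0 subr0; exact: wB.
have := hM (col' i z) 0; rewrite subr0 => /le_trans/(_ (ler_wpM2l (ltW M0) colz)).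
rewrite ler_norml => /andP[h1 _].
have := wB i; rewrite ler_norml => /andP[_ h2].
rewrite zE !mxE !eqxx mulr1 -zE => h3.
have e : t * B * (M + 1) = s by rewrite /t; field; rewrite !gt_eqF.
move: h1 h2 h3 e gam0; move: (gamma (col' i z)) (gamma 0) (w 0 i) (t * B) => a b c tb; clear -M;
  move: (s) => s'.
lra.
Qed.

(* Contractions towards P map the exterior of Omega into the closure of the exterior,
   which does not meet Omega; so dilations map Omega into the interior of closure Omega. *)
Lemma dilation_invariant Omega P : domain Omega -> g_radially_convex (~` closure Omega) P ->
  lipschitz_boundary Omega ->
  forall x (t : R), Omega x -> 1 <= t -> Omega (P + t *: (x - P)).
Proof.
move=> [oO _ _] [_ _ rc] lip x t xO t1.
apply: interior_closure_lipschitz => //.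
have t0 : 0 < t by exact: lt_le_trans t1.
pose y := P + t *: (x - P).
have xE z : (1 - t^-1) *: P + t^-1 *: z = P - t^-1 *: P + t^-1 *: z.
  by rewrite scalerBl scale1r.
have : \forall z \near y, Omega ((1 - t^-1) *: P + t^-1 *: z).
  apply: near_affine.
  have -> : (1 - t^-1) *: P + t^-1 *: y = x.
    by apply/rowP => j; rewrite !mxE; field; rewrite gt_eqF.
  exact: near_in.
apply: filterS => z zO; apply: contrapT => zc.
have t01 : 0 <= t^-1 <= 1 by rewrite invr_ge0 (ltW t0) invf_le1.
have cl := rc z zc _ t01.
by have [w [h1 h2]] := cl _ (near_in oO zO); apply: h1; exact: subset_closure.
Qed.

Lemma away_from_center Omega P : ~ closure Omega P ->
  exists2 d : R, 0 < d & forall x, Omega x -> d <= ksq P x.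
Proof.
move=> hP; have : \forall y \near P, ~ Omega y.
  have oC : open (~` closure Omega) by rewrite openC; exact: closed_closure.
  by have := near_in oC hP; apply: filterS => y yc yO; apply: yc; exact: subset_closure.
move=> /nbhs_ballP[r /= r0 hr]; exists (r ^+ 2); first by rewrite exprn_gt0.
move=> x xO; apply: le_trans (norm_sqr_le_nsq _); rewrite ler_pXn2r ?nnegrE ?(ltW r0) //.
rewrite leNgt; apply/negP => xr; apply: (hr x) => //.
by rewrite mx_norm_ball /ball_ /= distrC.
Qed.

(** Boundary points do not belong to the open set [Omega], so [u] is 0 there and joins the zero
    function continuously. *)
Lemma continuous_extension Omega (u : 'rV[R]_n -> R) : open Omega -> {within closure Omega,
  continuous u} ->
  (forall x, ~ Omega x -> u x = 0) -> continuous u.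
Proof.
move=> oO cu u0 x.
have [xc|xc] := pselect (closure Omega x); last first.
  have oC : open (~` closure Omega) by rewrite openC; exact: closed_closure.
  apply/(@cvgrPdist_lt _ _ _ _ (nbhs_filter x)) => e e0.
  have := near_in oC xc; apply: filterS => y yc; rewrite !u0 ?subrr ?normr0 //.
  - by move=> yO; apply: yc; exact: subset_closure.
  - by move=> xO; apply: xc; exact: subset_closure.
move/subspace_continuousP : cu => /(_ x xc) cu.
have FF : Filter (within (closure Omega) (nbhs x)) by apply: within_filter; exact: nbhs_filter.
apply/(@cvgrPdist_lt _ _ _ _ (nbhs_filter x)) => e e0.
have hu : \forall y \near x, closure Omega y -> `|u x - u y| < e.
  have : \forall y \near within (closure Omega) (nbhs x), `|u x - u y| < e.
    by move/(@cvgrPdist_lt _ _ _ _ FF) : cu; exact.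
  by rewrite near_withinE.
have [xO|xO] := pselect (Omega x).
  apply: filterS2 hu (near_in oO xO) => y hy yO; apply: hy; exact: subset_closure.
apply: filterS hu => y hy; have [yc|yc] := pselect (closure Omega y); first exact: hy.
rewrite !u0 // ?subrr ?normr0 // => yO; apply: yc; exact: subset_closure.
Qed.

End geometry.

(** Dominated convergence for [g] restricted to [E_ k] minus [N]; in the application the null set
    [N] is the limiting sphere, where nothing is known about membership in [E_ k]. *)
Lemma cvg_integral_vanishing_sets d (T : measurableType d) (R : realType)
    (mu : {measure set T -> \bar R}) (D N : set T) (E_ : nat -> set T) (g : T -> \bar R) :
  measurable D -> measurable N -> (forall k, measurable (E_ k)) -> (forall k, E_ k `<=` D) ->
  mu N = 0%E -> mu.-integrable D g -> (forall x, D x -> (0 <= g x)%E) ->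
  (forall x, D x -> ~ N x -> \forall k \near \oo, ~ E_ k x) ->
  (\int[mu]_(x in E_ k) g x)%E @[k --> \oo] --> 0%E.
Proof.
move=> mD mN mE ED N0 ig g0 hv.
have mEN k : measurable (E_ k `\` N) by exact: measurableD.
have mg : measurable_fun D g by case/integrableP: ig.
pose f_ k := (g \_ (E_ k `\` N)) : T -> \bar R.
have [|||||_ _ +] := @dominated_convergence _ T R mu D mD f_ (cst 0%E) g.
- move=> k; apply/(measurable_restrict _ (mEN k) mD).
  by apply: measurable_funS mg => // x [].
- exact: measurable_cst.
- apply: aeW => x Dx; apply: cvg_near_cst.
  have [Nx|Nx] := pselect (N x).
    by apply: nearW => k; rewrite /f_ patchE memNset // => -[].
  have := hv x Dx Nx; apply: filterS => k Ek.
  by rewrite /f_ patchE memNset // => -[].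
- exact: ig.
- apply: aeW => x k Dx; rewrite /f_ patchE; case: ifP => _.
    by rewrite gee0_abs // g0.
  by rewrite abse0 g0.
rewrite integral0; apply: cvg_trans; apply: near_eq_cvg; apply: nearW => k.
apply: (@etrans _ _ (\int[mu]_(x in D) (g \_ (E_ k `\` N)) x)%E); first by [].
rewrite -integral_mkcondr setIidr; last by move=> x [/ED].
apply/esym; apply: (ge0_negligible_integral mN (mE k)) => //.
- by apply: measurable_funS mg => //; exact: ED.
- by move=> x /ED; exact: g0.
Qed.

Section topology.
Context {R : realType} {n : nat}.
Implicit Types (S : set 'rV[R]_n) (g : 'rV[R]_n -> R) (x y : 'rV[R]_n).

Lemma closure_ge S g y (a : R) : {for y, continuous g} -> closure S y ->
  (forall x, S x -> a <= g x) -> a <= g y.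
Proof.
move=> cg Sy hg; rewrite leNgt; apply/negP => ga.
have near_lt := @cvgr_lt _ _ (nbhs y) (nbhs_filter y) g (g y) cg _ ga.
by have [x [Sx gx]] := Sy _ near_lt; have := hg x Sx; rewrite leNgt gx.
Qed.

Lemma closure_le S g y (a : R) : {for y, continuous g} -> closure S y ->
  (forall x, S x -> g x <= a) -> g y <= a.
Proof.
move=> cg Sy hg; rewrite leNgt; apply/negP => ga.
have near_lt := @cvgr_gt _ _ (nbhs y) (nbhs_filter y) g (g y) cg _ ga.
by have [x [Sx gx]] := Sy _ near_lt; have := hg x Sx; rewrite leNgt gx.
Qed.

Lemma bounded_on_ball g (L : R) : continuous g -> exists2 M : R, 0 < M & forall x, `|x| <= L -> g
  x <= M.
Proof.
move=> cg; have [L0|L0] := leP 0 L; last first.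
  by exists 1 => // x xL; have := le_lt_trans xL L0; rewrite normr_lt0.
have [||c _ hc] := @EVT_max_rV R n g _ _ (@compact_rV_ball R n L).
- by exists 0; rewrite /= normr0.
- by apply: continuous_subspaceT; exact: cg.
exists (Num.max (g c) 0 + 1); first by rewrite ltr_wpDl // le_max lexx orbT.
move=> x xL; apply: (@le_trans _ _ (g c)); first by apply: hc; rewrite inE.
by rewrite ler_wpDr // le_max lexx.
Qed.

End topology.

Section kelvin_facts.
Context {R : realType} {n : nat}.
Variables (P : 'rV[R]_n).
Implicit Types (x y : 'rV[R]_n) (lam : R) (u : 'rV[R]_n -> R).
Local Notation S := (ksq P).

Lemma kelvin_sphere u lam x : 0 < lam -> S x = lam ^+ 2 -> kelvin P lam u x = u x.
Proof.
move=> l0 xl; have b1 : kratio P lam x = 1 by rewrite /kratio xl divff // gt_eqF // exprn_gt0.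
by rewrite /kelvin /kweight /kinv b1 powR1 mul1r scale1r addrC subrK.
Qed.

Lemma kelvin_ge0 u lam x : (forall y, 0 <= u y) -> 0 <= kelvin P lam u x.
Proof. by move=> u0; rewrite mulr_ge0 // powR_ge0. Qed.

Lemma kelvin_cont_lam u lam x : continuous u -> 0 < lam -> S x != 0 ->
  {for lam, continuous (fun l => kelvin P l u x)}.
Proof.
move=> cu l0 x0.
have cb : {for lam, continuous (fun l => kratio P l x)}.
  apply: continuous_at_mul; last exact: continuous_at_cst.
  exact: exprn_continuous.
apply: continuous_at_mul.
  apply: (continuous_at_comp (g := fun t => t `^ ((n%:R - 2) / 2)) cb).
  apply: differentiable_continuous; apply/derivable1_diffP.
  by have := is_derive1_powR ((n%:R - 2) / 2) (kratio_gt0 l0 x0); case.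
apply: (continuous_at_comp (g := fun t => u (P + t *: (x - P))) cb).
apply: (@continuous_comp _ _ _ (fun t : R => P + t *: (x - P)) u); last exact: cu.
by apply: cvgD; [exact: cvg_cst|apply: cvgZr_tmp; exact: cvg_id].
Qed.

End kelvin_facts.

(** * Comparison with the Kelvin transform at every radius *)

Section moving_spheres.
Context {R : realType} {n : nat}.
Variables (P : 'rV[R]_n) (Omega : set 'rV[R]_n) (q d0 : R)
  (u : 'rV[R]_n -> R) (d : 'I_n -> 'rV[R]_n -> R) (dd : 'I_n -> 'I_n -> 'rV[R]_n -> R)
  (f : 'rV[R]_n -> R -> R).
Local Notation e_ k := (delta_mx 0 k : 'rV[R]_n).
Local Notation S := (ksq P).
Local Notation T := (caratheodory_type (@lebesgue_outer R n)).
Local Notation mu := (@lebesgue_rV R n).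
Implicit Types (x y : 'rV[R]_n) (lam : R).
Hypotheses (n1 : (1 < n)%N) (q1 : 1 < q) (nq : n%:R / 2 <= q) (oO : open Omega) (d00 : 0 < d0)
  (away : forall x, Omega x -> d0 <= S x)
  (dil : forall x (t : R), Omega x -> 1 <= t -> Omega (P + t *: (x - P)))
  (cu : continuous u) (u0 : forall x, ~ Omega x -> u x = 0) (u_gt0 : forall x, Omega x -> 0 < u x)
  (d_cont : forall k x, Omega x -> {for x, continuous (d k)})
  (d_derive : forall k x, Omega x -> is_derive x (e_ k) u (d k x))
  (dd_derive : forall i j x, Omega x -> is_derive x (e_ j) (d i) (dd i j x))
  (dd_cont : forall i j x, Omega x -> {for x, continuous (dd i j)})
  (pde : forall x, Omega x -> - (\sum_k dd k k x) = f x (u x))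
  (subcrit : forall lam x, 0 < lam -> Omega x -> S x < lam ^+ 2 ->
    f x (kelvin P lam u x) < kweight P lam x * kratio P lam x ^+ 2 *
      f (kinv P lam x) (u (kinv P lam x)))
  (flip : forall L M : R, 0 < L -> 0 < M -> exists H : 'rV[R]_n -> R,
    [/\ measurable_fun (Omega `&` [set x | `|x| < L] : set T) (H : T -> R),
        (\int[mu]_(x in Omega `&` [set x | (`|x| < L)%R]) (`|H x| `^ q)%:E < +oo)%E &
        forall x, Omega x -> `|x| < L -> 0 <= H x /\
          forall a b : R, 0 <= a <= M -> 0 <= b <= M -> `|f x a - f x b| <= H x * `|a - b|]).

Let u_ge0 x : 0 <= u x.
Proof. by have [/u_gt0/ltW|/u0 ->] := pselect (Omega x). Qed.

Let S_neq0 x : Omega x -> S x != 0.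
Proof. by move=> /away h; rewrite gt_eqF // (lt_le_trans d00). Qed.

Let kinv_in lam x : 0 < lam -> Omega x -> S x <= lam ^+ 2 -> Omega (kinv P lam x).
Proof.
move=> l0 xO xl; apply: dil => //; rewrite /kratio ler_pdivlMr ?mul1r //.
exact: lt_le_trans (away xO).
Qed.

(** It lies in [Omega] of itself: outside, [u] is 0 while the transform is nonnegative. *)
Definition excess lam : set 'rV[R]_n := [set x | S x < lam ^+ 2 /\ kelvin P lam u x < u x].

Let excess_in lam x : excess lam x -> Omega x.
Proof.
move=> [_ h]; apply: contrapT => /u0 ux; move: h; rewrite ux ltNge => /negP; apply.
exact: kelvin_ge0.
Qed.

Let kelvin_u_cont lam x : 0 < lam -> S x != 0 -> {for x, continuous (kelvin P lam u)}.
Proof. by move=> l0 x0; apply: (@kelvin_cont R n P lam l0 setT) => // y _; exact: cu. Qed.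

Let phi lam x := u x - kelvin P lam u x.
Let pd lam k x := d k x - kelvin_d P lam u d k x.
Let pdd lam k x := dd k k x - kelvin_dd P lam u d dd k x.

Let phi_cont lam x : 0 < lam -> S x != 0 -> {for x, continuous (phi lam)}.
Proof. by move=> l0 x0; apply: continuous_at_sub; [exact: cu|exact: kelvin_u_cont]. Qed.

Let S_cont x : {for x, continuous S}. Proof. exact: continuous_at_ksq. Qed.

Let excess_open lam : 0 < lam -> open (excess lam).
Proof.
move=> l0; rewrite openE => x xE.
have x0 := S_neq0 (excess_in xE).
have [h1 h2] := xE.
have p0 : 0 < phi lam x by rewrite subr_gt0.
apply: filterS2 (@cvgr_lt _ _ (nbhs x) (nbhs_filter x) S (S x) (@S_cont x) _ h1)
  (@cvgr_gt _ _ (nbhs x) (nbhs_filter x) (phi lam) _ (phi_cont l0 x0) _ p0) => y y1 y2.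
by split=> //; rewrite -subr_gt0.
Qed.

(** A positive level excludes limit points on the sphere, where the transform agrees with [u], and
    [d0 <= S] keeps limits away from the singular point [P]. *)
Let excess_closed lam e : 0 < lam -> 0 < e -> closed [set x | excess lam x /\ e <= phi lam x].
Proof.
move=> l0 e0 y cy.
have Sy : S y <= lam ^+ 2.
  by apply: (closure_le (@S_cont y) cy) => x [[/ltW h _] _].
have Sy0 : d0 <= S y.
  by apply: (closure_ge (@S_cont y) cy) => x [/excess_in/away].
have y0 : S y != 0 by rewrite gt_eqF // (lt_le_trans d00).
have py : e <= phi lam y.
  by apply: (closure_ge (phi_cont l0 y0) cy) => x [].
split=> //; split; last by rewrite -subr_gt0 (lt_le_trans e0).
rewrite lt_neqAle Sy andbT; apply/eqP => yl.
by move: py; rewrite /phi kelvin_sphere // subrr leNgt e0.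
Qed.

Let derivative_facts lam x : 0 < lam -> Omega x -> S x <= lam ^+ 2 ->
  [/\ forall k, {for x, continuous (pd lam k)},
      forall k, is_derive x (e_ k) (phi lam) (pd lam k x),
      forall k, is_derive x (e_ k) (pd lam k) (pdd lam k x),
      forall k, {for x, continuous (pdd lam k)} &
      - (\sum_k pdd lam k x) = f x (u x) - kweight P lam x * kratio P lam x ^+ 2 *
      f (kinv P lam x) (u (kinv P lam x))].
Proof.
move=> l0 xO xl; have x0 := S_neq0 xO; have Kx := kinv_in l0 xO xl.
have uc y : Omega y -> {for y, continuous u} by move=> _; exact: cu.
split=> [k|k|k|k|].
- by apply: continuous_at_sub; [exact: d_cont|apply: (kelvin_d_cont l0 uc)].
- by apply: derive_sub; [exact: d_derive|apply: (is_derive_kelvin l0 oO)].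
- by apply: derive_sub; [exact: dd_derive|apply: (is_derive_kelvin_d l0 oO)].
- by apply: continuous_at_sub; [exact: dd_cont|apply: (kelvin_dd_cont l0 uc)].
rewrite -!pde // sumrB kelvin_laplacian //; ring.
Qed.

Let excess_small lam : 0 < lam -> lam ^+ 2 <= d0 -> excess lam = set0.
Proof.
move=> l0 ld; apply/seteqP; split=> // x xE /=.
have := away (excess_in xE); case: xE => h _; rewrite leNgt => /negP; apply.
exact: lt_le_trans ld.
Qed.

(* A contact point inside the sphere would be an interior maximum of
   [u - kelvin P lam u], which the strict inequality [subcrit] excludes. *)
Let touching lam x : 0 < lam -> excess lam = set0 -> Omega x -> S x < lam ^+ 2 ->
  u x < kelvin P lam u x.
Proof.
move=> l0 E0 xO xl.
have nE y : S y < lam ^+ 2 -> u y <= kelvin P lam u y.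
  move=> yl; rewrite leNgt; apply/negP => h.
  by have : excess lam y by []; rewrite E0.
have le1 := nE x xl.
rewrite lt_neqAle le1 andbT; apply/eqP => ux.
have [_ _ h3 _ h5] := derivative_facts l0 xO (ltW xl).
have nearO : \forall y \near x, Omega y /\ S y < lam ^+ 2.
  exact: filterI (near_in oO xO) (@cvgr_lt _ _ (nbhs x) (nbhs_filter x) S (S x) (@S_cont x) _ xl).
have : \sum_k pdd lam k x <= 0.
  apply: (@laplacian_at_max R n (phi lam) (pd lam) (pdd lam)).
  - by apply: filterS nearO => y [yO /ltW yl]; have [] := derivative_facts l0 yO yl.
  - by apply: filterS nearO => y [_ yl]; rewrite /phi ux subrr subr_le0; exact: nE.
rewrite -oppr_ge0 h5 {1}ux subr_ge0 leNgt => /negP; apply.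
exact: subcrit.
Qed.

(** For a fixed point the inequalities defining [excess] are open in the radius, so they would
    persist slightly below [lam]. *)
Let excess_limit (lam : R) : 0 < lam -> (forall l, 0 < l -> l < lam -> excess l = set0) -> excess
  lam = set0.
Proof.
move=> l0 h; apply/seteqP; split=> // x xE /=.
have x0 := S_neq0 (excess_in xE); have [h1 h2] := xE.
have c := kelvin_cont_lam cu l0 x0.
have c2 : {for lam, continuous (fun l : R => l ^+ 2)} by exact: exprn_continuous.
have : \forall l \near lam, [/\ 0 < l, S x < l ^+ 2 & kelvin P l u x < u x].
  by apply: filterS3 (cvgr_gt _ cvg_id _ l0) (cvgr_gt _ c2 _ h1) (cvgr_lt _ c _ h2) => l.
move=> /nbhs_ballP[r /= r0 hr].
have [l1 l2 l3] : let l := lam - r / 2 in [/\ 0 < l, S x < l ^+ 2 & kelvin P l u x < u x].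
  apply: hr; rewrite /ball /= opprB addrCA subrr addr0 gtr0_norm ?divr_gt0 //; lra.
have : excess (lam - r / 2) x by [].
by rewrite h //; lra.
Qed.

Let excess_bound lam x : 0 < lam -> S x <= lam ^+ 2 -> `|x| < `|P| + lam + 1.
Proof.
move=> l0 xl; have : `|x - P| <= lam.
  by rewrite -(@ler_pXn2r _ 2) ?nnegrE ?(ltW l0) // (le_trans (norm_sqr_le_nsq _)).
have := ler_normD P (x - P); rewrite addrC subrK; lra.
Qed.

Lemma measurable_region (L : R) : measurable (Omega `&` [set x | `|x| < L] : set T).
Proof.
apply: measurableI; apply: open_measurable_rV => //.
have -> : [set x : 'rV[R]_n | `|x| < L] = (fun x : 'rV[R]_n => `|x|) @^-1` [set t | t < L] by [].
by apply: open_comp; [move=> x _; exact: norm_continuous|exact: open_lt].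
Qed.

(** Otherwise [narrow_domain] would empty the set: by [subcrit] and the Lipschitz bound, [phi lam]
    satisfies the differential inequality with weight [H]. One [L], hence one lower bound, serves
    all radii up to [l1]. *)
Let excess_measure (lam l1 L M : R) (H : 'rV[R]_n -> R) : 0 < lam -> lam <= l1 -> L = `|P| + l1 +
  1 ->
  (forall x, `|x| <= L -> u x <= M) ->
  measurable_fun (Omega `&` [set x | `|x| < L] : set T) (H : T -> R) ->
  (forall x, Omega x -> `|x| < L -> 0 <= H x /\
          forall a b : R, 0 <= a <= M -> 0 <= b <= M -> `|f x a - f x b| <= H x * `|a - b|) ->
  excess lam !=set0 ->
  ((@narrow_const R n L q)%:E <= \int[mu]_(x in excess lam) (`|H x| `^ q)%:E)%E.
Proof.
move=> l0 ll1 LE uM mH hH [x0 x0E]; rewrite leNgt; apply/negP => hint.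
have EL x : excess lam x -> `|x| < L.
  move=> [/ltW h _]; apply: lt_le_trans (excess_bound l0 h) _; rewrite LE; lra.
have L0 : 0 < L by apply: le_lt_trans (EL _ x0E).
have E0 : excess lam = set0.
  apply: (@narrow_domain R n L q n1 L0 q1 nq (excess lam) (phi lam) H (pd lam) (pdd lam) M).
  - exact: excess_open.
  - exact: EL.
  - by move=> x [_ h]; rewrite subr_gt0.
  - move=> x xE; have := uM x (ltW (EL x xE)); have := kelvin_ge0 P lam x u_ge0.
    rewrite /phi; lra.
  - by move=> e e0; exact: excess_closed.
  - by move=> x /excess_in/S_neq0; exact: phi_cont.
  - by move=> k x xE; have [/ltW h _] := xE; have [] := derivative_facts l0 (excess_in xE) h.
  - by move=> k x xE; have [/ltW h _] := xE; have [] := derivative_facts l0 (excess_in xE) h.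
  - by move=> k x xE; have [/ltW h _] := xE; have [] := derivative_facts l0 (excess_in xE) h.
  - by move=> k x xE; have [/ltW h _] := xE; have [] := derivative_facts l0 (excess_in xE) h.
  - apply: measurable_funS mH; last by move=> x xE; split; [exact: excess_in xE|exact: EL].
    exact: measurable_region.
  - by move=> x xE; have [] := hH x (excess_in xE) (EL x xE).
  - move=> x xE; have [h1 h2] := xE; have [_ _ _ _ ->] := derivative_facts l0 (excess_in xE) (ltW
    h1).
    have sub := subcrit l0 (excess_in xE) h1.
    have [H0 hlip] := hH x (excess_in xE) (EL x xE).
    have uxM := uM x (ltW (EL x xE)).
    have k0 := kelvin_ge0 P lam x u_ge0.
    have := hlip (u x) (kelvin P lam u x); rewrite u_ge0 uxM k0 (le_trans (ltW h2) uxM) => /(_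
      isT isT).
    rewrite [`|u x - _|]gtr0_norm ?subr_gt0 // -/(phi lam x); move: (ler_norm (f x (u x) - f x
      (kelvin P lam u x))); lra.
  - exact: ltW hint.
by move: x0E; rewrite E0.
Qed.

(* If [ls > 0] is the infimum of the bad radii and [l_ k] bad radii tending to
   [ls], the integrals of [H `^ q] over [excess (l_ k)] are bounded below although
   these sets shrink to a subset of the sphere of radius [ls]. *)
Lemma no_excess lam : 0 < lam -> excess lam = set0.
Proof.
move=> l0; apply/eqP; apply: contrapT => /negP /set0P hne.
pose A : set R := [set l | 0 < l /\ excess l !=set0].
have A0 : A !=set0 by exists lam.
have Alb : lbound A (Num.sqrt d0).
  move=> l [l0' [x xl]]; rewrite -(@ger0_norm _ l) ?(ltW l0') // -sqrtr_sqr.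
  by apply: ler_wsqrtr; rewrite leNgt; apply/negP => /ltW h; move: xl; rewrite excess_small.
pose ls := inf A.
have ls0 : 0 < ls by apply: lt_le_trans (lb_le_inf A0 Alb); rewrite sqrtr_gt0.
have infA : has_inf A by split=> //; exists (Num.sqrt d0).
have below l : 0 < l -> l < ls -> excess l = set0.
  move=> l0' ll; apply/eqP; apply: contrapT => /negP /set0P h.
  have : ls <= l by apply: ge_inf; [case: infA|].
  by rewrite leNgt ll.
have Els : excess ls = set0 by exact: excess_limit.
have /choice[l_ hl] : forall k : nat, exists l, A l /\ l < ls + k.+1%:R^-1.
  by move=> k; have [|l] := @inf_adherent R A k.+1%:R^-1 _ infA; [rewrite invr_gt0|exists l].
have l_ge k : ls <= l_ k by apply: ge_inf; [case: infA|case: (hl k)].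
have l_cvg : l_ k @[k --> \oo] --> ls.
  apply: (@squeeze_cvgr _ _ _ _ (fun=> ls) (fun k => ls + k.+1%:R^-1)).
  - by apply: nearW => k; rewrite l_ge ltW //; case: (hl k).
  - exact: cvg_cst.
  - by rewrite -[X in _ --> X]addr0; apply: cvgD; [exact: cvg_cst|exact: cvg_harmonic].
have l_le k : l_ k <= ls + 1.
  have [_ /ltW h] := hl k; apply: le_trans h _; rewrite lerD2l invf_le1 ?ler1n //.
(* Large enough for the spheres of all radii [l_ k <= ls + 1], so that [narrow_const] does not
   depend on k. *)
pose L := `|P| + (ls + 1) + 1.
have L0 : 0 < L by rewrite ltr_wpDl // addr_ge0 // addr_ge0 // ltW.
have [M M0 uM] := bounded_on_ball L cu.
have [H [mH iH hH]] := flip L0 M0.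
pose D : set T := Omega `&` [set x | `|x| < L].
have mD : measurable D by exact: measurable_region.
have mHq : measurable_fun D (fun x : T => (`|H x| `^ q)%:E).
  apply/measurable_EFinP; apply: (measurableT_comp (measurable_powR q)).
  exact: (measurableT_comp (@normr_measurable R setT)).
have iHq : mu.-integrable D (fun x : T => (`|H x| `^ q)%:E).
  apply/integrableP; split; first exact: mHq.
  under eq_integral do rewrite gee0_abs ?lee_fin ?powR_ge0 //.
  exact: iH.
have ED k : excess (l_ k) `<=` D.
  move=> x xE; split; first exact: excess_in xE.
  have [h _] := xE; have [[lk0 _] _] := hl k.
  apply: lt_le_trans (excess_bound lk0 (ltW h)) _.
  by rewrite lerD2r lerD2l.
pose N : set T := [set x | S x = ls ^+ 2].
have mN : measurable N.
  apply: closed_measurable_rV => y cy; apply/eqP; rewrite eq_le; apply/andP; split.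
    by apply: (closure_le (@S_cont y) cy) => x ->.
  by apply: (closure_ge (@S_cont y) cy) => x ->.
have N0 : mu N = 0%E by apply: lebesgue_rV_sphere; exact: ltnW.
have mE k : measurable (excess (l_ k) : set T).
  by apply: open_measurable_rV; apply: excess_open; case: (hl k) => [[]].
have := @cvg_integral_vanishing_sets _ T R mu D N (fun k => excess (l_ k)) _ mD mN mE ED N0 iHq.
have Hq0 x : D x -> (0 <= (`|H x| `^ q)%:E)%E by rewrite lee_fin powR_ge0.
move=> /(_ Hq0) hcvg.
(* Off the limiting sphere a point finally leaves the bad sets: inside because the strict inequality
   at [ls] persists for nearby radii, outside because [l_ k] falls below its distance to [P]. *)
have hv x : D x -> ~ N x -> \forall k \near \oo, ~ excess (l_ k) x.
  move=> [xO _] xN; have [xl|xl|//] := ltgtP (S x) (ls ^+ 2).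
    have h := touching ls0 Els xO xl.
    have c := kelvin_cont_lam cu ls0 (S_neq0 xO).
    have near_k : \forall k \near \oo, u x < kelvin P (l_ k) u x by exact: (l_cvg _ (cvgr_gt _ c
      _ h)).
    apply: filterS near_k => k hk [_ hk'].
    by have := lt_trans hk' hk; rewrite ltxx.
  have c : {for ls, continuous (fun l : R => l ^+ 2)} by exact: exprn_continuous.
  have near_k : \forall k \near \oo, l_ k ^+ 2 < S x by exact: (l_cvg _ (cvgr_lt _ c _ xl)).
  apply: filterS near_k => k hk [hk' _].
  by have := lt_trans hk' hk; rewrite ltxx.
have {}hcvg := hcvg hv.
have : ((@narrow_const R n L q)%:E <= 0)%E.
  rewrite -(cvg_lim _ hcvg) //; apply: lime_ge; first by apply/cvg_ex; eexists; exact: hcvg.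
  apply: nearW => k; have [[lk0 lkE] _] := hl k.
  exact: (excess_measure lk0 (l_le k) erefl uM mH hH lkE).
by rewrite lee_fin leNgt narrow_const_gt0.
Qed.

Lemma kelvin_strict lam x : 0 < lam -> Omega x -> S x < lam ^+ 2 -> u x < kelvin P lam u x.
Proof. by move=> l0; apply: touching => //; exact: no_excess. Qed.

End moving_spheres.

(** * From subcriticality to the Kelvin transform *)

Section subcritical.
Context {R : realType} {n : nat}.
Variables (P : 'rV[R]_n) (Omega : set 'rV[R]_n) (f : 'rV[R]_n -> R -> R).
Local Notation S := (ksq P).

(* The scaling parameter is the weight of the Kelvin transform if 2 < n, and its
   ratio if n = 2.  In the case of the range ]0, 1] the monotonicity is applied at
   the reflected point with the inverse parameter. *)
Lemma subcritical_kelvin (u : 'rV[R]_n -> R) (lam : R) x : (1 < n)%N -> subcritical Omega P f ->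
  0 < lam ->
  Omega x -> Omega (kinv P lam x) -> 0 < S x -> S x < lam ^+ 2 -> 0 < u (kinv P lam x) ->
  f x (kelvin P lam u x) < kweight P lam x * kratio P lam x ^+ 2 *
      f (kinv P lam x) (u (kinv P lam x)).
Proof.
move=> n1 hsub l0 xO yO S0 Sl v0.
set y := kinv P lam x in yO v0 *; set v := u y in v0 *.
set b := kratio P lam x; set a := kweight P lam x.
have b1 : 1 < b by rewrite /b /kratio ltr_pdivlMr // mul1r.
have b0 : 0 < b by exact: lt_trans b1.
have a0 : 0 < a by rewrite powR_gt0.
have kE : kelvin P lam u x = a * v by [].
have yE : y = P + b *: (x - P) by [].
have nsq0 : nsq (0 : 'rV[R]_n) = 0 by rewrite /nsq big1 // => i _; rewrite mxE expr0n.
have xP : x != P.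
  by apply: contraTneq S0 => ->; rewrite /ksq subrr nsq0 ltxx.
have yP : y != P.
  rewrite yE -subr_eq0 addrAC subrr add0r scaler_eq0 negb_or gt_eqF //= subr_eq0 //.
have Sx1 : 1 *: (x - P) + P = x by rewrite scale1r subrK.
have Sy1 : 1 *: (y - P) + P = y by rewrite scale1r subrK.
have Sxb : b *: (x - P) + P = y by rewrite yE addrC.
have Syb : b^-1 *: (y - P) + P = x.
  by rewrite yE addrAC subrr add0r scalerA mulVf ?gt_eqF // scale1r subrK.
rewrite kE; have av0 : 0 < a * v by exact: mulr_gt0.
have [n2|n2] := boolP (2 < n)%N; last first.
  have nE : n = 2%N by apply/eqP; rewrite eqn_leq n1 leqNgt n2.
  have aE : a = 1.
    by rewrite /a /kweight [X in _ `^ (X / 2)](_ : _ = 0) ?mul0r ?powRr0 // nE subrr.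
  have spE z (mu : R) : scaled_point P z mu = mu *: (z - P) + P by rewrite /scaled_point (negbTE
    n2).
  have snE z (w mu : R) : scaled_nonlinearity P f z w mu = mu ^+ 2 * f (mu *: (z - P) + P) w.
    by rewrite /scaled_nonlinearity spE (negbTE n2).
  rewrite aE !mul1r.
  case: hsub => hs.
    have := hs x v xO xP v0 1 b; rewrite !spE !snE Sx1 Sxb expr1n mul1r; apply=> //=; exact: ltW.
  have := hs y v yO yP v0 b^-1 1; rewrite !spE !snE Sy1 Syb expr1n mul1r /= invr_gt0 b0 invf_le1
    // (ltW b1) ltr01 lexx.
  move=> /(_ isT isT xO yO (_ : b^-1 < 1)); rewrite invf_lt1 // => /(_ b1).
  by rewrite exprVn ltr_pdivrMl ?exprn_gt0.
have m0 : 0 < n%:R - 2 :> R by rewrite subr_gt0 (ltr_nat R 2).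
have m_neq0 : n%:R - 2 != 0 :> R by rewrite gt_eqF.
have aE : a = b `^ ((n%:R - 2) / 2) by [].
have a1 : 1 < a.
  have p1 : (1 : R) `^ ((n%:R - 2) / 2) = 1 by rewrite powR1.
  by rewrite aE -[X in X < _]p1; apply: gt0_ltr_powR; rewrite ?nnegrE ?divr_gt0 // ltW.
have ab : a `^ (2 / (n%:R - 2)) = b.
  rewrite aE -powRrM (_ : _ * _ = 1) ?powRr1 ?(ltW b0) //.
  by field; rewrite m_neq0.
(* The scaling factor for the parameter [a] is exactly the factor of the transformed Laplacian. *)
have ab2 : a `^ ((n%:R + 2) / (n%:R - 2)) = a * b ^+ 2.
  have -> : (n%:R + 2) / (n%:R - 2) = 1 + 2 / (n%:R - 2) * 2 :> R by field.
  rewrite powRD; last by rewrite (gt_eqF a0) implybT.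
  by rewrite powRr1 ?(ltW a0) // powRrM ab powR_mulrn // ltW.
have spE z (mu : R) : scaled_point P z mu = mu `^ (2 / (n%:R - 2)) *: (z - P) + P by rewrite
  /scaled_point n2.
have snE z (w mu : R) : scaled_nonlinearity P f z w mu =
    mu `^ ((n%:R + 2) / (n%:R - 2)) * f (mu `^ (2 / (n%:R - 2)) *: (z - P) + P) (mu^-1 * w).
  by rewrite /scaled_nonlinearity spE n2.
case: hsub => hs.
  have := hs x (a * v) xO xP av0 1 a; rewrite !spE !snE !powR1 ab ab2 Sx1 Sxb invr1 !mul1r.
  by rewrite mulKf ?gt_eqF //; apply=> //=; exact: ltW.
have aV r : a^-1 `^ r = (a `^ r)^-1.
  have ar : a `^ r != 0 by rewrite gt_eqF // powR_gt0.
  by apply: (mulIf ar); rewrite -powRM ?invr_ge0 ?(ltW a0) // mulVf ?gt_eqF // powR1 mulVf.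
have := hs y v yO yP v0 a^-1 1; rewrite !spE !snE !powR1 !aV ab ab2 Sy1 Syb invr1 invrK !mul1r /=
  invr_gt0 a0 invf_le1 // (ltW a1) ltr01 lexx.
move=> /(_ isT isT xO yO (_ : a^-1 < 1)); rewrite invf_lt1 // => /(_ a1).
have ab0 : 0 < a * b ^+ 2 by apply: mulr_gt0 => //; exact: exprn_gt0.
rewrite ltr_pdivrMl //.
Qed.

End subcritical.

(** * One Lipschitz weight for a bounded range of values *)

Section lipschitz_weight.
Context {R : realType} {n : nat}.
Variables (Omega : set 'rV[R]_n) (f : 'rV[R]_n -> R -> R) (q : R).
Local Notation T := (caratheodory_type (@lebesgue_outer R n)).
Local Notation mu := (@lebesgue_rV R n).
Hypotheses (q0 : 0 < q) (flip : locally_Lq_lipschitz Omega q f).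

Lemma Lq_max (D : set 'rV[R]_n) (h g : 'rV[R]_n -> R) : measurable (D : set T) ->
  (forall x, D x -> 0 <= h x) -> (forall x, D x -> 0 <= g x) ->
  Lq_on D q h -> Lq_on D q g -> Lq_on D q (fun x => Num.max (h x) (g x)).
Proof.
move=> mD h0 g0 [mh ih] [mg ig]; split; first exact: measurable_maxr.
have mq (k : 'rV[R]_n -> R) : measurable_fun (D : set T) (k : T -> R) ->
    measurable_fun (D : set T) (fun x : T => (`|k x| `^ q)%:E).
  move=> mk; apply/measurable_EFinP; apply: (measurableT_comp (measurable_powR q)).
  exact: (measurableT_comp (@normr_measurable R setT)).
apply: (@le_lt_trans _ _ (\int[mu]_(x in D) ((`|h x| `^ q)%:E + (`|g x| `^ q)%:E))%E).
  apply: (ge0_le_integral mu mD).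
  - by move=> x _; rewrite lee_fin powR_ge0.
  - by apply: mq; exact: measurable_maxr.
  - by apply: emeasurable_funD; exact: mq.
  move=> x Dx; rewrite -EFinD lee_fin; have hx := h0 x Dx; have gx := g0 x Dx.
  rewrite !ger0_norm // ?le_max ?hx //.
  by case: (leP (h x) (g x)) => _; rewrite ?lerDl ?lerDr powR_ge0.
rewrite (ge0_integralD mu mD).
- exact: lte_add_pinfty.
- by move=> x _; rewrite lee_fin powR_ge0.
- exact: mq.
- by move=> x _; rewrite lee_fin powR_ge0.
- exact: mq.
Qed.

(* Real induction on the right end of the interval: two adjacent intervals are
   glued by taking the maximum of the two weights. *)
Lemma lipschitz_weight (D : set 'rV[R]_n) (M : R) : measurable (D : set T) -> bounded_set D -> D
  `<=` Omega ->
  0 <= M -> exists H : 'rV[R]_n -> R, Lq_on D q H /\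
    forall x, D x -> 0 <= H x /\
      forall a b : R, 0 <= a <= M -> 0 <= b <= M -> `|f x a - f x b| <= H x * `|a - b|.
Proof.
move=> mD bD DO M0.
pose good t (H : 'rV[R]_n -> R) := Lq_on D q H /\
    forall x, D x -> 0 <= H x /\
      forall a b : R, 0 <= a <= t -> 0 <= b <= t -> `|f x a - f x b| <= H x * `|a - b|.
pose A : set R := [set t | 0 <= t <= M /\ exists H, good t H].
have A0 : A 0.
  split; first by rewrite lexx.
  exists (fun=> 0); split.
    split; first exact: measurable_cst.
    rewrite (eq_integral (cst 0%E)) ?integral0 // => x _ /=.
    by rewrite normr0 powR0 // gt_eqF.
  move=> x _; split=> // a b; rewrite -!eq_le => /eqP <- /eqP <-.
  by rewrite subrr normr0 mul0r.
have supA : has_sup A by split; [exists 0|exists M => t [/andP[]]].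
pose s := sup A.
have s0 : 0 <= s by apply: ub_le_sup => //; case: supA.
have sM : s <= M by apply: ge_sup; [exists 0|move=> t [/andP[]]].
have [V [h [oV Vs hLq hlip]]] := flip s0 mD bD DO.
have /nbhs_ballP[e /= e0 he] : nbhs s V by move: oV; rewrite openE => /(_ _ Vs).
have [t [/andP[t0 tM] [H [HLq Hlip]]] ste] := @sup_adherent R A e e0 supA.
have ts : t <= s by apply: ub_le_sup; [case: supA|split; [rewrite t0|exists H]].
rewrite -/s in ste.
(* The local weight [h] at [s] covers the gap between [t] and [t']. As [t'] is again admissible, it
   cannot pass the supremum, so it is [M]. *)
pose t' := Num.min M (s + e / 2).
have good' : good t' (fun x => Num.max (H x) (h x)).
  split.
    by apply: Lq_max => // x Dx; [case: (Hlip x Dx)|case: (hlip x Dx)].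
  move=> x Dx; have [H0 HL] := Hlip x Dx; have [h0 hL] := hlip x Dx.
  split; first by rewrite le_max H0.
  have Ht : H x <= Num.max (H x) (h x) by rewrite le_max lexx.
  have ht : h x <= Num.max (H x) (h x) by rewrite le_max lexx orbT.
  have m0 : 0 <= Num.max (H x) (h x) by rewrite le_max H0.
  have hO a b : t <= a -> t <= b -> a <= t' -> b <= t' -> `|f x a - f x b| <= h x * `|a - b|.
    move=> ta tb; rewrite /t' !le_min => /andP[_ a'] /andP[_ b'].
    have [->|ab] := eqVneq a b; first by rewrite !subrr normr0 mulr0.
    rewrite -ler_pdivrMr ?normr_gt0 ?subr_eq0 //; apply: hL => //.
    - exact: le_trans ta.
    - exact: le_trans tb.
    - by apply: he; rewrite /ball /= ltr_norml; apply/andP; split; lra.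
    - by apply: he; rewrite /ball /= ltr_norml; apply/andP; split; lra.
  have main a b : 0 <= a -> a <= b -> b <= t' -> `|f x a - f x b| <= Num.max (H x) (h x) * `|a - b|.
    move=> a0 ab bt'.
    have [bt|tb] := leP b t.
      apply: le_trans (HL a b _ _) _; first by rewrite a0 (le_trans ab).
        by rewrite bt (le_trans a0).
      by rewrite ler_wpM2r.
    have [ta|ta] := leP t a.
      apply: le_trans (hO a b _ _ _ _) _ => //; first exact: ltW.
        exact: le_trans bt'.
      by rewrite ler_wpM2r.
    rewrite -(subrK (f x t) (f x a)) -addrA; apply: le_trans (ler_normD _ _) _.
    have h1 := HL a t; have h2 := hO t b.
    have {}h1 : `|f x a - f x t| <= H x * `|a - t| by apply: h1; rewrite ?a0 ?t0 ?lexx ?(ltW ta).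
    have {}h2 : `|f x t - f x b| <= h x * `|t - b|.
      by apply: h2 => //; [exact: ltW|apply: le_trans bt'; exact: ltW].
    apply: le_trans (lerD h1 h2) _.
    rewrite !ler0_norm ?subr_le0 ?(ltW ta) ?(ltW tb) // !opprB.
    have k1 : H x * (t - a) <= Num.max (H x) (h x) * (t - a) by rewrite ler_wpM2r // subr_ge0 ltW.
    have k2 : h x * (b - t) <= Num.max (H x) (h x) * (b - t) by rewrite ler_wpM2r // subr_ge0 ltW.
    apply: le_trans (lerD k1 k2) _; rewrite -mulrDr; apply: ler_wpM2l => //; lra.
  move=> a b /andP[a0 at'] /andP[b0 bt'].
  have [ab|ba] := leP a b; first exact: main.
  by rewrite distrC [`|a - b|]distrC; apply: main => //; exact: ltW.
have t'0 : 0 <= t' by rewrite /t' le_min M0 addr_ge0 // divr_ge0 // ltW.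
have At' : A t'.
  split; first by rewrite t'0 /t' ge_min lexx.
  by exists (fun x => Num.max (H x) (h x)); exact: good'.
have t's : t' <= s by apply: ub_le_sup => //; case: supA.
have t'M : t' = M.
  move: t's; rewrite /t'; case: (leP M (s + e / 2)) => // _; lra.
by exists (fun x => Num.max (H x) (h x)); rewrite -t'M; exact: good'.
Qed.

End lipschitz_weight.

(** * Barriers *)

Section barrier.
Context {R : realType} {n : nat}.
Local Notation e_ k := (delta_mx 0 k : 'rV[R]_n).
Variables (c : 'rV[R]_n) (rho : R).
Hypothesis rho0 : 0 < rho.
Local Notation S := (ksq c).
Local Notation closed_ball := [set x | S x <= rho ^+ 2].

Lemma ksq_center : S c = 0.
Proof. by rewrite /ksq subrr /nsq big1 // => i _; rewrite mxE expr0n. Qed.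

Let S_cont : continuous S. Proof. by move=> x; exact: continuous_at_ksq. Qed.

Lemma compact_eball : compact closed_ball.
Proof.
apply: (@subclosed_compact _ _ [set x : 'rV[R]_n | `|x| <= `|c| + rho]).
- by move=> y cy; apply: (closure_le (@S_cont y) cy) => x.
- exact: compact_rV_ball.
move=> x /= xS; have : `|x - c| <= rho.
  by rewrite -(@ler_pXn2r _ 2) ?nnegrE ?(ltW rho0) // (le_trans (norm_sqr_le_nsq _)).
have := ler_normD c (x - c); rewrite addrC subrK => h1 h2.
by apply: le_trans h1 _; rewrite lerD2l.
Qed.

Section power.
Variable j : nat.
(** Exponents start at 2, so two differentiations stay among natural powers; [j = 0] gives the
    comparison function of the eigenvalue bound, a large [j] the barrier of the maximum
    principle. *)
Definition bump x : R := (rho ^+ 2 - S x) ^+ j.+2.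
Definition bump_d (k : 'I_n) (x : 'rV[R]_n) : R :=
  - 2 * j.+2%:R * ((rho ^+ 2 - S x) ^+ j.+1 * (x - c) 0 k).
Definition bump_dd (k : 'I_n) (x : 'rV[R]_n) : R :=
  - 2 * j.+2%:R * ((rho ^+ 2 - S x) ^+ j.+1 - 2 * j.+1%:R * (rho ^+ 2 - S x) ^+ j * (x - c) 0 k
    ^+ 2).

Let derive_z (k : 'I_n) (x : 'rV[R]_n) : is_derive x (e_ k) (fun x => rho ^+ 2 - S x) (- 2 * (x -
  c) 0 k).
Proof.
have -> : - 2 * (x - c) 0 k = 0 - 2 * (x - c) 0 k by rewrite sub0r mulNr.
by apply: derive_sub; exact: derive_ksq.
Qed.

Let derive_pow (i : nat) (k : 'I_n) (x : 'rV[R]_n) : is_derive x (e_ k) (fun x => (rho ^+ 2 - S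
  x) ^+ i.+1)
  (i.+1%:R * (rho ^+ 2 - S x) ^+ i * (- 2 * (x - c) 0 k)).
Proof.
apply: (is_derive_comp_line (g := fun t : R => t ^+ i.+1) (derive_z k x)).
have := @is_deriveX R R id i.+1 (rho ^+ 2 - S x) 1 1 (is_derive_id _ _).
rewrite /GRing.scale /= mulr1 (_ : id ^+ i.+1 = (fun t : R => t ^+ i.+1)) //.
by apply/funext => t; rewrite exprfctE.
Qed.

Lemma bump_derive k x : is_derive x (e_ k) bump (bump_d k x).
Proof.
have := derive_pow j.+1 k x; rewrite (_ : _ * _ * _ = bump_d k x) // /bump_d.
by ring.
Qed.

Lemma bump_d_derive k x : is_derive x (e_ k) (bump_d k) (bump_dd k x).
Proof.
have -> : bump_dd k x = - 2 * j.+2%:R * ((j.+1%:R * (rho ^+ 2 - S x) ^+ j * (- 2 * (x - c) 0 k))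
  * (x - c) 0 k +
    (rho ^+ 2 - S x) ^+ j.+1 * (k == k)%:R).
  by rewrite eqxx /bump_dd /=; ring.
by apply: derive_scale; apply: derive_mul; [exact: derive_pow|exact: derive_y].
Qed.

Lemma bump_continuous : continuous bump.
Proof.
move=> x; suff : {for x, continuous bump} by [].
apply: (continuous_at_comp (g := fun t : R => t ^+ j.+2)); last exact: exprn_continuous.
by apply: continuous_at_sub; [exact: continuous_at_cst|exact: S_cont].
Qed.

Lemma bump_laplacian x : \sum_k bump_dd k x =
  2 * j.+2%:R * (rho ^+ 2 - S x) ^+ j * (2 * j.+1%:R * S x - n%:R * (rho ^+ 2 - S x)).
Proof.
rewrite /bump_dd -mulr_sumr sumrB sumr_const card_ord -mulr_sumr -[\sum_i _]/(S x) -[_ *+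
  n]mulr_natl exprS.
by ring.
Qed.

End power.

Variables (u : 'rV[R]_n -> R) (d : 'I_n -> 'rV[R]_n -> R) (dd : 'I_n -> 'rV[R]_n -> R).
Hypotheses (cu : continuous u)
  (d_derive : forall k x, closed_ball x -> is_derive x (e_ k) u (d k x))
  (dd_derive : forall k x, closed_ball x -> is_derive x (e_ k) (d k) (dd k x)).

Let inside x : S x < rho ^+ 2 -> \forall y \near x, S y < rho ^+ 2.
Proof. by move=> h; exact: (@cvgr_lt _ _ (nbhs x) (nbhs_filter x) S (S x) (@S_cont x) _ h). Qed.

(* For [psi = (rho ^+ 2 - S) ^+ 2] one has [- Delta psi <= (n + 2) ^+ 2 / (2 * rho ^+ 2) * psi];
   compare [u] with [psi] at a maximum of [psi / u]. *)
Lemma eigenvalue_bound (K : R) : (forall x, closed_ball x -> 0 < u x) ->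
  (forall x, S x < rho ^+ 2 -> K * u x <= - (\sum_k dd k x)) -> K * rho ^+ 2 <= (n%:R + 2) ^+ 2 / 2.
Proof.
move=> u0 hK; rewrite leNgt; apply/negP => hbig.
have r2 : 0 < rho ^+ 2 by rewrite exprn_gt0.
pose psi := bump 0.
have [||x1] := @EVT_max_rV R n (fun x => psi x / u x) _ _ compact_eball.
- by exists c; rewrite /= ksq_center ltW.
- apply: continuous_in_subspaceT => x; rewrite inE => xB.
  apply: continuous_at_mul; first exact: bump_continuous.
  by apply: continuous_at_inv; [rewrite gt_eqF // u0|exact: cu].
rewrite inE /= => x1B x1max.
pose t := psi x1 / u x1.
have t0 : 0 < t.
  have cB : closed_ball c by rewrite /= ksq_center ltW.
  apply: lt_le_trans (x1max c _); last by rewrite inE.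
  by rewrite divr_gt0 ?u0 // /psi /bump ksq_center subr0 exprn_gt0.
have x1in : S x1 < rho ^+ 2.
  rewrite lt_neqAle x1B andbT; apply/eqP => e.
  by move: t0; rewrite /t /psi /bump e subrr expr0n mul0r ltxx.
have u1 := u0 x1 x1B.
have psiE : psi x1 = t * u x1 by rewrite /t divfK // gt_eqF.
have : \sum_k (bump_dd 0 k x1 - t * dd k x1) <= 0.
  apply: (@laplacian_at_max R n (fun x => psi x - t * u x) (fun k x => bump_d 0 k x - t * d k x)
    (fun k x => bump_dd 0 k x - t * dd k x)).
  - apply: filterS (inside x1in) => y /ltW yB k.
    by apply: derive_sub; [exact: bump_derive|apply: derive_scale; exact: d_derive].
  - by move=> k; apply: derive_sub; [exact: bump_d_derive|apply: derive_scale; exact: dd_derive].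
  - apply: filterS (inside x1in) => y /ltW yB.
    rewrite psiE subrr subr_le0 -ler_pdivrMr ?u0 //; apply: x1max; by rewrite inE.
rewrite sumrB bump_laplacian -mulr_sumr.
have := hK x1 x1in.
move: (\sum_k dd k x1) => D hD.
have zE : psi x1 = (rho ^+ 2 - S x1) ^+ 2 by [].
move: x1in; rewrite -subr_gt0; set z := rho ^+ 2 - S x1 in zE *.
have -> : S x1 = rho ^+ 2 - z by rewrite /z; ring.
rewrite expr0 => z0 h.
have h1 : K * z ^+ 2 <= 4 * (n%:R * z - 2 * (rho ^+ 2 - z)).
  rewrite -zE psiE.
  have : t * (K * u x1) <= t * (- D) by rewrite ler_pM2l.
  lra.
have h2 : (n%:R + 2) ^+ 2 / 2 * z ^+ 2 < K * rho ^+ 2 * z ^+ 2.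
  by rewrite ltr_pM2r // exprn_gt0.
have h3 : K * rho ^+ 2 * z ^+ 2 <= rho ^+ 2 * (4 * (n%:R * z - 2 * (rho ^+ 2 - z))).
  by rewrite [K * _]mulrC -mulrA ler_pM2l.
(* This square gives 4 rho^2 ((n + 2) z - 2 rho^2) <= (n + 2)^2 z^2 / 2, the origin of the
   constant. *)
have := sqr_ge0 ((n%:R + 2) * z - 4 * rho ^+ 2).
by clearbody z; move: h2 h3; move: (rho ^+ 2) (n%:R : R) => a b; lra.
Qed.

(* The power of [rho ^+ 2 - S] is chosen so large that it is strictly subharmonic
   outside a small ball around [c]; it is a lower barrier in the annulus. *)
Lemma positive_in_ball : (forall x, closed_ball x -> 0 <= u x) ->
  (forall x, S x < rho ^+ 2 -> \sum_k dd k x <= 0) -> 0 < u c ->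
  forall x, S x < rho ^+ 2 -> 0 < u x.
Proof.
move=> u0 hdd uc.
have r2 : 0 < rho ^+ 2 by rewrite exprn_gt0.
have : \forall x \near c, u c / 2 < u x /\ S x < rho ^+ 2.
  apply: (filterI (F := nbhs c)).
    by apply: (@cvgr_gt _ _ (nbhs c) (nbhs_filter c) u (u c) (@cu c)); lra.
  by apply: inside; rewrite ksq_center.
move=> /nbhs_ballP[s /= s0 hs].
have near_c x : S x < s ^+ 2 -> u c / 2 < u x /\ S x < rho ^+ 2.
  move=> xs; apply: hs; rewrite mx_norm_ball /ball_ /= distrC.
  by rewrite -(@ltr_pXn2r _ 2) ?nnegrE ?(ltW s0) // (le_lt_trans (norm_sqr_le_nsq _)).
have s2 : 0 < s ^+ 2 by rewrite exprn_gt0.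
pose j := Num.truncn (n%:R * rho ^+ 2 / s ^+ 2).
have jn : n%:R * rho ^+ 2 < 2 * j.+1%:R * s ^+ 2.
  have : n%:R * rho ^+ 2 / s ^+ 2 < j.+1%:R by exact: truncnS_gt.
  rewrite ltr_pdivrMr // => h; apply: lt_le_trans h _; rewrite ler_pM2r // ler_peMl //; lra.
(* The scaled barrier is at most [u c / 2] on the whole ball, hence below [u] near [c], where the
   barrier need not be subharmonic. *)
pose e := u c / (2 * (rho ^+ 2) ^+ j.+2).
have e0 : 0 < e by rewrite divr_gt0 // mulr_gt0 // exprn_gt0.
have main x : S x <= rho ^+ 2 -> e * bump j x <= u x.
  move=> xB.
  have [||x1] := @EVT_max_rV R n (fun x => e * bump j x - u x) _ _ compact_eball.
  - by exists c; rewrite /= ksq_center ltW.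
  - apply: continuous_subspaceT => y; suff : {for y, continuous (fun x => e * bump j x - u x)} by
    [].
    apply: continuous_at_sub; last exact: cu.
    by apply: continuous_at_mul; [exact: continuous_at_cst|exact: bump_continuous].
  rewrite inE /= => x1B x1max.
  rewrite -subr_le0; apply: (@le_trans _ _ (e * bump j x1 - u x1)); first by apply: x1max;
    rewrite inE.
  rewrite leNgt; apply/negP => pos.
  have x1s : s ^+ 2 <= S x1.
    rewrite leNgt; apply/negP => /near_c[h _].
    have hb : bump j x1 <= (rho ^+ 2) ^+ j.+2.
      rewrite /bump; apply: lerXn2r; rewrite ?nnegrE ?subr_ge0 ?(ltW r2) // gerBl; exact: ksq_ge0.
    have : e * bump j x1 <= e * (rho ^+ 2) ^+ j.+2 by rewrite ler_pM2l.
    have -> : e * (rho ^+ 2) ^+ j.+2 = u c / 2.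
      have B0 : (rho ^+ 2) ^+ j.+2 != 0 by rewrite gt_eqF ?exprn_gt0.
      by rewrite /e; move: B0; move: ((rho ^+ 2) ^+ j.+2) => B B0; field.
    by move: h pos; lra.
  have x1in : S x1 < rho ^+ 2.
    rewrite lt_neqAle x1B andbT; apply/eqP => eq.
    by move: pos; rewrite /bump eq subrr expr0n mulr0 sub0r oppr_gt0 ltNge u0.
  have : \sum_k (e * bump_dd j k x1 - dd k x1) <= 0.
    apply: (@laplacian_at_max R n (fun x => e * bump j x - u x) (fun k x => e * bump_d j k x - d
      k x)
      (fun k x => e * bump_dd j k x - dd k x)).
    - apply: filterS (inside x1in) => y /ltW yB k.
      by apply: derive_sub; [apply: derive_scale; exact: bump_derive|exact: d_derive].
    - by move=> k; apply: derive_sub; [apply: derive_scale; exact: bump_d_derive|exact: dd_derive].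
    - by apply: filterS (inside x1in) => y /ltW yB; apply: x1max; rewrite inE.
  rewrite sumrB -[\sum_k e * _]mulr_sumr bump_laplacian leNgt => /negP; apply.
  have := hdd x1 x1in; move: (\sum_k dd k x1) => D D0.
  rewrite subr_gt0; apply: le_lt_trans D0 _.
  rewrite mulr_gt0 // mulr_gt0 //.
    by rewrite mulr_gt0 ?exprn_gt0 ?subr_gt0 // mulr_gt0.
  rewrite subr_gt0.
  apply: (@le_lt_trans _ _ (n%:R * rho ^+ 2)); first by rewrite ler_wpM2l // gerBl ksq_ge0.
  by apply: lt_le_trans jn _; rewrite ler_wpM2l // mulr_ge0.
move=> x xin; apply: lt_le_trans (main x (ltW xin)).
by rewrite mulr_gt0 // exprn_gt0 // subr_gt0.
Qed.

End barrier.

Section powers.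
Context {R : realType}.

(** The power of T with which [K * (kap * T) ^+ 2] grows in the cone. For n > 2 its positivity is
    [p < p_c n a] itself; for n = 2 it reduces to [-2 < a]. *)
Lemma growth_exponent (n : nat) (a p : R) : (1 < n)%N -> -2 < a -> (p%:E < p_c n a)%E ->
  0 < 2 + a - (p - 1) * ((n%:R - 2) / 2).
Proof.
move=> n1 a2; rewrite /p_c; case: ifP => [n2|/negbT n2 _]; last first.
  have nE : n = 2%N by apply/eqP; rewrite eqn_leq n1 leqNgt n2.
  by rewrite nE subrr mul0r mulr0 subr0; lra.
have m0 : 0 < n%:R - 2 :> R by rewrite subr_gt0 (ltr_nat R 2).
by rewrite lte_fin ltr_pdivlMr //; lra.
Qed.

Lemma power_large (g c B R0 : R) : 0 < g -> 0 < c -> exists T : R, [/\ 0 < T, R0 <= T & B < c * T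
  `^ g].
Proof.
move=> g0 c0; pose t := `|B| / c + 1.
have t0 : 0 < t by rewrite ltr_wpDl // divr_ge0 // ltW.
pose T := Num.max (t `^ g^-1) R0.
have tT : t `^ g^-1 <= T by rewrite le_max lexx.
have T0 : 0 < T by apply: lt_le_trans tT; rewrite powR_gt0.
exists T; split=> //; first by rewrite le_max lexx orbT.
have h : t <= T `^ g.
  have -> : t = (t `^ g^-1) `^ g by rewrite -powRrM mulVf ?gt_eqF // powRr1 // ltW.
  by apply: ge0_ler_powR; rewrite ?nnegrE ?powR_ge0 // ltW.
apply: lt_le_trans (_ : c * t <= _); last by rewrite ler_pM2l.
rewrite mulrDr mulrCA divff ?gt_eqF // !mulr1; have := ler_norm B; lra.
Qed.

Lemma powR_between (w a : R) : 2^-1 <= w -> w <= 2 -> Num.min (2 `^ a) (2^-1 `^ a) <= w `^ a.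
Proof.
move=> w1 w2; have w0 : 0 < w by apply: lt_le_trans w1.
have [a0|a0] := leP 0 a.
  rewrite ge_min; apply/orP; right; apply: ge0_ler_powR; rewrite ?nnegrE // ltW //.
rewrite ge_min; apply/orP; left.
rewrite -(opprK a) (powRN w) (powRN 2) lef_pV2 ?posrE ?powR_gt0 //.
by apply: ge0_ler_powR; rewrite ?nnegrE ?oppr_ge0 // ltW.
Qed.

End powers.

(** * Growth along the cone *)

Section cone_growth.
Context {R : realType} {n : nat}.
Local Notation e_ k := (delta_mx 0 k : 'rV[R]_n).
Variables (P : 'rV[R]_n) (Omega : set 'rV[R]_n)
  (u : 'rV[R]_n -> R) (d : 'I_n -> 'rV[R]_n -> R) (dd : 'I_n -> 'rV[R]_n -> R)
  (f : 'rV[R]_n -> R -> R).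
Local Notation S := (ksq P).
Local Notation m := ((n%:R - 2) / 2).
Hypotheses (n1 : (1 < n)%N)
  (dil : forall x (t : R), Omega x -> 1 <= t -> Omega (P + t *: (x - P)))
  (cu : continuous u) (u_gt0 : forall x, Omega x -> 0 < u x)
  (d_derive : forall k x, Omega x -> is_derive x (e_ k) u (d k x))
  (dd_derive : forall k x, Omega x -> is_derive x (e_ k) (d k) (dd k x))
  (pde : forall x, Omega x -> - (\sum_k dd k x) = f x (u x))
  (mono : forall x (t : R), Omega x -> 1 <= t -> u x <= t `^ m * u (P + t *: (x - P))).
Variables (r : R) (Sigma : set 'rV[R]_n) (C a p : R).
Hypotheses (r0 : 0 < r) (cs : cross_section Sigma) (SO : Sigma `<=` section_at Omega P r)
  (C0 : 0 < C) (a2 : -2 < a) (p1 : 1 <= p) (pc : (p%:E < p_c n a)%E)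
  (growth : forall x (v : R), cone_out P Sigma r x -> 0 <= v ->
      C * enorm (x - P) `^ a * v `^ p <= f x v).

Let section_in w : Sigma w -> Omega (P + r *: w).
Proof.
move=> /SO [y [_ yO] <-]; rewrite scalerA divff ?gt_eqF // scale1r addrC subrK //.
Qed.

Let enorm_cont (x : 'rV[R]_n) : {for x, continuous (@enorm R n)}.
Proof. by apply: continuous_at_comp; [exact: nsq_continuous|exact: sqrt_continuous]. Qed.

(** [Sigma] is open only relative to the unit sphere; the radial projection, continuous near [s0],
    pulls it back to a neighbourhood in space. *)
Lemma cone_neighbourhood : exists (s0 : 'rV[R]_n) (e c0 : R), [/\ 0 < e, 0 < c0 & forall v, `|v -
  s0| < e ->
  [/\ 2^-1 <= enorm v <= 2, Sigma ((enorm v)^-1 *: v) & c0 <= u (P + r *: ((enorm v)^-1 *: v))]].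
Proof.
case: cs => [[V oV SE] _ [s0 Ss0]].
have [Vs0] : (V `&` esphere 0 1) s0 by rewrite -SE.
rewrite /esphere /= subr0 => s01.
pose w (v : 'rV[R]_n) := (enorm v)^-1 *: v.
have ws0 : w s0 = s0 by rewrite /w s01 invr1 scale1r.
have wc : w v @[v --> s0] --> w s0.
  apply: (@cvgZ _ _ _ (nbhs s0) (nbhs_filter s0)); last exact: cvg_id.
  by apply: continuous_at_inv; [rewrite s01 oner_eq0|exact: enorm_cont].
have u0 := u_gt0 (section_in Ss0).
have uwc : u (P + r *: w v) @[v --> s0] --> u (P + r *: s0).
  rewrite -[in X in _ --> X]ws0.
  apply: (@continuous_comp _ _ _ w (fun x => u (P + r *: x)) s0 wc).
  apply: (@continuous_comp _ _ _ (fun x : 'rV[R]_n => P + r *: x) u); last exact: cu.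
  move=> Q hQ; exact: near_affine.
have nV : \forall v \near s0, V (w v).
  have hV : nbhs (w s0) V by apply: open_nbhs_nbhs; split=> //; rewrite ws0.
  exact: (wc _ hV).
have nu : \forall v \near s0, u (P + r *: s0) / 2 < u (P + r *: w v).
  by apply: (@cvgr_gt _ _ (nbhs s0) (nbhs_filter s0) _ _ uwc); lra.
have n_1 : \forall v \near s0, enorm v < 2.
  by apply: (@cvgr_lt _ _ (nbhs s0) (nbhs_filter s0) _ _ (@enorm_cont s0)); rewrite s01; lra.
have n_2 : \forall v \near s0, 2^-1 < enorm v.
  by apply: (@cvgr_gt _ _ (nbhs s0) (nbhs_filter s0) _ _ (@enorm_cont s0)); rewrite s01; lra.
have /nbhs_ballP[e /= e0 he] : \forall v \near s0, [/\ V (w v), u (P + r *: s0) / 2 < u (P + r *: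
  w v),
    enorm v < 2 & 2^-1 < enorm v].
  have FF := nbhs_filter s0.
  have h1 := @filterI _ _ FF _ _ nV nu; have h2 := @filterI _ _ FF _ _ n_1 n_2.
  by apply: filterS (@filterI _ _ FF _ _ h1 h2) => v [[? ?] [? ?]].
exists s0, e, (u (P + r *: s0) / 2); split=> //; first by rewrite divr_gt0.
move=> v vs; have [|h1 h2 h3 h4] := he v; first by rewrite mx_norm_ball /ball_ /= distrC.
have v0 : 0 < enorm v by apply: lt_trans h4.
split; last exact: ltW.
- by rewrite (ltW h3) (ltW h4).
- rewrite SE; split=> //; rewrite /esphere /= subr0 enormZ gtr0_norm ?invr_gt0 //.
  by rewrite mulVf // gt_eqF.
Qed.

(* In the balls of centre [P + T *: s0] and radius [kap * T] the solution satisfies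
   [- Delta u >= K * u], where [K * (kap * T) ^+ 2] is unbounded in T. *)
Lemma no_supersolution : False.
Proof.
have [s0 [e [c0 [e0 c00 hv]]]] := cone_neighbourhood.
pose ca : R := Num.min (2 `^ a) (2^-1 `^ a).
have ca0 : 0 < ca by rewrite lt_min !powR_gt0.
pose kap := e / 2; have kap0 : 0 < kap by rewrite divr_gt0.
pose g0 : R := (2 / r) `^ m.
have g00 : 0 < g0 by rewrite powR_gt0 // divr_gt0.
pose cst := C * ca * (c0 / g0) `^ (p - 1) * kap ^+ 2.
have cst0 : 0 < cst by rewrite !mulr_gt0 ?exprn_gt0 // powR_gt0 // divr_gt0.
have gam0 := growth_exponent n1 a2 pc.
(* With [T > 2 * r] the ball, where the distance to [P] is at least T / 2, stays out of the closed
   ball of radius [r], as [cone_out] demands. *)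
have [T [T0 Tr hT]] := power_large ((n%:R + 2) ^+ 2 / 2) (2 * r + 1) gam0 cst0.
(* A lower bound on the ball for C |x - P|^a u^(p - 1): [ca] accounts for |x - P| / T lying between
   1/2 and 2, whatever the sign of [a]. *)
pose K := C * T `^ a * ca * (c0 / (g0 * T `^ m)) `^ (p - 1).
have TmE : 0 < T `^ m by rewrite powR_gt0.
have KE : K * (kap * T) ^+ 2 = cst * T `^ (2 + a - (p - 1) * m).
  have -> : K = C * T `^ a * ca * ((c0 / g0) `^ (p - 1) * (T `^ m)^-1 `^ (p - 1)).
    rewrite /K -powRM ?divr_ge0 ?invr_ge0 ?(ltW c00) ?(ltW g00) ?(ltW TmE) //.
    by rewrite invfM [c0 * (_ * _)]mulrA.
  have -> : (T `^ m)^-1 `^ (p - 1) = T `^ (- ((p - 1) * m)).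
    by rewrite -powRN -powRrM; congr (_ `^ _); ring.
  have -> : T `^ (2 + a - (p - 1) * m) = T ^+ 2 * T `^ a * T `^ (- ((p - 1) * m)).
    rewrite powRD; last by rewrite (gt_eqF T0) implybT.
    rewrite powRD; last by rewrite (gt_eqF T0) implybT.
    by rewrite powR_mulrn // ltW.
  by rewrite /cst exprMn; ring.
pose x0 := P + T *: s0.
have inball x : ksq x0 x <= (kap * T) ^+ 2 -> let v := T^-1 *: (x - P) in `|v - s0| < e.
  move=> xb /=; have kT0 : 0 <= kap * T by rewrite mulr_ge0 // ltW.
  have : `|x - x0| <= kap * T.
    by rewrite -(@ler_pXn2r _ 2) ?nnegrE // (le_trans (norm_sqr_le_nsq _)).
  have -> : T^-1 *: (x - P) - s0 = T^-1 *: (x - x0).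
    by apply/rowP => i; rewrite !mxE; field; rewrite gt_eqF.
  move=> h; rewrite normrZ gtr0_norm ?invr_gt0 // ltr_pdivrMl // mulrC.
  by apply: le_lt_trans h _; rewrite ltr_pM2r // /kap; lra.
have facts x : ksq x0 x <= (kap * T) ^+ 2 -> [/\ Omega x, cone_out P Sigma r x,
    T * 2^-1 <= enorm (x - P) <= T * 2 & c0 / (g0 * T `^ m) <= u x].
  move=> /inball /= hb; set v := T^-1 *: (x - P) in hb.
  have [/andP[v1 v2] Sv uv] := hv v hb.
  have v0 : 0 < enorm v by apply: lt_le_trans v1.
  have xE : x - P = T *: v by rewrite /v scalerA divff ?gt_eqF // scale1r.
  have xn : enorm (x - P) = T * enorm v by rewrite xE enormZ gtr0_norm.
  set w := (enorm v)^-1 *: v in Sv uv.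
  have xw : x - P = (T * enorm v) *: w by rewrite /w scalerA mulfK ?gt_eqF.
  (* [x] is the dilate by [t] of the point of its ray at distance [r] from [P], where [u] is at
     least [c0]; [mono] transports this bound to [x], at the cost of t^m with [t <= 2 / r * T]. *)
  pose t := T * enorm v / r.
  have T2 : r < T * enorm v.
    apply: (@lt_le_trans _ _ (T * 2^-1)); first by move: Tr; lra.
    by rewrite ler_pM2l.
  have t1 : 1 <= t by rewrite /t ler_pdivlMr // mul1r ltW.
  have xt : x = P + t *: (P + r *: w - P).
    by rewrite [P + r *: w]addrC addrK scalerA /t divfK ?gt_eqF // -xw addrC subrK.
  have bO := section_in Sv.
  split.
  - by rewrite xt; exact: dil.
  - split.
      exists (T * enorm v); first by rewrite /= mulr_gt0.
      by exists w => //; rewrite -xw subrK.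
    move=> cl; have : S x <= r ^+ 2.
      apply: (closure_le (@continuous_at_ksq R n P x) cl) => y [_].
      rewrite /eball /= => h; rewrite /ksq -enorm_sqr ler_pXn2r ?nnegrE ?(ltW r0) ?(ltW h) //.
      exact: enorm_ge0.
    rewrite /ksq -enorm_sqr xn leNgt ltr_pXn2r ?nnegrE ?T2 ?(ltW r0) //.
    by rewrite (le_trans (ltW r0)) // ltW.
  - by rewrite xn !ler_pM2l // v1 v2.
  have h := le_trans uv (mono bO t1); rewrite -xt in h.
  rewrite ler_pdivrMr ?mulr_gt0 // mulrC; apply: le_trans h _.
  rewrite ler_wpM2r; [by []|rewrite ltW // u_gt0 // xt; exact: dil|].
  rewrite /g0 -powRM ?divr_ge0 ?(ltW T0) ?(ltW r0) //.
  have m0 : 0 <= m :> R by apply: divr_ge0 => //; rewrite subr_ge0 (ler_nat R 2).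
  have t_ge0 : 0 <= t by exact: le_trans t1.
  have tT : t <= 2 / r * T.
    by rewrite /t [2 / r * T]mulrAC ler_pM2r ?invr_gt0 // mulrC ler_pM2r.
  by apply: ge0_ler_powR => //; rewrite nnegrE // (le_trans t_ge0).
have kT : 0 < kap * T by rewrite mulr_gt0.
have : K * (kap * T) ^+ 2 <= (n%:R + 2) ^+ 2 / 2.
  apply: (@eigenvalue_bound R n x0 (kap * T) kT u d dd cu).
  - by move=> k x /facts[xO _ _ _]; exact: d_derive.
  - by move=> k x /facts[xO _ _ _]; exact: dd_derive.
  - by move=> x /facts[xO _ _ _]; exact: u_gt0.
  move=> x /ltW /facts[xO xc /andP[x1 x2] ux].
  rewrite pde //; have u0 := u_gt0 xO; apply: le_trans (growth xc (ltW u0)).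
  have xn0 : 0 <= enorm (x - P) by exact: enorm_ge0.
  have -> : u x `^ p = u x `^ (p - 1) * u x.
    by rewrite -[X in _ * X](powRr1 (ltW u0)) -powRD ?subrK // (gt_eqF u0) implybT.
  rewrite mulrA ler_pM2r // /K; apply: ler_pM; rewrite ?mulr_ge0 ?powR_ge0 ?(ltW C0) ?(ltW ca0) //.
    rewrite -mulrA ler_pM2l //.
    have -> : enorm (x - P) = T * (enorm (x - P) / T) by rewrite mulrC divfK // gt_eqF.
    rewrite powRM ?divr_ge0 ?(ltW T0) //; apply: ler_wpM2l; first exact: powR_ge0.
    apply: powR_between; first by rewrite ler_pdivlMr // mulrC.
    by rewrite ler_pdivrMr // mulrC.
  apply: ge0_ler_powR; rewrite ?nnegrE ?subr_ge0 ?(ltW u0) ?divr_ge0 ?mulr_ge0 ?(ltW c00) ?(ltW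
    g00) ?(ltW TmE) //.
by rewrite KE leNgt hT.
Qed.

End cone_growth.

(** * The strong maximum principle *)

Section strong_maximum_principle.
Context {R : realType} {n : nat}.
Local Notation e_ k := (delta_mx 0 k : 'rV[R]_n).
Variables (Omega : set 'rV[R]_n)
  (u : 'rV[R]_n -> R) (d : 'I_n -> 'rV[R]_n -> R) (dd : 'I_n -> 'rV[R]_n -> R).
Hypotheses (oO : open Omega) (conO : connected Omega)
  (cu : continuous u) (u_ge0 : forall x, Omega x -> 0 <= u x)
  (d_derive : forall k x, Omega x -> is_derive x (e_ k) u (d k x))
  (dd_derive : forall k x, Omega x -> is_derive x (e_ k) (d k) (dd k x))
  (super : forall x, Omega x -> \sum_k dd k x <= 0).

(** The positivity set is relatively closed: a limit point [x] lies in a ball contained in [Omega]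
    and centred at a nearby point of positivity, to which [positive_in_ball] applies. *)
Lemma strong_maximum_principle x0 : Omega x0 -> 0 < u x0 -> forall x, Omega x -> 0 < u x.
Proof.
move=> x0O ux0; pose B := Omega `&` [set x | 0 < u x].
suff BE : B = Omega by move=> x; rewrite -BE => -[].
have oV : open [set x | 0 < u x].
  rewrite openE => x ux.
  exact: (@cvgr_gt _ _ (nbhs x) (nbhs_filter x) u (u x) (@cu x)).
apply: conO; first by exists x0.
- by exists [set x | 0 < u x].
exists (closure B); first exact: closed_closure.
apply/seteqP; split=> [x xB|x [xO cB]]; first by split; [case: xB|exact: subset_closure].
split=> //=.
have /nbhs_ballP[s /= s0 hs] := near_in oO xO.
(* The ball of radius s / 3 around a point within s / 3 of [x] contains [x] and stays in the ball of
   radius s. *)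
have r0 : 0 < s / 3 by rewrite divr_gt0.
have near_x : \forall y \near x, ksq x y < (s / 3) ^+ 2.
  apply: (@cvgr_lt _ _ (nbhs x) (nbhs_filter x) (ksq x) _ (@continuous_at_ksq R n x x)).
  by rewrite ksq_center exprn_gt0.
have [y [[yO uy] yx]] := cB _ near_x.
have norm_le (z w : 'rV[R]_n) : ksq z w <= (s / 3) ^+ 2 -> `|w - z| <= s / 3.
  move=> h; rewrite -(@ler_pXn2r _ 2) ?nnegrE ?(ltW r0) //.
  exact: le_trans (norm_sqr_le_nsq _) h.
have inO z : ksq y z <= (s / 3) ^+ 2 -> Omega z.
  move=> /norm_le h1; apply: hs; rewrite mx_norm_ball /ball_ /= distrC.
  have h2 := norm_le _ _ (ltW yx).
  have := ler_normD (z - y) (y - x); rewrite addrA subrK; lra.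
apply: (@positive_in_ball R n y (s / 3) r0 u d dd cu).
- by move=> k z /inO; exact: d_derive.
- by move=> k z /inO; exact: dd_derive.
- by move=> z /inO; exact: u_ge0.
- by move=> z /ltW /inO; exact: super.
- exact: uy.
suff -> : ksq y x = ksq x y by [].
by apply: eq_bigr => i _; rewrite !mxE -sqrrN opprB.
Qed.

End strong_maximum_principle.

(** * Nonexistence *)

Section solution.
Context {R : realType} {n : nat}.
Local Notation e_ k := (delta_mx 0 k : 'rV[R]_n).
Local Notation T := (caratheodory_type (@lebesgue_outer R n)).
Variables (Omega : set 'rV[R]_n) (P : 'rV[R]_n) (f : 'rV[R]_n -> R -> R) (q : R).
Hypotheses (n1 : (1 < n)%N) (q1 : 1 < q) (nq : n%:R / 2 <= q)
  (dO : domain Omega) (conv : g_radially_convex (~` closure Omega) P)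
  (PO : (~` closure Omega) P) (lip : lipschitz_boundary Omega)
  (sub : subcritical Omega P f) (flip : locally_Lq_lipschitz Omega q f)
  (growth : exists (r : R) (Sigma : set 'rV[R]_n) (C a p : R),
    dist_inf Omega P < r /\
    cross_section Sigma /\ Sigma `<=` section_at Omega P r /\
    0 < C /\ -2 < a /\ 1 <= p /\ (p%:E < p_c n a)%E /\
    forall x (u : R), cone_out P Sigma r x -> 0 <= u ->
      C * enorm (x - P) `^ a * u `^ p <= f x u).

Lemma no_positive_solution (u : 'rV[R]_n -> R) : classical_solution Omega f u ->
  (forall x, Omega x -> 0 < u x) -> False.
Proof.
move=> [C2u cu u0 pde] u_gt0.
have [oO conO O0] := dO.
have dil := dilation_invariant dO conv lip.
have [d0 d00 away] := away_from_center PO.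
have {}cu := continuous_extension oO cu u0.
pose d k := partial k u; pose dd i j := partial j (partial i u).
have d_cont k x : Omega x -> {for x, continuous (d k)} by move=> /C2u[_ h _]; case: (h k).
have d_derive k x : Omega x -> is_derive x (e_ k) u (d k x).
  by move=> /C2u[_ h _]; case: (h k) => + _; exact: derivableP.
have dd_derive i j x : Omega x -> is_derive x (e_ j) (d i) (dd i j x).
  by move=> /C2u[_ _ h]; case: (h i j) => + _; exact: derivableP.
have dd_cont i j x : Omega x -> {for x, continuous (dd i j)}.
  by move=> /C2u[_ _ h]; case: (h i j).
have S0 x : Omega x -> 0 < ksq P x by move=> /away; exact: lt_le_trans.
have ratio1 lam x : Omega x -> ksq P x < lam ^+ 2 -> Omega (kinv P lam x).
  by move=> xO xl; apply: dil => //; rewrite /kratio ler_pdivlMr ?S0 // mul1r ltW.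
have strict : forall lam x, 0 < lam -> Omega x -> ksq P x < lam ^+ 2 -> u x < kelvin P lam u x.
  apply: (@kelvin_strict R n P Omega q d0 u d dd f n1 q1 nq oO d00 away dil cu u0 u_gt0 d_cont
    d_derive dd_derive dd_cont pde _ _).
  - move=> lam x l0 xO xl; have yO := ratio1 lam x xO xl.
    by apply: (subcritical_kelvin n1 sub) => //; [exact: S0|exact: u_gt0].
  - move=> L M L0 M0; have mD := measurable_region oO L.
    have [||H [[mH iH] hH]] := @lipschitz_weight R n Omega f q (lt_trans ltr01 q1) flip _ M mD _
      _ (ltW M0).
    + by exists L; split; [exact: num_real|move=> M' LM x [_ xL]; exact: ltW (lt_trans xL LM)].
    + by move=> x [].
    exists H; split; [exact: mH|exact: iH|move=> x xO xL; apply: hH].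
    by split.
have mono x (t : R) : Omega x -> 1 <= t -> u x <= t `^ ((n%:R - 2) / 2) * u (P + t *: (x - P)).
  move=> xO; rewrite le_eqVlt => /orP[/eqP <-|t1].
    by rewrite powR1 mul1r scale1r addrC subrK.
  have t0 : 0 < t by apply: lt_trans t1.
  have Sx := S0 x xO.
  (* For this radius the inversion ratio at [x] is [t], so the reflected point is the dilate of [x]
     by [t]; letting the radius vary yields the monotonicity along rays. *)
  have lE : Num.sqrt (t * ksq P x) ^+ 2 = t * ksq P x by rewrite sqr_sqrtr // ltW // mulr_gt0.
  have := strict (Num.sqrt (t * ksq P x)) x; rewrite sqrtr_gt0 mulr_gt0 // lE => /(_ isT xO).
  rewrite /kelvin /kweight /kinv /kratio lE mulfK ?gt_eqF // => h; apply: ltW; apply: h.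
  by rewrite ltr_pMl.
have [r [Sigma [C [a [p [dr [cs [SO [C0 [a2 [p1 [pc fg]]]]]]]]]]]] := growth.
have r0 : 0 < r.
  apply: le_lt_trans dr; apply: lb_le_inf.
    by case: O0 => x xO; exists (enorm (x - P)), x.
  by move=> _ [x _ <-]; exact: enorm_ge0.
exact: (@no_supersolution R n P Omega u d (fun k => dd k k) f n1 dil cu u_gt0 d_derive
  (fun k => dd_derive k k) pde mono r Sigma C a p r0 cs SO C0 a2 p1 pc fg).
Qed.

Lemma nonnegative_solution (u : 'rV[R]_n -> R) : (forall x (v : R), Omega x -> 0 <= v -> 0 <= f x
  v) ->
  classical_solution Omega f u -> (forall x, Omega x -> 0 <= u x) -> forall x, Omega x -> u x = 0.
Proof.
move=> f0 su u_ge0 x xO; apply/eqP; apply: contrapT => /negP ux.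
have [C2u cu u0 pde] := su.
have [oO conO O0] := dO.
apply: (no_positive_solution su).
apply: (@strong_maximum_principle R n Omega u (fun k => partial k u)
  (fun k => partial k (partial k u)) oO conO _ u_ge0 _ _ _ x xO).
- exact: continuous_extension oO cu u0.
- by move=> k y /C2u[_ h _]; case: (h k) => + _; exact: derivableP.
- by move=> k y /C2u[_ _ h]; case: (h k k) => + _; exact: derivableP.
- move=> y yO; rewrite -oppr_ge0 -[X in - X]/(laplacian u y) pde //.
  by apply: f0 => //; exact: u_ge0.
- by rewrite lt_def ux u_ge0.
Qed.

End solution.

Theorem theorem1p15 (R : realType) (n : nat) (hn : (2 <= n)%N)
  (Omega : set 'rV[R]_n) (P : 'rV[R]_n)
  (hMSS : MSS_applicable Omega P)
  (hconv : g_radially_convex (~` closure Omega) P)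
  (hP : (~` closure Omega) P)
  (hLip : lipschitz_boundary Omega)
  (f : 'rV[R]_n -> R -> R)
  (ha : subcritical Omega P f)
  (hb : exists (r : R) (Sigma : set 'rV[R]_n) (C a p : R),
    dist_inf Omega P < r /\
    cross_section Sigma /\ Sigma `<=` section_at Omega P r /\
    0 < C /\ -2 < a /\ 1 <= p /\ (p%:E < p_c n a)%E /\
    forall x (u : R), cone_out P Sigma r x -> 0 <= u ->
      C * enorm (x - P) `^ a * u `^ p <= f x u)
  (hc : exists2 u0 : R, 0 <= u0 &
    forall rho : R, 0 < rho -> Lq_on (Omega `&` eball P rho) 1 (f ^~ u0))
  (delta : R) (hdelta : 0 < delta)
  (hd : locally_Lq_lipschitz Omega
    (if (2 < n)%N then n%:R / 2 else 1 + delta) f) :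
  (~ exists u : 'rV[R]_n -> R,
       classical_solution Omega f u /\ forall x, Omega x -> 0 < u x) /\
  ((forall x (u : R), Omega x -> 0 <= u -> 0 <= f x u) ->
   forall u : 'rV[R]_n -> R, classical_solution Omega f u ->
     (forall x, Omega x -> 0 <= u x) -> forall x, Omega x -> u x = 0).
Proof.
case: hMSS => dO _ _; set q := (if _ then _ else _) in hd.
(* [1 < q] provides a finite conjugate exponent and [n / 2 <= q] makes the Sobolev exponent
   sufficient; in dimension 2 the first comes from [delta > 0]. *)
have [q1 nq] : 1 < q /\ n%:R / 2 <= q.
  rewrite /q; case: ifP => [n2|/negbT n2].
    by rewrite lexx ltr_pdivlMr // mul1r (ltr_nat R 2).
  have -> : n = 2%N by apply/eqP; rewrite eqn_leq hn leqNgt n2.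
  by rewrite divff // ltrDl lerDl hdelta ltW.
split=> [[u [su u_gt0]]|f0 u su u_ge0].
  exact: (no_positive_solution hn q1 nq dO hconv hP hLip ha hd hb su u_gt0).
exact: (nonnegative_solution hn q1 nq dO hconv hP hLip ha hd hb f0 su u_ge0).
Qed.
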